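(* Let $\Gamma$ be a discrete countable amenable group. Then $\Gamma$ is MF if and only if the C*-algebra $C^*(\Gamma)$ is quasidiagonal.
   Context: For an increasing sequence $\vec n=(n_k)$ of positive integers let $Q_{\vec n}=\prod_k M_{n_k}(\mathbb{C})\big/\sum_k M_{n_k}(\mathbb{C})$, where $\prod_k M_{n_k}(\mathbb{C})$ is the C*-algebra of sequences $(a_k)$, $a_k\in M_{n_k}(\mathbb{C})$, with $\sup_k\|a_k\|<\infty$, and $\sum_k M_{n_k}(\mathbb{C})$ is the closed ideal of sequences with $\|a_k\|\to0$. A countable group is MF if it embeds (as a group) in the unitary group of $Q_{\vec n}$ for some $\vec n$ (equivalently, for $\vec n=(1,2,3,\dots)$). A separable set $\Omega\subset B(H)$, $H$ a separable Hilbert space, is quasidiagonal if there is an increasing sequence of compact (hence finite-rank) self-adjoint projections $P_n$ with $P_n\to1_H$ strongly and $\|P_nT-TP_n\|\to0$ for every $T\in\Omega$. A separable C*-algebra is quasidiagonal if it has a faithful representation on a separable Hilbert space whose image is a quasidiagonal set of operators. $C^*(\Gamma)$ is the full group C*-algebra (which coincides with the reduced one when $\Gamma$ is amenable). *)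

(* Defs.v *)
From HB Require Import structures.
From mathcomp Require Import all_boot all_order all_algebra sesquilinear.
From mathcomp Require Import finmap.
From mathcomp Require Import boolp classical_sets functions cardinality fsbigop.
From mathcomp Require Import reals topology normedtype sequences.
From mathcomp Require Import complex.

Set Implicit Arguments.
Unset Strict Implicit.
Unset Printing Implicit Defensive.

Import Order.TTheory GRing.Theory Num.Theory Num.Def.
Import numFieldNormedType.Exports.

Local Open Scope classical_set_scope.
Local Open Scope ring_scope.

Reserved Notation "a *c u" (at level 40, u at next level).

(* Complex unital *-algebras, possibly zero.  MathComp's [lalgType] requires
   [1 != 0], which fails for 'M_0 and for quotients by improper ideals, and
   Hierarchy-Builder does not allow to join [pzRingType] and [lmodType] anew;
   hence a separate scalar multiplication [cscale], written [a *c u]. *)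
HB.mixin Record isStarAlgebra (C : numClosedFieldType) A of GRing.PzRing A := {
  cscale : C -> A -> A;
  star : A -> A;
  cscaleA : forall a b u, cscale a (cscale b u) = cscale (a * b) u;
  cscale1 : forall u, cscale 1 u = u;
  cscaleDr : forall a u v, cscale a (u + v) = cscale a u + cscale a v;
  cscaleDl : forall a b u, cscale (a + b) u = cscale a u + cscale b u;
  cscaleAl : forall a u v, cscale a (u * v) = cscale a u * v;
  cscaleAr : forall a u v, cscale a (u * v) = u * cscale a v;
  starK : involutive star;
  starD : {morph star : u v / u + v};
  starZ : forall a u, star (cscale a u) = cscale a^* (star u);
  starM : forall u v, star (u * v) = star v * star u
}.

#[short(type="starAlgType")]
HB.structure Definition StarAlgebra (C : numClosedFieldType) :=
  {A of GRing.PzRing A & isStarAlgebra C A}.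

Notation "a *c u" := (cscale a u) : ring_scope.

Section StarTheory.
Context (C : numClosedFieldType) (A : starAlgType C).
Implicit Types u v : A.

Definition unitary (u : A) : Prop := star u * u = 1 /\ u * star u = 1.

Lemma star0 : star (0 : A) = 0.
Proof. by apply: (addrI (star 0)); rewrite -starD !addr0. Qed.

Lemma cscale0 (a : C) : a *c (0 : A) = 0.
Proof. by apply: (addrI (a *c 0)); rewrite -cscaleDr !addr0. Qed.

Lemma cscaleN (a : C) u : a *c (- u) = - (a *c u).
Proof. by apply/eqP; rewrite -addr_eq0 -cscaleDr addNr cscale0. Qed.

Lemma cscaleB (a : C) u v : a *c (u - v) = a *c u - a *c v.
Proof. by rewrite cscaleDr cscaleN. Qed.

Lemma starN u : star (- u) = - star u.
Proof. by apply/eqP; rewrite -addr_eq0 -starD addNr star0. Qed.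

Lemma starB u v : star (u - v) = star u - star v.
Proof. by rewrite starD starN. Qed.

Lemma star1 : star (1 : A) = 1.
Proof. by rewrite -[LHS]mulr1 -[X in _ * X]starK -starM mulr1 starK. Qed.

End StarTheory.

Record starSubalg (C : numClosedFieldType) (A : starAlgType C) := StarSubalg {
  ss_set :> A -> Prop;
  ss1 : ss_set 1;
  ssB : forall u v, ss_set u -> ss_set v -> ss_set (u - v);
  ssZ : forall (a : C) u, ss_set u -> ss_set (a *c u);
  ssM : forall u v, ss_set u -> ss_set v -> ss_set (u * v);
  ssS : forall u, ss_set u -> ss_set (star u)
}.

Definition subalg (C : numClosedFieldType) (A : starAlgType C)
  (S : starSubalg A) : Type := {u : A | S u}.

Section Subalg.
Context (C : numClosedFieldType) (A : starAlgType C) (S : starSubalg A).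
Local Notation T := (subalg S).

Definition subval (x : T) : A := proj1_sig x.

HB.instance Definition _ := gen_eqMixin T.
HB.instance Definition _ := gen_choiceMixin T.

Lemma subval_inj : injective subval.
Proof. by move=> [x px] [y py] exy; exact: eq_exist. Qed.

Lemma ss0 : S 0. Proof. by rewrite -(subrr 1); apply: ssB; exact: ss1. Qed.
Lemma ssN u : S u -> S (- u).
Proof. by move=> Su; rewrite -sub0r; exact: ssB ss0 Su. Qed.
Lemma ssD u v : S u -> S v -> S (u + v).
Proof. by move=> Su Sv; rewrite -[v]opprK; apply: ssB => //; exact: ssN. Qed.

Let zero : T := exist _ 0 ss0.
Let one : T := exist _ 1 (ss1 S).
Let opp (x : T) : T := exist _ (- subval x) (ssN (proj2_sig x)).
Let add (x y : T) : T :=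
  exist _ (subval x + subval y) (ssD (proj2_sig x) (proj2_sig y)).
Let mul (x y : T) : T :=
  exist _ (subval x * subval y) (ssM (proj2_sig x) (proj2_sig y)).
Let scale (a : C) (x : T) : T :=
  exist _ (a *c subval x) (ssZ a (proj2_sig x)).
Let starT (x : T) : T := exist _ (star (subval x)) (ssS (proj2_sig x)).

Let addA : associative add.
Proof. by move=> x y z; apply: subval_inj; exact: addrA. Qed.
Let addC : commutative add.
Proof. by move=> x y; apply: subval_inj; exact: addrC. Qed.
Let add0 : left_id zero add.
Proof. by move=> x; apply: subval_inj; exact: add0r. Qed.
Let addN : left_inverse zero opp add.
Proof. by move=> x; apply: subval_inj; exact: addNr. Qed.
HB.instance Definition _ := GRing.isZmodule.Build T addA addC add0 addN.

Let mulA : associative mul.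
Proof. by move=> x y z; apply: subval_inj; exact: mulrA. Qed.
Let mul1 : left_id one mul.
Proof. by move=> x; apply: subval_inj; exact: mul1r. Qed.
Let mulr1T : right_id one mul.
Proof. by move=> x; apply: subval_inj; exact: mulr1. Qed.
Let mulDl : left_distributive mul +%R.
Proof. by move=> x y z; apply: subval_inj; exact: mulrDl. Qed.
Let mulDr : right_distributive mul +%R.
Proof. by move=> x y z; apply: subval_inj; exact: mulrDr. Qed.
HB.instance Definition _ :=
  GRing.Zmodule_isPzRing.Build T mulA mul1 mulr1T mulDl mulDr.

Let scaleA a b v : scale a (scale b v) = scale (a * b) v.
Proof. by apply: subval_inj; exact: cscaleA. Qed.
Let scale1 v : scale 1 v = v.
Proof. by apply: subval_inj; exact: cscale1. Qed.
Let scaleDr a (x y : T) : scale a (x + y) = scale a x + scale a y.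
Proof. by apply: subval_inj; exact: cscaleDr. Qed.
Let scaleDl a b (v : T) : scale (a + b) v = scale a v + scale b v.
Proof. by apply: subval_inj; exact: cscaleDl. Qed.

Let sAl (a : C) (u v : T) : scale a (u * v) = scale a u * v.
Proof. by apply: subval_inj; exact: cscaleAl. Qed.
Let sAr (a : C) (u v : T) : scale a (u * v) = u * scale a v.
Proof. by apply: subval_inj; exact: cscaleAr. Qed.
Let sK : involutive starT.
Proof. by move=> x; apply: subval_inj; exact: starK. Qed.
Let sD : {morph starT : u v / u + v}.
Proof. by move=> x y; apply: subval_inj; exact: starD. Qed.
Let sZ (a : C) (u : T) : starT (scale a u) = scale a^* (starT u).
Proof. by apply: subval_inj; exact: starZ. Qed.
Let sM (u v : T) : starT (u * v) = starT v * starT u.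
Proof. by apply: subval_inj; exact: starM. Qed.
HB.instance Definition _ := isStarAlgebra.Build C T
  scaleA scale1 scaleDr scaleDl sAl sAr sK sD sZ sM.

End Subalg.

Record starIdeal (C : numClosedFieldType) (A : starAlgType C) := StarIdeal {
  si_set :> A -> Prop;
  si0 : si_set 0;
  siB : forall u v, si_set u -> si_set v -> si_set (u - v);
  siZ : forall (a : C) u, si_set u -> si_set (a *c u);
  siMl : forall u v, si_set v -> si_set (u * v);
  siMr : forall u v, si_set u -> si_set (u * v);
  siS : forall u, si_set u -> si_set (star u)
}.

Definition quotalg (C : numClosedFieldType) (A : starAlgType C)
    (I : starIdeal A) : Type :=
  {X : set A | exists x, X = [set y | I (y - x)]}.

Section Quotalg.
Context (C : numClosedFieldType) (A : starAlgType C) (I : starIdeal A).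
Local Notation T := (quotalg I).

HB.instance Definition _ := gen_eqMixin T.
HB.instance Definition _ := gen_choiceMixin T.

Definition coset (x : A) : T := exist _ [set y | I (y - x)] (ex_intro _ x erefl).

Definition rep (X : T) : A := projT1 (cid (proj2_sig X)).

Lemma repK X : coset (rep X) = X.
Proof.
rewrite /coset /rep; case: X => X pX /=; case: cid => x /= Xx; exact: eq_exist.
Qed.

Lemma siN u : I u -> I (- u).
Proof. by move=> Iu; rewrite -sub0r; exact: siB (si0 I) Iu. Qed.
Lemma siD u v : I u -> I v -> I (u + v).
Proof. by move=> Iu Iv; rewrite -[v]opprK; apply: siB => //; exact: siN. Qed.

Lemma cosetP x y : coset x = coset y <-> I (x - y).
Proof.
split=> [[e]|Ixy].
  have : [set z | I (z - x)] x by rewrite /= subrr; exact: si0.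
  by rewrite e.
apply: eq_exist; apply/seteqP; split => z /= Iz.
  by rewrite -(subrKA x); exact: siD.
by rewrite -(subrKA y) -(opprB x); apply: siB.
Qed.

Lemma rep_coset x : I (rep (coset x) - x).
Proof. by apply/cosetP; rewrite repK. Qed.

Let add (X Y : T) : T := coset (rep X + rep Y).
Let opp (X : T) : T := coset (- rep X).
Let mul (X Y : T) : T := coset (rep X * rep Y).
Let scale (a : C) (X : T) : T := coset (a *c rep X).
Let starT (X : T) : T := coset (star (rep X)).

Let addE x y : add (coset x) (coset y) = coset (x + y).
Proof.
by apply/cosetP; rewrite opprD addrACA; apply: siD; exact: rep_coset.
Qed.
Let oppE x : opp (coset x) = coset (- x).
Proof. by apply/cosetP; rewrite -opprD; apply: siN; exact: rep_coset. Qed.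
Let mulE x y : mul (coset x) (coset y) = coset (x * y).
Proof.
apply/cosetP; rewrite -(subrKA (rep (coset x) * y)) -mulrBr -mulrBl.
by apply: siD; [apply: siMl|apply: siMr]; exact: rep_coset.
Qed.
Let scaleE a x : scale a (coset x) = coset (a *c x).
Proof. by apply/cosetP; rewrite -cscaleB; apply: siZ; exact: rep_coset. Qed.
Let starE x : starT (coset x) = coset (star x).
Proof. by apply/cosetP; rewrite -starB; apply: siS; exact: rep_coset. Qed.

Let addA : associative add.
Proof.
by move=> X Y Z; rewrite -(repK X) -(repK Y) -(repK Z) !addE addrA.
Qed.
Let addC : commutative add.
Proof. by move=> X Y; rewrite -(repK X) -(repK Y) !addE addrC. Qed.
Let add0 : left_id (coset 0) add.
Proof. by move=> X; rewrite -(repK X) !addE add0r. Qed.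
Let addN : left_inverse (coset 0) opp add.
Proof. by move=> X; rewrite -(repK X) oppE addE addNr. Qed.
HB.instance Definition _ := GRing.isZmodule.Build T addA addC add0 addN.

Lemma cosetD : {morph coset : x y / x + y}.
Proof. by move=> x y; rewrite -addE. Qed.

Let mulA : associative mul.
Proof.
by move=> X Y Z; rewrite -(repK X) -(repK Y) -(repK Z) !mulE mulrA.
Qed.
Let mul1 : left_id (coset 1) mul.
Proof. by move=> X; rewrite -(repK X) mulE mul1r. Qed.
Let mulr1T : right_id (coset 1) mul.
Proof. by move=> X; rewrite -(repK X) mulE mulr1. Qed.
Let mulDl : left_distributive mul +%R.
Proof.
move=> X Y Z; rewrite -(repK X) -(repK Y) -(repK Z).
by rewrite -cosetD !mulE -cosetD mulrDl.
Qed.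
Let mulDr : right_distributive mul +%R.
Proof.
move=> X Y Z; rewrite -(repK X) -(repK Y) -(repK Z).
by rewrite -cosetD !mulE -cosetD mulrDr.
Qed.
HB.instance Definition _ :=
  GRing.Zmodule_isPzRing.Build T mulA mul1 mulr1T mulDl mulDr.

Let scaleA a b v : scale a (scale b v) = scale (a * b) v.
Proof. by rewrite -(repK v) !scaleE cscaleA. Qed.
Let scale1 v : scale 1 v = v.
Proof. by rewrite -(repK v) scaleE cscale1. Qed.
Let scaleDr a (x y : T) : scale a (x + y) = scale a x + scale a y.
Proof.
rewrite -(repK x) -(repK y) -cosetD !scaleE -cosetD.
by rewrite cscaleDr.
Qed.
Let scaleDl a b (v : T) : scale (a + b) v = scale a v + scale b v.
Proof. by rewrite -(repK v) !scaleE -cosetD cscaleDl. Qed.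

Lemma cosetM : {morph coset : x y / x * y}.
Proof. by move=> x y; rewrite -mulE. Qed.

Let sAl (a : C) (u v : T) : scale a (u * v) = scale a u * v.
Proof. by rewrite -(repK u) -(repK v) -cosetM !scaleE -cosetM cscaleAl. Qed.
Let sAr (a : C) (u v : T) : scale a (u * v) = u * scale a v.
Proof. by rewrite -(repK u) -(repK v) -cosetM !scaleE -cosetM cscaleAr. Qed.
Let sK : involutive starT.
Proof. by move=> X; rewrite -(repK X) !starE starK. Qed.
Let sD : {morph starT : u v / u + v}.
Proof.
by move=> X Y; rewrite -(repK X) -(repK Y) -cosetD !starE -cosetD starD.
Qed.
Let sZ (a : C) (u : T) : starT (scale a u) = scale a^* (starT u).
Proof. by rewrite -(repK u) scaleE !starE scaleE starZ. Qed.
Let sM (u v : T) : starT (u * v) = starT v * starT u.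
Proof. by rewrite -(repK u) -(repK v) -cosetM !starE -cosetM starM. Qed.
HB.instance Definition _ := isStarAlgebra.Build C T
  scaleA scale1 scaleDr scaleDl sAl sAr sK sD sZ sM.

Lemma cosetZ (a : C) x : coset (a *c x) = a *c coset x.
Proof. by rewrite -scaleE. Qed.
Lemma coset1 : coset 1 = 1. Proof. by []. Qed.
Lemma cosetS x : coset (star x) = star (coset x).
Proof. by rewrite -starE. Qed.

End Quotalg.

Definition seqalg (C : numClosedFieldType) (A : nat -> starAlgType C) : Type :=
  forall k, A k.

Section Seqalg.
Context (C : numClosedFieldType) (A : nat -> starAlgType C).
Local Notation T := (seqalg A).

HB.instance Definition _ := gen_eqMixin T.
HB.instance Definition _ := gen_choiceMixin T.

Let zero : T := fun=> 0.
Let one : T := fun=> 1.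
Let opp (x : T) : T := fun k => - x k.
Let add (x y : T) : T := fun k => x k + y k.
Let mul (x y : T) : T := fun k => x k * y k.
Let scale (a : C) (x : T) : T := fun k => a *c x k.
Let starT (x : T) : T := fun k => star (x k).

Let ext (x y : T) : (forall k, x k = y k) -> x = y.
Proof. exact: functional_extensionality_dep. Qed.

Let addA : associative add.
Proof. by move=> x y z; apply: ext => k; exact: addrA. Qed.
Let addC : commutative add.
Proof. by move=> x y; apply: ext => k; exact: addrC. Qed.
Let add0 : left_id zero add.
Proof. by move=> x; apply: ext => k; exact: add0r. Qed.
Let addN : left_inverse zero opp add.
Proof. by move=> x; apply: ext => k; exact: addNr. Qed.
HB.instance Definition _ := GRing.isZmodule.Build T addA addC add0 addN.

Let mulA : associative mul.
Proof. by move=> x y z; apply: ext => k; exact: mulrA. Qed.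
Let mul1 : left_id one mul.
Proof. by move=> x; apply: ext => k; exact: mul1r. Qed.
Let mulr1T : right_id one mul.
Proof. by move=> x; apply: ext => k; exact: mulr1. Qed.
Let mulDl : left_distributive mul +%R.
Proof. by move=> x y z; apply: ext => k; exact: mulrDl. Qed.
Let mulDr : right_distributive mul +%R.
Proof. by move=> x y z; apply: ext => k; exact: mulrDr. Qed.
HB.instance Definition _ :=
  GRing.Zmodule_isPzRing.Build T mulA mul1 mulr1T mulDl mulDr.

Let scaleA a b v : scale a (scale b v) = scale (a * b) v.
Proof. by apply: ext => k; exact: cscaleA. Qed.
Let scale1 v : scale 1 v = v.
Proof. by apply: ext => k; exact: cscale1. Qed.
Let scaleDr a (x y : T) : scale a (x + y) = scale a x + scale a y.
Proof. by apply: ext => k; exact: cscaleDr. Qed.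
Let scaleDl a b (v : T) : scale (a + b) v = scale a v + scale b v.
Proof. by apply: ext => k; exact: cscaleDl. Qed.

Let sAl (a : C) (u v : T) : scale a (u * v) = scale a u * v.
Proof. by apply: ext => k; exact: cscaleAl. Qed.
Let sAr (a : C) (u v : T) : scale a (u * v) = u * scale a v.
Proof. by apply: ext => k; exact: cscaleAr. Qed.
Let sK : involutive starT.
Proof. by move=> x; apply: ext => k; exact: starK. Qed.
Let sD : {morph starT : u v / u + v}.
Proof. by move=> x y; apply: ext => k; exact: starD. Qed.
Let sZ (a : C) (u : T) : starT (scale a u) = scale a^* (starT u).
Proof. by apply: ext => k; exact: starZ. Qed.
Let sM (u v : T) : starT (u * v) = starT v * starT u.
Proof. by apply: ext => k; exact: starM. Qed.
HB.instance Definition _ := isStarAlgebra.Build C T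
  scaleA scale1 scaleDr scaleDl sAl sAr sK sD sZ sM.

Lemma seqalg1E k : (1 : T) k = 1. Proof. by []. Qed.
Lemma seqalgBE (x y : T) k : (x - y) k = x k - y k. Proof. by []. Qed.
Lemma seqalgZE a (x : T) k : (a *c x) k = a *c x k. Proof. by []. Qed.
Lemma seqalgME (x y : T) k : (x * y) k = x k * y k. Proof. by []. Qed.
Lemma seqalgSE (x : T) k : star x k = star (x k). Proof. by []. Qed.

End Seqalg.

Section Seminorms.
Context (R : realType).
Local Notation C := R[i].

Definition cabs (z : C) : R := complex.Re `|z|.

Lemma cabsE (z : C) : ((cabs z)%:C)%C = `|z|.
Proof. by rewrite /cabs RRe_real// normr_real. Qed.

Lemma cabs_ge0 (z : C) : 0 <= cabs z.
Proof. by rewrite -ler0c cabsE. Qed.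

Lemma cabsJ (z : C) : cabs z^* = cabs z.
Proof. by rewrite /cabs norm_conjC. Qed.

Record starSeminorm (A : starAlgType C) := StarSeminorm {
  sn :> A -> R;
  sn_ge0 : forall u, 0 <= sn u;
  snB : forall u v, sn (u - v) <= sn u + sn v;
  snZ : forall (a : C) u, sn (a *c u) <= cabs a * sn u;
  sn1 : sn 1 <= 1;
  snM : forall u v, sn (u * v) <= sn u * sn v;
  snS : forall u, sn (star u) <= sn u
}.

Lemma sn0 (A : starAlgType C) (p : starSeminorm A) : p 0 = 0.
Proof.
apply/eqP; rewrite eq_le sn_ge0 andbT.
have e : (0 : A) = 0 *c 0 by rewrite cscale0.
by rewrite {1}e (le_trans (snZ _ _ _))// /cabs normr0 mul0r.
Qed.

Lemma snD (A : starAlgType C) (p : starSeminorm A) u v :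
  p (u + v) <= p u + p v.
Proof.
rewrite -[v in leLHS]opprK (le_trans (snB _ _ _))// lerD2l.
by rewrite -sub0r (le_trans (snB _ _ _))// sn0 add0r.
Qed.

Section Bounded.
Context (A : nat -> starAlgType C) (p : forall k, starSeminorm (A k)).

Definition bounded_seq (a : seqalg A) : Prop :=
  exists M : R, forall k, p k (a k) <= M.

Definition null_seq (a : seqalg A) : Prop :=
  (fun k => p k (a k)) @ \oo --> (0 : R).

Let bseq1 : bounded_seq 1.
Proof. by exists 1 => k; exact: sn1. Qed.
Let bseqB a b : bounded_seq a -> bounded_seq b -> bounded_seq (a - b).
Proof.
move=> [M aM] [N bN]; exists (M + N) => k.
by rewrite (le_trans (snB _ _ _))// lerD.
Qed.
Let bseqZ (c : C) a : bounded_seq a -> bounded_seq (c *c a).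
Proof.
move=> [M aM]; exists (cabs c * M) => k.
by rewrite (le_trans (snZ _ _ _))// ler_wpM2l// cabs_ge0.
Qed.
Let bseqM a b : bounded_seq a -> bounded_seq b -> bounded_seq (a * b).
Proof.
move=> [M aM] [N bN]; exists (M * N) => k.
by rewrite (le_trans (snM _ _ _))// ler_pM ?sn_ge0.
Qed.
Let bseqS a : bounded_seq a -> bounded_seq (star a).
Proof. by move=> [M aM]; exists M => k; rewrite (le_trans (snS _ _)). Qed.

Definition bounded_subalg : starSubalg (seqalg A) :=
  StarSubalg bseq1 bseqB bseqZ bseqM bseqS.

Section Null.
Context (S : starSubalg (seqalg A)) (Sb : forall a, S a -> bounded_seq a).

Let nul (x : subalg S) : Prop := null_seq (subval x).

Let nul_le (x : seqalg A) (y : nat -> R) :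
  y @ \oo --> (0 : R) -> (forall k, p k (x k) <= y k) -> null_seq x.
Proof.
move=> y0 xy; apply: (@squeeze_cvgr _ _ _ _ (fun=> 0) y) => //.
  by near=> k; rewrite sn_ge0 xy.
exact: cvg_cst.
Unshelve. all: by end_near. Qed.

Let nul0 : nul 0.
Proof.
apply: (@nul_le _ (fun=> 0)); first exact: cvg_cst.
by move=> k; rewrite (sn0 (p k)).
Qed.
Let nulB x y : nul x -> nul y -> nul (x - y).
Proof.
move=> x0 y0; apply: (@nul_le _ (fun k => p k (subval x k) + p k (subval y k))).
  by rewrite -[0]addr0; exact: cvgD x0 y0.
by move=> k; exact: snB.
Qed.
Let nulZ (c : C) x : nul x -> nul (c *c x).
Proof.
move=> x0; apply: (@nul_le _ (fun k => cabs c * p k (subval x k))).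
  by rewrite -(mulr0 (cabs c)); apply: cvgM => //; exact: cvg_cst.
by move=> k; exact: snZ.
Qed.
Let nulMl x y : nul y -> nul (x * y).
Proof.
have [M xM] := Sb (proj2_sig x).
move=> y0; apply: (@nul_le _ (fun k => M * p k (subval y k))).
  by rewrite -(mulr0 M); apply: cvgM => //; exact: cvg_cst.
by move=> k; rewrite (le_trans (snM _ _ _))// ler_wpM2r ?sn_ge0//; exact: xM.
Qed.
Let nulMr x y : nul x -> nul (x * y).
Proof.
have [M yM] := Sb (proj2_sig y).
move=> x0; apply: (@nul_le _ (fun k => p k (subval x k) * M)).
  by rewrite -(mul0r M); apply: cvgM => //; exact: cvg_cst.
by move=> k; rewrite (le_trans (snM _ _ _))// ler_wpM2l ?sn_ge0//; exact: yM.
Qed.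
Let nulS x : nul x -> nul (star x).
Proof. by move=> x0; apply: nul_le x0 _ => k; exact: snS. Qed.

Definition null_ideal : starIdeal (subalg S) :=
  StarIdeal nul0 nulB nulZ nulMl nulMr nulS.

End Null.
End Bounded.

Section Cauchy.
Context (A : starAlgType C) (p : starSeminorm A).
Local Notation T := (seqalg (fun=> A)).

Definition cauchy_seq (a : T) : Prop := forall e : R, 0 < e ->
  exists N, forall m n, (N <= m)%N -> (N <= n)%N -> p (a m - a n) < e.

Lemma cauchy_seq_bounded (a : T) : cauchy_seq a -> bounded_seq (fun=> p) a.
Proof.
move=> /(_ 1 ltr01)[N aN].
exists (\sum_(i < N) p (a i) + (1 + p (a N))) => k.
have [kN|Nk] := ltnP k N.
  rewrite (bigD1 (Ordinal kN))//= -addrA lerDl addr_ge0//.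
    by apply: sumr_ge0 => i _; exact: sn_ge0.
  by rewrite addr_ge0// sn_ge0.
have -> : a k = (a k - a N) + a N by rewrite subrK.
rewrite (le_trans (snD _ _ _))// -[leLHS]add0r lerD//.
  by apply: sumr_ge0 => i _; exact: sn_ge0.
by rewrite lerD2r ltW// aN.
Qed.

Let cau1 : cauchy_seq 1.
Proof. by move=> e e0; exists 0 => m n _ _; rewrite /= subrr sn0. Qed.
Let cauB (a b : T) : cauchy_seq a -> cauchy_seq b -> cauchy_seq (a - b).
Proof.
move=> ca cb e e0; have e20 : 0 < e / 2 by rewrite divr_gt0.
have [M aM] := ca _ e20; have [N bN] := cb _ e20.
exists (maxn M N) => m n; rewrite !geq_max => /andP[Mm Nm] /andP[Mn Nn].
have -> : (a - b) m - (a - b) n = (a m - a n) - (b m - b n).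
  by rewrite !seqalgBE !opprD addrACA.
by rewrite (le_lt_trans (snB _ _ _))// [ltRHS]splitr ltrD ?aM ?bN.
Qed.
Let cauZ (c : C) (a : T) : cauchy_seq a -> cauchy_seq (c *c a).
Proof.
move=> ca e e0; have c0 : 0 < cabs c + 1 by rewrite ltr_wpDl ?cabs_ge0.
have [N aN] := ca _ (divr_gt0 e0 c0); exists N => m n Nm Nn.
have -> : (c *c a) m - (c *c a) n = c *c (a m - a n).
  by rewrite !seqalgZE cscaleB.
have := aN _ _ Nm Nn; rewrite ltr_pdivlMr// => /le_lt_trans; apply.
by rewrite (le_trans (snZ _ _ _))// mulrC ler_wpM2l ?sn_ge0// lerDl.
Qed.
Let cauM (a b : T) : cauchy_seq a -> cauchy_seq b -> cauchy_seq (a * b).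
Proof.
move=> ca cb e e0.
have [K aK] := cauchy_seq_bounded ca; have [L bL] := cauchy_seq_bounded cb.
have K0 : 0 <= K by rewrite (le_trans _ (aK 0)) ?sn_ge0.
have L0 : 0 <= L by rewrite (le_trans _ (bL 0)) ?sn_ge0.
have KL0 : 0 < K + L + 1 by rewrite ltr_wpDl ?addr_ge0.
have [M aM] := ca _ (divr_gt0 e0 KL0); have [N bN] := cb _ (divr_gt0 e0 KL0).
exists (maxn M N) => m n; rewrite !geq_max => /andP[Mm Nm] /andP[Mn Nn].
have -> : (a * b) m - (a * b) n = a m * (b m - b n) + (a m - a n) * b n.
  by rewrite !seqalgME mulrBr mulrBl subrKA.
set d := e / (K + L + 1) in aM bN.
have d0 : 0 < d by rewrite divr_gt0.
have -> : e = d * (K + L + 1) by rewrite divfK// gt_eqF.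
rewrite (@le_lt_trans _ _ (K * d + d * L))//; last first.
  by rewrite mulrC -mulrDr ltr_pM2l// ltrDl.
rewrite (le_trans (snD _ _ _))// lerD// (le_trans (snM _ _ _))//.
  by rewrite ler_pM ?sn_ge0// ltW// bN.
by rewrite ler_pM ?sn_ge0// ltW// aM.
Qed.
Let cauS (a : T) : cauchy_seq a -> cauchy_seq (star a).
Proof.
move=> ca e /ca[N aN]; exists N => m n Nm Nn.
have -> : star a m - star a n = star (a m - a n).
  by rewrite !seqalgSE starB.
by rewrite (le_lt_trans (snS _ _))// aN.
Qed.

Definition cauchy_subalg : starSubalg T :=
  StarSubalg cau1 cauB cauZ cauM cauS.

(* The separated completion of A for p: Cauchy sequences modulo null sequences.
   Its norm is not recorded, since *-representations, their faithfulness and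
   unitaries only depend on the *-algebra structure. *)
Definition completion : starAlgType C :=
  quotalg (@null_ideal _ (fun=> p) cauchy_subalg cauchy_seq_bounded).

End Cauchy.
End Seminorms.

Section MatrixStar.
Context (C : numClosedFieldType) (n : nat).
Local Notation T := 'M[C]_n.

Definition mxadj (A : T) : T := (map_mx Num.conj A)^T.

Let sAl (a : C) (A B : T) : a *: (A * B) = a *: A * B.
Proof. exact: scalemxAl. Qed.
Let sAr (a : C) (A B : T) : a *: (A * B) = A * (a *: B).
Proof. exact: scalemxAr. Qed.
Let sK : involutive mxadj.
Proof. by move=> A; apply/matrixP => i j; rewrite !mxE conjCK. Qed.
Let sD : {morph mxadj : A B / A + B}.
Proof. by move=> A B; apply/matrixP => i j; rewrite !mxE rmorphD. Qed.
Let sZ (a : C) (A : T) : mxadj (a *: A) = a^* *: mxadj A.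
Proof. by apply/matrixP => i j; rewrite !mxE rmorphM. Qed.
Let sM (A B : T) : mxadj (A * B) = mxadj B * mxadj A.
Proof. by rewrite /mxadj map_mxM trmx_mul. Qed.

HB.instance Definition _ := isStarAlgebra.Build C T
  (@scalerA _ _) (@scale1r _ _) (fun a => @scalerDr _ _ a)
  (fun a b v => @scalerDl _ _ v a b) sAl sAr sK sD sZ sM.

End MatrixStar.

Section ColumnDot.
Context (C : numClosedFieldType) (n : nat).

Definition coldot (x y : 'cV[C]_n) : C := \sum_i x i 0 * (y i 0)^*.

Let coldot_bilinear : bilinear_for
  (GRing.Scale.Law.clone _ _ *%R _)
  (GRing.Scale.Law.clone _ _ (Num.conj \; *%R) _) coldot.
Proof.
split=> [y|x] a u v; rewrite /coldot /= mulr_sumr -big_split /=;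
  apply: eq_bigr => i _; rewrite !mxE.
  by rewrite mulrDl mulrA.
by rewrite rmorphD rmorphM mulrDr mulrCA.
Qed.

HB.instance Definition _ := bilinear_isBilinear.Build C 'cV[C]_n 'cV[C]_n C
  *%R (Num.conj \; *%R) coldot coldot_bilinear.

Let coldot_herm (x y : 'cV[C]_n) :
  coldot x y = (-1) ^+ false * (coldot y x)^*.
Proof.
rewrite expr0 mul1r /coldot rmorph_sum; apply: eq_bigr => i _.
by rewrite rmorphM /= conjCK mulrC.
Qed.
HB.instance Definition _ := isHermitianSesquilinear.Build C 'cV[C]_n
  false Num.conj coldot coldot_herm.

Let coldot_gt0 (x : 'cV[C]_n) : x != 0 -> 0 < coldot x x.
Proof.
move=> x0; have [i xi0] : exists i, x i 0 != 0.
  apply: contrapT => h; move/negP: x0; apply; apply/eqP/matrixP => i j.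
  rewrite ord1 mxE; apply/eqP; apply: contrapT => xi.
  by apply: h; exists i; apply/negP.
rewrite /coldot (bigD1 i)//= ltr_wpDr//; last by rewrite mul_conjC_gt0.
by apply: sumr_ge0 => j _; exact: mul_conjC_ge0.
Qed.
HB.instance Definition _ := isDotProduct.Build C 'cV[C]_n coldot coldot_gt0.

End ColumnDot.

Section DotNorm.
Context (R : realType).
Local Notation C := R[i].

Definition vnorm (V : lmodType C) (f : {dot V for Num.conj}) (v : V) : R :=
  Num.sqrt (complex.Re (f v v)).

Definition opnorm (V : lmodType C) (f : {dot V for Num.conj}) (T : V -> V) : R :=
  sup [set r | exists2 v, vnorm f v <= 1 & r = vnorm f (T v)].

Section Theory.
Context (V : lmodType C) (f : {dot V for Num.conj}).
Implicit Types u v : V.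

Local Notation Re := complex.Re.

Let ReD (x y : C) : Re (x + y) = Re x + Re y.
Proof. by case: x => ? ?; case: y. Qed.
Let ReN (x : C) : Re (- x) = - Re x.
Proof. by case: x. Qed.
Let ReM (a : R) (x : C) : Re ((a%:C)%C * x) = a * Re x.
Proof. by case: x => x y /=; rewrite mul0r subr0. Qed.
Let ReJ (x : C) : Re (x^*) = Re x.
Proof. by case: x. Qed.
Let conjR (a : R) : ((a%:C)%C)^* = (a%:C)%C.
Proof. by apply/eqP; rewrite eq_complex /= oppr0 !eqxx. Qed.

Let f_ge0 v : 0 <= f v v.
Proof. exact: dnorm_ge0. Qed.

Lemma vnorm_sqr v : vnorm f v ^+ 2 = Re (f v v).
Proof. by rewrite sqr_sqrtr//; have := f_ge0 v; rewrite lecE => /andP[]. Qed.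

Lemma fvvE v : f v v = ((vnorm f v ^+ 2)%:C)%C.
Proof. by rewrite vnorm_sqr RRe_real// ger0_real. Qed.

Lemma vnorm_ge0 v : 0 <= vnorm f v. Proof. exact: sqrtr_ge0. Qed.

Lemma vnorm_eq0 v : vnorm f v = 0 -> v = 0.
Proof.
move=> v0; apply/eqP; apply: contrapT => /negP /(@neq0_dnorm_gt0 _ _ _ f).
by rewrite fvvE v0 expr0n ltxx.
Qed.

Lemma vnorm0 : vnorm f 0 = 0.
Proof. by rewrite /vnorm linear0r/= sqrtr0. Qed.

Let sqrB u v : vnorm f (u - v) ^+ 2 =
  vnorm f u ^+ 2 + vnorm f v ^+ 2 - Re (f u v) *+ 2.
Proof. by rewrite !vnorm_sqr dnormB /= !(ReD, ReN) ReJ mulr2n. Qed.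

Let sqrD u v : vnorm f (u + v) ^+ 2 =
  vnorm f u ^+ 2 + vnorm f v ^+ 2 + Re (f u v) *+ 2.
Proof. by rewrite !vnorm_sqr dnormD /= !(ReD, ReN) ReJ mulr2n. Qed.

Lemma vnormZ (a : C) v : vnorm f (a *: v) = cabs a * vnorm f v.
Proof.
apply/eqP; rewrite -(@eqrXn2 _ 2)// ?mulr_ge0 ?vnorm_ge0 ?cabs_ge0//.
rewrite vnorm_sqr (dnormZ f) exprMn vnorm_sqr -ReM; apply/eqP; congr Re.
by rewrite -cabsE rmorphXn.
Qed.

Lemma dot_cs u v : Re (f u v) <= vnorm f u * vnorm f v.
Proof.
have [/vnorm_eq0 ->|u0] := eqVneq (vnorm f u) 0.
  by rewrite linear0l vnorm0 mul0r.
have [/vnorm_eq0 ->|v0] := eqVneq (vnorm f v) 0.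
  by rewrite linear0r vnorm0 mulr0.
set a := vnorm f u in u0 *; set b := vnorm f v in v0 *.
have ab0 : 0 < a * b by rewrite mulr_gt0// lt_def ?u0 ?v0 vnorm_ge0.
have cR (x : R) : 0 <= x -> cabs (x%:C)%C = x.
  by move=> x0; rewrite /cabs ger0_norm// lecR.
have := sqr_ge0 (vnorm f ((b%:C)%C *: u - (a%:C)%C *: v)).
rewrite sqrB !vnormZ !cR ?vnorm_ge0// -/a -/b.
rewrite linearZl_LR/= linearZr_LR/= conjR !ReM (mulrC b a) -mulr2n -mulrnBl.
rewrite pmulrn_lge0// (mulrCA b) mulrA expr2 -mulrBr pmulr_rge0//.
by rewrite subr_ge0.
Qed.

Lemma ler_vnormD u v : vnorm f (u + v) <= vnorm f u + vnorm f v.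
Proof.
rewrite -(@ler_pXn2r _ 2) ?nnegrE ?addr_ge0 ?vnorm_ge0// sqrD sqrrD.
by rewrite addrAC lerD2r lerD2l lerMn2r dot_cs.
Qed.

Lemma vnormN v : vnorm f (- v) = vnorm f v.
Proof. by rewrite -scaleN1r vnormZ /cabs normrN1 mul1r. Qed.

Lemma opnorm_ge0 T : 0 <= opnorm f T.
Proof.
rewrite /opnorm; set S := [set _ | _].
have [hs|hs] := pselect (has_sup S); last by rewrite sup_out.
have S0 : S (vnorm f (T 0)) by exists 0 => //; rewrite vnorm0.
by rewrite (le_trans (vnorm_ge0 (T 0)))// (sup_upper_bound hs).
Qed.

Lemma opnorm_le T M :
  0 <= M -> (forall v, vnorm f (T v) <= M * vnorm f v) -> opnorm f T <= M.
Proof.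
move=> M0 TM; apply: ge_sup.
  by exists (vnorm f (T 0)), 0 => //; rewrite vnorm0.
by move=> _ [v v1 ->]; rewrite (le_trans (TM v))// ler_piMr.
Qed.

Lemma le_opnorm T M : scalable T ->
  (forall v, vnorm f (T v) <= M * vnorm f v) ->
  forall v, vnorm f (T v) <= opnorm f T * vnorm f v.
Proof.
move=> TZ TM v.
have T0 : T 0 = 0 by rewrite -[X in T X](scale0r (0 : V)) TZ scale0r.
have [v0|v0] := eqVneq (vnorm f v) 0.
  by rewrite (vnorm_eq0 v0) T0 vnorm0 mulr0.
have vp : 0 < vnorm f v by rewrite lt_def v0 vnorm_ge0.
rewrite -ler_pdivrMr// /opnorm; apply: ub_le_sup.
  exists `|M| => _ [w w1 ->]; rewrite (le_trans (TM w))//.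
  rewrite (le_trans (ler_wpM2r (vnorm_ge0 w) (ler_norm M)))//.
  by rewrite ler_piMr.
have cR : cabs ((vnorm f v)^-1%:C)%C = (vnorm f v)^-1.
  by rewrite /cabs ger0_norm// lecR invr_ge0 ltW.
exists (((vnorm f v)^-1)%:C%C *: v); first by rewrite vnormZ cR mulVf.
by rewrite TZ vnormZ cR mulrC.
Qed.

Lemma vnorm_adj (T S : V -> V) M :
  (forall v, vnorm f (T v) <= M * vnorm f v) ->
  (forall u v, f (T u) v = f u (S v)) ->
  forall v, vnorm f (S v) <= M * vnorm f v.
Proof.
move=> TM TS v; have [->|Sv0] := eqVneq (vnorm f (S v)) 0.
  by rewrite (le_trans (vnorm_ge0 (T v))).
have Svp : 0 < vnorm f (S v) by rewrite lt_def Sv0 vnorm_ge0.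
rewrite -(ler_pM2l Svp) -expr2 vnorm_sqr -TS (le_trans (dot_cs _ _))//.
by rewrite mulrCA mulrA ler_wpM2r ?vnorm_ge0.
Qed.

End Theory.
End DotNorm.

Section MatrixNorm.
Context (R : realType) (n : nat).
Local Notation C := R[i].
Local Notation f := (@coldot C n).

Definition mxopnorm (A : 'M[C]_n) : R := opnorm f (mulmx A).

Let mx_bounded (A : 'M[C]_n) :
  exists M, forall v : 'cV[C]_n, vnorm f (A *m v) <= M * vnorm f v.
Proof.
have entry (v : 'cV[C]_n) j : cabs (v j 0) <= vnorm f v.
  rewrite -(@ler_pXn2r _ 2) ?nnegrE ?vnorm_ge0 ?cabs_ge0//.
  rewrite -lecR -fvvE rmorphXn /= cabsE normCK /coldot (bigD1 j)//= lerDl.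
  by apply: sumr_ge0 => i _; exact: mul_conjC_ge0.
have sum_le (F : 'I_n -> 'cV[C]_n) :
    vnorm f (\sum_i F i) <= \sum_i vnorm f (F i).
  elim/big_ind2 : _ => [|x a y b xa yb|//]; first by rewrite vnorm0.
  by rewrite (le_trans (ler_vnormD _ _ _))// lerD.
exists (\sum_j vnorm f (col j A)) => v.
rewrite (_ : A *m v = \sum_j v j 0 *: col j A); last first.
  apply/matrixP => i j; rewrite !mxE summxE; apply: eq_bigr => k _.
  by rewrite !mxE mulrC ord1.
rewrite (le_trans (sum_le _))// mulr_suml ler_sum// => j _.
by rewrite vnormZ mulrC ler_wpM2l ?vnorm_ge0.
Qed.

Let mxopP A v : vnorm f (A *m v) <= mxopnorm A * vnorm f v.
Proof.
have [M AM] := mx_bounded A; apply: (@le_opnorm _ _ _ (mulmx A) M) => //.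
by move=> a x; rewrite -scalemxAr.
Qed.

Let mxop_ge0 A : 0 <= mxopnorm A. Proof. exact: opnorm_ge0. Qed.

Let mxopB A B : mxopnorm (A - B) <= mxopnorm A + mxopnorm B.
Proof.
apply: opnorm_le => [|v]; first by rewrite addr_ge0.
rewrite mulmxBl (le_trans (ler_vnormD _ _ _))// vnormN mulrDl.
by rewrite lerD.
Qed.
Let mxopZ (a : C) A : mxopnorm (a *c A) <= cabs a * mxopnorm A.
Proof.
apply: opnorm_le => [|v]; first by rewrite mulr_ge0 ?cabs_ge0.
by rewrite -scalemxAl vnormZ -mulrA ler_wpM2l ?cabs_ge0.
Qed.
Let mxop1 : mxopnorm 1 <= 1.
Proof. by apply: opnorm_le => // v; rewrite mul1mx mul1r. Qed.
Let mxopM A B : mxopnorm (A * B) <= mxopnorm A * mxopnorm B.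
Proof.
apply: opnorm_le => [|v]; first by rewrite mulr_ge0.
rewrite -mulmxA (le_trans (mxopP _ _))// -mulrA ler_wpM2l//.
Qed.
Let mxopS A : mxopnorm (star A) <= mxopnorm A.
Proof.
apply: opnorm_le => // v; apply: (@vnorm_adj _ _ f (mulmx A)) => //.
move=> x y; rewrite /coldot.
transitivity (\sum_i \sum_j A i j * x j 0 * (y i 0)^*).
  by apply: eq_bigr => i _; rewrite mxE mulr_suml.
rewrite exchange_big; apply: eq_bigr => j _ /=.
rewrite mxE rmorph_sum mulr_sumr; apply: eq_bigr => i _.
have -> : star A j i = (A i j)^* by rewrite [LHS]mxE mxE.
by rewrite rmorphM /= conjCK -mulrA mulrCA.
Qed.

Definition mx_seminorm : starSeminorm 'M[C]_n :=
  @StarSeminorm R 'M[C]_n mxopnorm mxop_ge0 mxopB mxopZ mxop1 mxopM mxopS.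

End MatrixNorm.

Section GroupAlgebra.
Context (C : numClosedFieldType) (G : groupType).

Definition grpalg : Type := {x : G -> C | finite_set [set g | x g != 0]}.

HB.instance Definition _ := gen_eqMixin grpalg.
HB.instance Definition _ := gen_choiceMixin grpalg.

Definition gcoef (x : grpalg) : G -> C := proj1_sig x.
Coercion gcoef : grpalg >-> Funclass.

Lemma gcoef_inj (x y : grpalg) : x =1 y -> x = y.
Proof. by case: x y => [x px] [y py] /= /funext xy; exact: eq_exist. Qed.

Definition gsupp (x : grpalg) : {fset G} := fset_set [set g | x g != 0].

Lemma gsuppP (x : grpalg) g : g \notin gsupp x -> x g = 0.
Proof.
rewrite in_fset_set; last exact: (proj2_sig x).
by rewrite notin_setE /= => /negP; rewrite negbK => /eqP.
Qed.

Let fin (x : G -> C) (A : {fset G}) :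
  (forall g, g \notin A -> x g = 0) -> finite_set [set g | x g != 0].
Proof.
move=> xA; apply: (finite_subfset A) => g /=.
by apply: contra_neqT => /xA.
Qed.

Let add_fin (x y : grpalg) : finite_set [set g | x g + y g != 0].
Proof.
apply: (@fin _ (gsupp x `|` gsupp y)%fset) => g.
by rewrite inE negb_or => /andP[/gsuppP -> /gsuppP ->]; rewrite addr0.
Qed.
Let opp_fin (x : grpalg) : finite_set [set g | - x g != 0].
Proof. by apply: (@fin _ (gsupp x)) => g /gsuppP ->; rewrite oppr0. Qed.
Let scale_fin (a : C) (x : grpalg) : finite_set [set g | a * x g != 0].
Proof. by apply: (@fin _ (gsupp x)) => g /gsuppP ->; rewrite mulr0. Qed.
Let delta_fin (h : G) : finite_set [set g | (g == h)%:R != 0 :> C].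
Proof. by apply: (@fin _ [fset h]%fset) => g; rewrite inE => /negPf ->. Qed.

Definition gdelta (h : G) : grpalg := exist _ (fun g => (g == h)%:R) (delta_fin h).

Definition conv (x y : G -> C) (g : G) : C :=
  \sum_(t \in [set: G]) x t * y (t^-1 * g)%g.

Let psupp (x y : grpalg) : {fset G} :=
  [fset (t * u)%g | t in gsupp x, u in gsupp y]%fset.

Let psuppP (x y : grpalg) t g :
  t \in gsupp x -> g \notin psupp x y -> y (t^-1 * g)%g = 0.
Proof.
move=> xt gxy; apply: gsuppP; apply: contra gxy => yg.
by apply/imfset2P; exists t => //; exists (t^-1 * g)%g => //; rewrite mulVKg.
Qed.

Lemma convE (x : grpalg) (y : G -> C) g :
  conv x y g = \sum_(t <- gsupp x) x t * y (t^-1 * g)%g.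
Proof. by apply: fsbigTE => t /gsuppP ->; rewrite mul0r. Qed.

Let conv0 (x y : grpalg) g : g \notin psupp x y -> conv x y g = 0.
Proof.
move=> gxy; rewrite convE big_seq big1// => t tx.
by rewrite (psuppP tx gxy) mulr0.
Qed.

Let conv_fin (x y : grpalg) : finite_set [set g | conv x y g != 0].
Proof. by apply: (@fin _ (psupp x y)) => g; exact: conv0. Qed.

Let star_fin (x : grpalg) : finite_set [set g | (x g^-1%g)^* != 0].
Proof.
apply: (@fin _ [fset g^-1%g | g in gsupp x]%fset) => g gx.
rewrite gsuppP ?rmorph0//; apply: contra gx => gx.
by apply/imfsetP; exists g^-1%g => //; rewrite invgK.
Qed.

Let zero_fin : finite_set [set g : G | (0 : C) != 0].
Proof. by apply: (@fin _ fset0). Qed.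

Let zero : grpalg := exist _ (fun=> 0) zero_fin.
Let add (x y : grpalg) : grpalg := exist _ (fun g => x g + y g) (add_fin x y).
Let opp (x : grpalg) : grpalg := exist _ (fun g => - x g) (opp_fin x).
Let scale a (x : grpalg) : grpalg := exist _ (fun g => a * x g) (scale_fin a x).
Let mul (x y : grpalg) : grpalg := exist _ (conv x y) (conv_fin x y).
Let starg (x : grpalg) : grpalg :=
  exist _ (fun g => (x g^-1%g)^*) (star_fin x).

Let addA : associative add.
Proof. by move=> x y z; apply: gcoef_inj => g; exact: addrA. Qed.
Let addC : commutative add.
Proof. by move=> x y; apply: gcoef_inj => g; exact: addrC. Qed.
Let add0 : left_id zero add.
Proof. by move=> x; apply: gcoef_inj => g; exact: add0r. Qed.
Let addN : left_inverse zero opp add.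
Proof. by move=> x; apply: gcoef_inj => g; exact: addNr. Qed.
HB.instance Definition _ := GRing.isZmodule.Build grpalg addA addC add0 addN.

(* Reindexing by left translation, for a function F supported in gsupp y. *)
Lemma shift_sum (V : nmodType) (F : G -> V) (x y : grpalg) t :
  (forall g, g \notin gsupp y -> F g = 0) -> t \in gsupp x ->
  \sum_(u <- psupp x y) F (t^-1 * u)%g = \sum_(u <- gsupp y) F u.
Proof.
move=> Fy tx; rewrite -(fsbigTE (gsupp y) F)// -fsbigTE.
  rewrite [RHS](reindex_fsbigT (fun u => t^-1 * u)%g)//.
  by exists (fun u => t * u)%g => u; [exact: mulVKg|exact: mulKg].
move=> u uxy; apply: Fy; apply: contra uxy => uy.
by apply/imfset2P; exists t => //; exists (t^-1 * u)%g => //; rewrite mulVKg.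
Qed.

Lemma sum_mul (V : nmodType) (F : G -> C -> V) (x y : grpalg) :
  (forall g, {morph F g : a b / a + b}) -> (forall g, F g 0 = 0) ->
  \sum_(u \in [set: G]) F u (mul x y u) =
  \sum_(t \in [set: G]) \sum_(u \in [set: G]) F (t * u)%g (x t * y u).
Proof.
move=> FD F0.
rewrite (fsbigTE (psupp x y)); last by move=> u /conv0 /= ->.
rewrite [RHS](fsbigTE (gsupp x)); last first.
  by move=> t /gsuppP xt; apply: fsbig1 => u _; rewrite xt mul0r.
transitivity (\sum_(u <- psupp x y) \sum_(t <- gsupp x) F u (x t * y (t^-1 * u)%g)).
  by apply: eq_bigr => u _; rewrite /= convE (big_morph _ (FD u) (F0 u)).
rewrite exchange_big /= [LHS]big_seq [RHS]big_seq; apply: eq_bigr => t tx.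
rewrite (fsbigTE (gsupp y)); last by move=> u /gsuppP ->; rewrite mulr0.
rewrite -(@shift_sum _ (fun u => F (t * u)%g (x t * y u)) x y t)//.
  by apply: eq_bigr => u _; rewrite mulVKg.
by move=> u /gsuppP ->; rewrite mulr0.
Qed.

Let mulA : associative mul.
Proof.
move=> x y z; apply: gcoef_inj => g /=; symmetry.
rewrite /conv (@sum_mul _ (fun u a => a * z (u^-1 * g)%g)); last 2 first.
- by move=> u a b; rewrite mulrDl.
- by move=> u; rewrite mul0r.
apply: eq_fsbigr => t _; rewrite [LHS](fsbigTE (gsupp y)); last first.
  by move=> u /gsuppP ->; rewrite mulr0 mul0r.
rewrite [X in _ = _ * X](fsbigTE (gsupp y)); last first.
  by move=> u /gsuppP ->; rewrite mul0r.
rewrite mulr_sumr; apply: eq_bigr => u _.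
by rewrite invgM !mulgA mulrA.
Qed.

Let one := gdelta 1%g.

Let mul1 : left_id one mul.
Proof.
move=> x; apply: gcoef_inj => g /=; rewrite /conv (fsbigTE [fset 1%g]%fset).
  by rewrite big_seq_fset1 eqxx mul1r invg1 mul1g.
by move=> t; rewrite inE => /negPf ->; rewrite mul0r.
Qed.
Let mulr1T : right_id one mul.
Proof.
move=> x; apply: gcoef_inj => g /=; rewrite /conv (fsbigTE [fset g]%fset).
  by rewrite big_seq_fset1 mulVg eqxx mulr1.
move=> t; rewrite inE => tg.
have [e|] := eqVneq (t^-1 * g)%g 1%g; last by rewrite mulr0.
by move: tg; rewrite -[g](mulVKg t) e mulg1 eqxx.
Qed.
Let mulDl : left_distributive mul +%R.
Proof.
move=> x y z; apply: gcoef_inj => g /=; rewrite /conv.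
pose A := (gsupp x `|` gsupp y)%fset.
rewrite !(fsbigTE A) -?big_split /=; first by apply: eq_bigr => t _; rewrite mulrDl.
all: move=> t; rewrite inE negb_or => /andP[/gsuppP xt /gsuppP yt].
- by rewrite yt mul0r.
- by rewrite xt mul0r.
- by rewrite xt yt addr0 mul0r.
Qed.
Let mulDr : right_distributive mul +%R.
Proof.
move=> x y z; apply: gcoef_inj => g /=; rewrite !convE -big_split /=.
by apply: eq_bigr => t _; rewrite mulrDr.
Qed.
HB.instance Definition _ :=
  GRing.Zmodule_isPzRing.Build grpalg mulA mul1 mulr1T mulDl mulDr.

Let scaleA a b v : scale a (scale b v) = scale (a * b) v.
Proof. by apply: gcoef_inj => g /=; rewrite mulrA. Qed.
Let scale1 v : scale 1 v = v.
Proof. by apply: gcoef_inj => g /=; rewrite mul1r. Qed.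
Let scaleDr a (x y : grpalg) : scale a (x + y) = scale a x + scale a y.
Proof. by apply: gcoef_inj => g /=; rewrite mulrDr. Qed.
Let scaleDl a b (v : grpalg) : scale (a + b) v = scale a v + scale b v.
Proof. by apply: gcoef_inj => g /=; rewrite mulrDl. Qed.

Let sAl (a : C) (u v : grpalg) : scale a (u * v) = scale a u * v.
Proof.
apply: gcoef_inj => g /=; rewrite convE /conv (fsbigTE (gsupp u)).
  by rewrite mulr_sumr; apply: eq_bigr => t _; rewrite mulrA.
by move=> t /gsuppP ->; rewrite mulr0 mul0r.
Qed.
Let sAr (a : C) (u v : grpalg) : scale a (u * v) = u * scale a v.
Proof.
apply: gcoef_inj => g /=; rewrite !convE.
by rewrite mulr_sumr; apply: eq_bigr => t _; rewrite mulrCA.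
Qed.
Let sK : involutive starg.
Proof. by move=> x; apply: gcoef_inj => g /=; rewrite invgK conjCK. Qed.
Let sD : {morph starg : u v / u + v}.
Proof. by move=> x y; apply: gcoef_inj => g /=; rewrite rmorphD. Qed.
Let sZ (a : C) (u : grpalg) : starg (scale a u) = scale a^* (starg u).
Proof. by apply: gcoef_inj => g /=; rewrite rmorphM. Qed.
Let sM (u v : grpalg) : starg (u * v) = starg v * starg u.
Proof.
apply: gcoef_inj => g /=; rewrite convE /conv.
rewrite (reindex_fsbigT (fun t => g * t)%g); last first.
  by exists (fun t => g^-1 * t)%g => t; [exact: mulKg|exact: mulVKg].
have e t : (((g * t)^-1 * g)^-1 = t)%g by rewrite [in X in (X^-1)%g]invgM mulgVK invgK.
rewrite (fsbigTE (gsupp u)).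
  rewrite rmorph_sum; apply: eq_bigr => t _.
  by rewrite rmorphM /= e invgM mulrC.
by move=> t /gsuppP ut; rewrite e ut rmorph0 mulr0.
Qed.
HB.instance Definition _ := isStarAlgebra.Build C grpalg
  scaleA scale1 scaleDr scaleDl sAl sAr sK sD sZ sM.

End GroupAlgebra.

Section GroupAlgebraSums.
Context (C : numClosedFieldType) (G : groupType).

Lemma sum_mulE (V : nmodType) (F : G -> C -> V) (x y : grpalg C G) :
  (forall g, {morph F g : a b / a + b}) -> (forall g, F g 0 = 0) ->
  \sum_(u \in [set: G]) F u (gcoef (x * y) u) =
  \sum_(t \in [set: G]) \sum_(u \in [set: G]) F (t * u)%g (x t * y u).
Proof. exact: sum_mul. Qed.

Lemma grpalgBE (x y : grpalg C G) g : gcoef (x - y) g = x g - y g.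
Proof. by []. Qed.
Lemma grpalgZE a (x : grpalg C G) g : gcoef (a *c x) g = a * x g.
Proof. by []. Qed.
Lemma grpalgSE (x : grpalg C G) g : gcoef (star x) g = (x g^-1%g)^*.
Proof. by []. Qed.
Lemma grpalg1E (g : G) : gcoef 1 g = (g == 1%g)%:R :> C.
Proof. by []. Qed.

End GroupAlgebraSums.

(* [inner] is linear in its first argument and conjugate-linear in the second. *)

Record hilbert (R : realType) := Hilbert {
  hsort :> completeNormedModType R[i];
  inner : {dot hsort for Num.conj};
  inner_norm : forall x : hsort, inner x x = `|x| ^+ 2
}.

Section UniversalNorm.
Context (R : realType) (G : groupType).
Local Notation C := R[i].

Record unitary_rep (H : hilbert R) := UnitaryRep {
  urep :> G -> {linear H -> H};
  urep1 : forall v, urep 1%g v = v;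
  urepM : forall g h v, urep (g * h)%g v = urep g (urep h v);
  urep_inner : forall g v w, inner H (urep g v) (urep g w) = inner H v w
}.

Definition integrated (H : hilbert R) (U : unitary_rep H) (x : grpalg C G)
  (v : H) : H := \sum_(g \in [set: G]) x g *: U g v.

(* The full C*-norm: the supremum runs over all unitary representations of G on
   all Hilbert spaces.  It is finite by [integrated_bounded]. *)
Definition univ_norm (x : grpalg C G) : R :=
  sup [set r | exists (H : hilbert R) (U : unitary_rep H),
                 r = opnorm (inner H) (integrated U x)].

Section Rep.
Context (H : hilbert R) (U : unitary_rep H).
Local Notation f := (inner H).
Local Notation I := (integrated U).

Let IE x v : I x v = \sum_(g <- gsupp x) x g *: U g v.
Proof. by apply: fsbigTE => g /gsuppP ->; rewrite scale0r. Qed.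

Lemma integrated_bounded x v :
  vnorm f (I x v) <= (\sum_(g <- gsupp x) cabs (x g)) * vnorm f v.
Proof.
rewrite IE mulr_suml.
elim/big_ind2 : _ => [|a b c d ab cd|g _]; first by rewrite vnorm0.
  by rewrite (le_trans (ler_vnormD _ _ _))// lerD.
by rewrite vnormZ /vnorm urep_inner.
Qed.

Lemma integratedB x y v : I (x - y) v = I x v - I y v.
Proof.
pose A := (gsupp x `|` gsupp y)%fset.
rewrite /integrated !(fsbigTE A) -?sumrB.
- by apply: eq_bigr => t _; rewrite grpalgBE scalerBl.
all: move=> t; rewrite inE negb_or => /andP[/gsuppP xt /gsuppP yt].
- by rewrite yt scale0r.
- by rewrite xt scale0r.
- by rewrite grpalgBE xt yt subr0 scale0r.
Qed.

Lemma integratedZ a x v : I (a *c x) v = a *: I x v.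
Proof.
rewrite [in RHS]IE /integrated (fsbigTE (gsupp x)).
  by rewrite scaler_sumr; apply: eq_bigr => t _; rewrite grpalgZE scalerA.
by move=> t /gsuppP; rewrite grpalgZE => ->; rewrite mulr0 scale0r.
Qed.

Lemma integrated1 v : I 1 v = v.
Proof.
rewrite /integrated (fsbigTE [fset 1%g]%fset).
  by rewrite big_seq_fset1 grpalg1E eqxx scale1r urep1.
by move=> t; rewrite grpalg1E inE => /negPf ->; rewrite scale0r.
Qed.

Lemma integratedM x y v : I (x * y) v = I x (I y v).
Proof.
rewrite [LHS]/integrated (@sum_mulE _ _ _ (fun u a => a *: U u v)).
- apply: eq_fsbigr => t _; rewrite IE linear_sum scaler_sumr.
  rewrite (fsbigTE (gsupp y)).
    by apply: eq_bigr => u _; rewrite urepM linearZ /= scalerA.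
  by move=> u /gsuppP ->; rewrite mulr0 scale0r.
- by move=> u a b; rewrite scalerDl.
- by move=> u; rewrite scale0r.
Qed.

Let urep_adj g v w : f (U g v) w = f v (U g^-1%g w).
Proof. by rewrite -(urep_inner U g v) -urepM mulgV urep1. Qed.

Lemma integratedS x v w : f (I x v) w = f v (I (star x) w).
Proof.
rewrite IE /integrated (reindex_fsbigT (fun g : G => g^-1%g)); last first.
  by exists (fun g : G => g^-1%g) => t; exact: invgK.
rewrite (fsbigTE (gsupp x)); last first.
  by move=> t /gsuppP; rewrite grpalgSE invgK => ->; rewrite rmorph0 scale0r.
rewrite linear_sumlz linear_sumr; apply: eq_bigr => g _.
rewrite linearZl_LR linearZr_LR grpalgSE invgK /= urep_adj.
by rewrite conjCK.
Qed.

Lemma integrated_opnorm x v : vnorm f (I x v) <= opnorm f (I x) * vnorm f v.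
Proof.
apply: (@le_opnorm _ _ _ _ (\sum_(g <- gsupp x) cabs (x g))).
  move=> a u; rewrite !IE scaler_sumr; apply: eq_bigr => g _.
  by rewrite linearZ/= !scalerA mulrC.
exact: integrated_bounded.
Qed.

End Rep.

Lemma univ_norm_ub (H : hilbert R) (U : unitary_rep H) x :
  opnorm (inner H) (integrated U x) <= univ_norm x.
Proof.
apply: ub_le_sup; last by exists H, U.
exists (\sum_(g <- gsupp x) cabs (x g)) => _ [K [W ->]].
apply: opnorm_le; last exact: integrated_bounded.
by apply: sumr_ge0 => g _; exact: cabs_ge0.
Qed.

Lemma univ_norm_le x M : 0 <= M ->
  (forall (H : hilbert R) (U : unitary_rep H),
     opnorm (inner H) (integrated U x) <= M) -> univ_norm x <= M.
Proof.
move=> M0 xM; rewrite /univ_norm; set S := [set _ | _].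
have [S0|S0] := pselect (S !=set0).
  by apply: ge_sup => // _ [H [U ->]].
by rewrite sup_out// => -[].
Qed.

Lemma univ_norm_vnorm (H : hilbert R) (U : unitary_rep H) x v :
  vnorm (inner H) (integrated U x v) <= univ_norm x * vnorm (inner H) v.
Proof.
rewrite (le_trans (integrated_opnorm U x v))//.
by rewrite ler_wpM2r ?vnorm_ge0// univ_norm_ub.
Qed.

Let un_ge0 x : 0 <= univ_norm x.
Proof.
rewrite /univ_norm; set S := [set _ | _].
have [hs|hs] := pselect (has_sup S); last by rewrite sup_out.
have [[_ [H [U _]]] _] := hs.
exact: (le_trans (opnorm_ge0 _ _) (univ_norm_ub U x)).
Qed.
Let unB x y : univ_norm (x - y) <= univ_norm x + univ_norm y.
Proof.
apply: univ_norm_le => [|H U]; first by rewrite addr_ge0.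
apply: opnorm_le => [|v]; first by rewrite addr_ge0.
rewrite integratedB (le_trans (ler_vnormD _ _ _))// vnormN mulrDl.
by rewrite lerD// univ_norm_vnorm.
Qed.
Let unZ (a : C) x : univ_norm (a *c x) <= cabs a * univ_norm x.
Proof.
apply: univ_norm_le => [|H U]; first by rewrite mulr_ge0 ?cabs_ge0.
apply: opnorm_le => [|v]; first by rewrite mulr_ge0 ?cabs_ge0.
by rewrite integratedZ vnormZ -mulrA ler_wpM2l ?cabs_ge0 ?univ_norm_vnorm.
Qed.
Let un1 : univ_norm 1 <= 1.
Proof.
apply: univ_norm_le => // H U; apply: opnorm_le => // v.
by rewrite integrated1 mul1r.
Qed.
Let unM x y : univ_norm (x * y) <= univ_norm x * univ_norm y.
Proof.
apply: univ_norm_le => [|H U]; first by rewrite mulr_ge0.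
apply: opnorm_le => [|v]; first by rewrite mulr_ge0.
rewrite integratedM (le_trans (univ_norm_vnorm _ _ _))// -mulrA.
by rewrite ler_wpM2l// univ_norm_vnorm.
Qed.
Let unS x : univ_norm (star x) <= univ_norm x.
Proof.
apply: univ_norm_le => // H U; apply: opnorm_le => // v.
apply: (@vnorm_adj _ _ _ (integrated U x)) => [w|u w].
  exact: univ_norm_vnorm.
exact: integratedS.
Qed.

Definition univ_seminorm : starSeminorm (grpalg C G) :=
  StarSeminorm un_ge0 unB unZ un1 unM unS.

Definition group_Cstar : starAlgType C := completion univ_seminorm.

End UniversalNorm.

Section MainDefinitions.
Context (R : realType).
Local Notation C := R[i].

Definition bounded_function (G : groupType) (f : G -> R) : Prop :=
  exists M, forall g, `|f g| <= M.

(* [m] is only constrained on bounded functions, i.e. it is a left-invariant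
   state on the real l^oo(G). *)
Definition invariant_mean (G : groupType) (m : (G -> R) -> R) : Prop :=
  [/\ forall (a : R) (f h : G -> R), bounded_function f -> bounded_function h ->
        m (fun g => a * f g + h g) = a * m f + m h,
      forall f, bounded_function f -> (forall g, 0 <= f g) -> 0 <= m f,
      m (fun=> 1) = 1 &
      forall (t : G) f, bounded_function f -> m (fun g => f (t^-1 * g)%g) = m f].

Definition amenable (G : groupType) : Prop :=
  exists m : (G -> R) -> R, invariant_mean m.

Definition matrix_prod (n : nat -> nat) :
    starSubalg (seqalg (fun k => 'M[C]_(n k) : starAlgType C)) :=
  bounded_subalg (fun k => mx_seminorm R (n k)).

Definition matrix_sum (n : nat -> nat) : starIdeal (subalg (matrix_prod n)) :=
  null_ideal (fun a (ba : matrix_prod n a) => ba).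

(* Only the *-algebra structure of the quotient is recorded: it determines the
   unitary group. *)
Definition Qalg (n : nat -> nat) : starAlgType C := quotalg (matrix_sum n).

Definition MF (G : groupType) : Prop :=
  exists n : nat -> nat,
    [/\ forall k, (0 < n k)%N,
        forall k, (n k < n k.+1)%N &
        exists phi : G -> Qalg n,
          [/\ forall g, unitary (phi g),
              forall g h, phi (g * h)%g = phi g * phi h &
              injective phi]].

Definition separable (T : topologicalType) : Prop :=
  exists2 D : set T, countable D & dense D.

Section Operators.
Context (H : hilbert R).

Definition projection (P : {linear H -> H}) : Prop :=
  (forall v, P (P v) = P v) /\ (forall v w, inner H (P v) w = inner H v (P w)).

Definition compact_operator (T : {linear H -> H}) : Prop :=
  compact (closure [set T v | v in [set v | `|v| <= 1]]).

Definition operator_le (S T : {linear H -> H}) : Prop :=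
  forall v, inner H (S v) v <= inner H (T v) v.

(* [opnorm] is a supremum in R, hence meaningful for bounded operators only;
   the commutators below are bounded because T is continuous. *)
Definition quasidiagonal_set (Omega : set {linear H -> H}) : Prop :=
  (forall T, Omega T -> continuous T) /\
  exists P : nat -> {linear H -> H},
    [/\ forall n, projection (P n) /\ compact_operator (P n),
        forall n, operator_le (P n) (P n.+1),
        forall v, P n v @[n --> \oo] --> v &
        forall T, Omega T ->
          opnorm (inner H) (fun v => P n (T v) - T (P n v)) @[n --> \oo]
            --> (0 : R)].

Record star_rep (A : starAlgType C) := StarRep {
  srep :> A -> {linear H -> H};
  srep_continuous : forall a, continuous (srep a);
  srepD : forall a b v, srep (a + b) v = srep a v + srep b v;
  srepZ : forall (c : C) a v, srep (c *c a) v = c *: srep a v;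
  srepM : forall a b v, srep (a * b) v = srep a (srep b v);
  srepS : forall a v w, inner H (srep a v) w = inner H v (srep (star a) w)
}.

Definition faithful (A : starAlgType C) (pi : star_rep A) : Prop :=
  forall a b, (forall v, pi a v = pi b v) -> a = b.

End Operators.

(* Meant for (the *-algebra underlying) a separable C*-algebra, such as
   [group_Cstar R G] for a countable G.  As for [star_rep], the unit of A need
   not act as the identity of H. *)
Definition quasidiagonal (A : starAlgType C) : Prop :=
  exists (H : hilbert R) (pi : star_rep H A),
    [/\ separable H, faithful pi & quasidiagonal_set (range pi)].

End MainDefinitions.

(* Main.v *)
(* MF => QD.  Amenability gives Reiter functions, by Hahn-Banach separation.  The
   MF property gives almost multiplicative unitary maps on matrices that separate
   the points of G; adding a trivial summand and taking tensor powers makes their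
   coefficients off the identity small, so that some vector has an almost
   orthonormal orbit.  Weighted by the square root of a Reiter function, such an
   orbit yields an approximate form of Fell's absorption principle: any
   approximate representation sits almost equivariantly in a multiple of any
   sufficiently good one.  This produces a sequence of approximate
   representations s_n on C^(d_n), each contained in the next up to summable
   errors, whose limit is a unitary representation U on l^2 almost commuting with
   the projections onto the first d_n coordinates.  The absorption estimate
   applied to an arbitrary unitary representation W bounds W(x) by U(x), hence U
   is faithful on C*(G).

   QD => MF.  Compress the unitaries of G to the ranges of the projections.  The
   compressions separate the points of G because a faithful representation of
   C*(G) does, and the point g is recovered from its class in C*(G) by the
   regular representation. *)

(* MF alone gives matrix models of unrelated sizes, whereas quasidiagonality asks for one Hilbert
   space with increasing projections; the obstacle is to nest one model in the next. For the regular
   representation, Fell's map v -> sum_h delta_h (x) W(h)^-1 v intertwines exactly, but the constant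
   weight 1 on G is not square-summable in general. The square root of a Reiter function is a unit
   vector that translations almost fix, and it replaces that weight. Only finitely many points of
   the orbit then matter, so a finite-dimensional model of the orbit is enough. The triangle
   inequality over the support [A n] multiplies the orbit error by [size (A n)]. Hence the Reiter
   functions are chosen before the matrices, and the accuracy [e n] is divided by the sizes of these
   supports. The absorption estimate holds for every unitary representation, so the limit is
   compared with the universal norm directly, without passing through the reduced C*-algebra. *)
From HB Require Import structures.
From mathcomp Require Import all_boot all_order all_algebra sesquilinear spectral.
From mathcomp Require Import finmap.
From mathcomp Require Import boolp classical_sets functions cardinality fsbigop.
From mathcomp Require Import reals topology normedtype sequences.
From mathcomp Require Import complex mxtens.
From mathcomp Require Import ring lra zify.
Require Import Defs.

Set Implicit Arguments.
Unset Strict Implicit.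
Unset Printing Implicit Defensive.

Import Order.TTheory GRing.Theory Num.Theory Num.Def.
Import numFieldNormedType.Exports.

Local Open Scope classical_set_scope.
Local Open Scope ring_scope.
Local Open Scope sesquilinear_scope.

(** * Norm estimates for matrices and tensor products *)

Section ComplexModulus.
Context (R : realType).
Local Notation C := R[i].
Local Notation Re := (@complex.Re R).
Implicit Types z w : C.

Lemma cabs_eq z (a : R) : `|z| = (a%:C)%C -> cabs z = a.
Proof. by rewrite -cabsE => /(congr1 Re). Qed.

Lemma cabs0 : cabs (0 : C) = 0.
Proof. by apply: cabs_eq; rewrite normr0. Qed.

Lemma cabs1 : cabs (1 : C) = 1.
Proof. by apply: cabs_eq; rewrite normr1. Qed.

Lemma cabsM z w : cabs (z * w) = cabs z * cabs w.
Proof. by apply: cabs_eq; rewrite normrM rmorphM /= !cabsE. Qed.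

Lemma cabsN z : cabs (- z) = cabs z.
Proof. by apply: cabs_eq; rewrite normrN cabsE. Qed.

Lemma cabsD z w : cabs (z + w) <= cabs z + cabs w.
Proof. by rewrite -lecR rmorphD /= !cabsE ler_normD. Qed.

Lemma cabs_real (a : R) : cabs (a%:C)%C = `|a|.
Proof.
have [a0|a0] := leP 0 a; apply: cabs_eq.
  by rewrite !ger0_norm ?lecR.
by rewrite !ltr0_norm ?ltcR// rmorphN.
Qed.

Lemma cabs_sum (I : Type) (r : seq I) (F : I -> C) :
  cabs (\sum_(i <- r) F i) <= \sum_(i <- r) cabs (F i).
Proof.
elim/big_ind2 : _ => [|x a y b xa yb|//]; first by rewrite cabs0.
by rewrite (le_trans (cabsD _ _))// lerD.
Qed.

Lemma cabs_eq0 z : cabs z = 0 -> z = 0.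
Proof. by move=> z0; apply/eqP; rewrite -normr_eq0 -cabsE z0. Qed.

Lemma conjc_real (a : R) : ((a%:C)%C)^* = (a%:C)%C.
Proof. by apply/eqP; rewrite eq_complex /= oppr0 !eqxx. Qed.

Lemma cabs_sqr z : ((cabs z ^+ 2)%:C)%C = z * z^*.
Proof. by rewrite rmorphXn /= cabsE normCK. Qed.

Lemma cabs_sqr_Re z : cabs z ^+ 2 = Re (z * z^*).
Proof. by rewrite -cabs_sqr. Qed.

End ComplexModulus.

Section DotTheory.
Context (R : realType).
Local Notation C := R[i].
Local Notation Re := (@complex.Re R).
Context (V : lmodType C) (f : {dot V for Num.conj}).
Implicit Types u v : V.

Lemma dot_conj u v : f u v = (f v u)^*.
Proof. by rewrite (hermC f) expr0 mul1r. Qed.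

(** Cauchy-Schwarz in [dot_cs] bounds only the real part; multiplying u by a phase makes the product
    real and nonnegative. *)
Lemma dot_cabs u v : cabs (f u v) <= vnorm f u * vnorm f v.
Proof.
have [z0|z0] := eqVneq (f u v) 0.
  by rewrite z0 cabs0 mulr_ge0 ?vnorm_ge0.
pose a := (f u v)^* / `|f u v|.
have na : cabs a = 1.
  by apply: cabs_eq; rewrite normf_div norm_conjC normr_id divff// normr_eq0.
have -> : cabs (f u v) = Re (f (a *: u) v).
  rewrite linearZl_LR /= /a /cabs mulrAC [_^* * _]mulrC -normCK expr2 mulfK //.
  by rewrite normr_eq0.
by rewrite (le_trans (dot_cs _ _ _))// vnormZ na mul1r.
Qed.

Lemma vnormB u v : vnorm f (u - v) = vnorm f (v - u).
Proof. by rewrite -opprB vnormN. Qed.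

Lemma ler_vnormB u v w : vnorm f (u - w) <= vnorm f (u - v) + vnorm f (v - w).
Proof. by rewrite (le_trans _ (ler_vnormD _ _ _))// addrA subrK. Qed.

Lemma ler_vnorm_dist u v : vnorm f u <= vnorm f (u - v) + vnorm f v.
Proof. by rewrite (le_trans _ (ler_vnormD _ _ _))// subrK. Qed.

Lemma vnorm_sum (I : Type) (r : seq I) (F : I -> V) :
  vnorm f (\sum_(i <- r) F i) <= \sum_(i <- r) vnorm f (F i).
Proof.
elim/big_ind2 : _ => [|x a y b xa yb|//]; first by rewrite vnorm0.
by rewrite (le_trans (ler_vnormD _ _ _))// lerD.
Qed.

Lemma vnorm_eq (a : R) v : 0 <= a -> f v v = ((a ^+ 2)%:C)%C -> vnorm f v = a.
Proof. by move=> a0 fv; rewrite /vnorm fv /= sqrtr_sqr ger0_norm. Qed.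

Lemma vnormBE u v :
  vnorm f (u - v) ^+ 2 = vnorm f u ^+ 2 + vnorm f v ^+ 2 - Re (f u v) *+ 2.
Proof.
rewrite !vnorm_sqr dnormB /=.
by case: (f u u) (f v v) (f u v) => [a b] [c d] [x y] /=; rewrite mulr2n.
Qed.

Lemma vnormDE u v :
  vnorm f (u + v) ^+ 2 = vnorm f u ^+ 2 + vnorm f v ^+ 2 + Re (f u v) *+ 2.
Proof.
rewrite !vnorm_sqr dnormD /=.
by case: (f u u) (f v v) (f u v) => [a b] [c d] [x y] /=; rewrite mulr2n.
Qed.

End DotTheory.

Section Isometry.
Context (R : realType).
Local Notation C := R[i].
Local Notation Re := (@complex.Re R).

(** Polarization: the norm of [T (u + v)] determines the real part of the product, and replacing u
    by i u gives the imaginary part. *)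
Lemma isometry_dot (V W : lmodType C) (f : {dot V for Num.conj})
    (g : {dot W for Num.conj}) (T : V -> W) : linear T ->
  (forall v, vnorm g (T v) = vnorm f v) ->
  forall u v, g (T u) (T v) = f u v.
Proof.
move=> lT nT.
have TD u v : T (u + v) = T u + T v by rewrite -[u]scale1r lT !scale1r.
have T0 : T 0 = 0 by apply: (addrI (T 0)); rewrite -TD !addr0.
have TZ a u : T (a *: u) = a *: T u by rewrite -[a *: u]addr0 lT T0 addr0.
have ReE u v : Re (g (T u) (T v)) = Re (f u v).
  have := vnormDE g (T u) (T v); rewrite -TD !nT vnormDE => /addrI/eqP.
  by rewrite eqr_pMn2r// => /eqP.
move=> u v; apply/eqP; rewrite eq_complex ReE eqxx /=.
have := ReE ((0 +i* 1)%C *: u) v; rewrite TZ !linearZl_LR /=.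
case: (g _ _) (f u v) => [a b] [c d] /=.
by rewrite !mul0r !mul1r !sub0r => /eqP; rewrite eqr_opp.
Qed.

End Isometry.

Section MatrixBounds.
Context (R : realType).
Local Notation C := R[i].
Local Notation Re := (@complex.Re R).

Definition cnorm n (v : 'cV[C]_n) : R := vnorm (@coldot C n) v.

Lemma cnorm_ge0 n (v : 'cV[C]_n) : 0 <= cnorm v.
Proof. exact: vnorm_ge0. Qed.

Lemma cnorm_sqr n (v : 'cV[C]_n) : cnorm v ^+ 2 = \sum_i cabs (v i 0) ^+ 2.
Proof.
apply: (@complexI R); rewrite -fvvE rmorph_sum; apply: eq_bigr => i _.
by rewrite /= cabs_sqr.
Qed.

Lemma cabs_le_cnorm n (v : 'cV[C]_n) i : cabs (v i 0) <= cnorm v.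
Proof.
rewrite -(@ler_pXn2r _ 2) ?nnegrE ?cnorm_ge0 ?cabs_ge0// cnorm_sqr.
by rewrite (bigD1 i)//= lerDl sumr_ge0// => j _; rewrite sqr_ge0.
Qed.

Lemma cnorm_delta n (i : 'I_n) : cnorm (delta_mx i 0) = 1.
Proof.
apply/eqP; rewrite -(@eqrXn2 _ 2)// ?cnorm_ge0// cnorm_sqr (bigD1 i)//=.
rewrite mxE !eqxx cabs1 big1 ?addr0 ?expr1n// => j ji.
by rewrite mxE (negPf ji) cabs0 expr0n.
Qed.

Lemma cnorm_le_sum n (v : 'cV[C]_n) : cnorm v <= \sum_i cabs (v i 0).
Proof.
have -> : v = \sum_i v i 0 *: delta_mx i 0.
  by rewrite [LHS]matrix_sum_delta; apply: eq_bigr => i _; rewrite big_ord1.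
rewrite (le_trans (vnorm_sum _ _ _))//; apply: ler_sum => i _.
rewrite vnormZ -/(cnorm _) cnorm_delta mulr1 summxE (bigD1 i)//= big1.
  by rewrite !mxE !eqxx mulr1 addr0.
by move=> j ji; rewrite !mxE eq_sym (negPf ji) mulr0.
Qed.

Lemma coldot_adj m n (A : 'M[C]_(m, n)) x y :
  coldot (A *m x) y = coldot x (A ^t* *m y).
Proof.
rewrite /coldot.
transitivity (\sum_i \sum_j A i j * x j 0 * (y i 0)^*).
  by apply: eq_bigr => i _; rewrite mxE mulr_suml.
rewrite exchange_big; apply: eq_bigr => j _ /=.
rewrite mxE rmorph_sum mulr_sumr; apply: eq_bigr => i _.
by rewrite !mxE rmorphM /= conjCK -mulrA mulrCA.
Qed.

Lemma trmxC_mul m n p (A : 'M[C]_(m, n)) (B : 'M[C]_(n, p)) :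
  (A *m B) ^t* = B ^t* *m A ^t*.
Proof. by rewrite trmx_mul map_mxM. Qed.

Lemma coldot_isom m n (A : 'M[C]_(m, n)) x y : A ^t* *m A = 1%:M ->
  coldot (A *m x) (A *m y) = coldot x y.
Proof. by move=> AA; rewrite coldot_adj mulmxA AA mul1mx. Qed.

Lemma cnorm_isom m n (A : 'M[C]_(m, n)) x : A ^t* *m A = 1%:M ->
  cnorm (A *m x) = cnorm x.
Proof. by move=> AA; rewrite /cnorm /vnorm /= coldot_isom. Qed.

(** A bound on the operator norm without the supremum, available for rectangular matrices;
    [mxbound_opnorm] and [opnorm_mxbound] relate it to [mx_seminorm]. *)
Definition mxbound m n (A : 'M[C]_(m, n)) (M : R) : Prop :=
  forall v, cnorm (A *m v) <= M * cnorm v.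

Lemma mxbound_le m n (A : 'M[C]_(m, n)) (M N : R) : M <= N ->
  mxbound A M -> mxbound A N.
Proof. by move=> MN AM v; rewrite (le_trans (AM v))// ler_wpM2r// cnorm_ge0. Qed.

Lemma mxboundD m n (A B : 'M[C]_(m, n)) (M N : R) :
  mxbound A M -> mxbound B N -> mxbound (A + B) (M + N).
Proof.
move=> AM BN v; rewrite mulmxDl (le_trans (ler_vnormD _ _ _))// mulrDl.
by rewrite lerD ?AM ?BN.
Qed.

Lemma mxboundN m n (A : 'M[C]_(m, n)) (M : R) : mxbound A M -> mxbound (- A) M.
Proof. by move=> AM v; rewrite mulNmx /cnorm vnormN AM. Qed.

Lemma mxboundBC m n (A B : 'M[C]_(m, n)) (M : R) :
  mxbound (A - B) M -> mxbound (B - A) M.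
Proof. by move/mxboundN; rewrite opprB. Qed.

Lemma mxboundBt m n (A B D : 'M[C]_(m, n)) (M N : R) :
  mxbound (A - B) M -> mxbound (B - D) N -> mxbound (A - D) (M + N).
Proof. by move=> AB BD; rewrite -[A - D](subrKA B); exact: mxboundD. Qed.

Lemma mxboundM m n p (A : 'M[C]_(m, n)) (B : 'M[C]_(n, p)) (M N : R) : 0 <= M ->
  mxbound A M -> mxbound B N -> mxbound (A *m B) (M * N).
Proof.
move=> M0 AM BN v; rewrite -mulmxA (le_trans (AM _))// -mulrA.
by rewrite ler_wpM2l.
Qed.

Lemma mxbound_isom m n (A : 'M[C]_(m, n)) : A ^t* *m A = 1%:M -> mxbound A 1.
Proof. by move=> AA v; rewrite cnorm_isom// mul1r. Qed.

Lemma mxbound0 m n (M : R) : 0 <= M -> mxbound (0 : 'M[C]_(m, n)) M.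
Proof.
by move=> M0 v; rewrite mul0mx /cnorm vnorm0 mulr_ge0// cnorm_ge0.
Qed.

(** A crude bound, enough to make the supremum in [opnorm] finite and to control a matrix with tiny
    entries. *)
Lemma mxbound_entries m n (A : 'M[C]_(m, n)) :
  mxbound A (\sum_i \sum_j cabs (A i j)).
Proof.
move=> v; rewrite (le_trans (cnorm_le_sum _))// mulr_suml ler_sum// => i _.
rewrite mxE (le_trans (cabs_sum _ _))// mulr_suml ler_sum// => j _.
by rewrite cabsM ler_wpM2l ?cabs_ge0 ?cabs_le_cnorm.
Qed.

Lemma mxbound_opnorm n (A : 'M[C]_n) : mxbound A (mx_seminorm R n A).
Proof.
apply: (@le_opnorm _ _ _ (mulmx A)); last exact: mxbound_entries.
by move=> a x; rewrite -scalemxAr.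
Qed.

Lemma opnorm_mxbound n (A : 'M[C]_n) (M : R) : 0 <= M ->
  mxbound A M -> mx_seminorm R n A <= M.
Proof. by move=> M0 AM; exact: opnorm_le. Qed.

End MatrixBounds.

Section Tensor.
Context (R : realType).
Local Notation C := R[i].

Lemma sum_mxtens (V : nmodType) m n (F : 'I_(m * n) -> V) :
  \sum_k F k = \sum_(i < m) \sum_(j < n) F (mxtens_index (i, j)).
Proof.
rewrite pair_big /= (reindex (@mxtens_index m n)) /=.
  by apply: eq_bigr => -[].
by exists (@mxtens_unindex m n) => k _; rewrite ?mxtens_indexK ?mxtens_unindexK.
Qed.

Lemma tensmx_adj m n p q (A : 'M[C]_(m, n)) (B : 'M[C]_(p, q)) :
  (A *t B) ^t* = A ^t* *t B ^t*.
Proof. by rewrite trmx_tens map_mxT. Qed.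

Lemma tensmx1 m n : (1%:M : 'M[C]_m) *t (1%:M : 'M[C]_n) = 1%:M.
Proof.
apply/matrixP => k l; case: (mxtens_indexP k) => i j; case: (mxtens_indexP l) => i' j'.
rewrite tensmxE !mxE -natrM mulnb; congr (_%:R); congr nat_of_bool.
by rewrite (can_eq (@mxtens_indexK m n)) xpair_eqE.
Qed.

Lemma tensmxBl m n p q (A A' : 'M[C]_(m, n)) (B : 'M[C]_(p, q)) :
  (A - A') *t B = A *t B - A' *t B.
Proof. by apply/matrixP => i j; rewrite !mxE mulrBl. Qed.

Lemma tensmxBr m n p q (A : 'M[C]_(m, n)) (B B' : 'M[C]_(p, q)) :
  A *t (B - B') = A *t B - A *t B'.
Proof. by apply/matrixP => i j; rewrite !mxE mulrBr. Qed.

Lemma tensmx_isom m n p q (A : 'M[C]_(m, n)) (B : 'M[C]_(p, q)) :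
  A ^t* *m A = 1%:M -> B ^t* *m B = 1%:M -> (A *t B) ^t* *m (A *t B) = 1%:M.
Proof. by move=> AA BB; rewrite tensmx_adj tensmx_mul AA BB tensmx1. Qed.

Lemma tensmx_mulv m n p q (A : 'M[C]_(m, n)) (B : 'M[C]_(p, q))
    (u : 'cV[C]_n) (v : 'cV[C]_q) :
  (A *t B) *m (u *t v : 'cV[C]_(n * q)) = (A *m u) *t (B *m v).
Proof. exact: (@tensmx_mul _ m n p q 1 1). Qed.

Lemma coldot_tens m n (u u' : 'cV[C]_m) (v v' : 'cV[C]_n) :
  @coldot C (m * n) (u *t v) (u' *t v') = coldot u u' * coldot v v'.
Proof.
rewrite /coldot sum_mxtens mulr_suml; apply: eq_bigr => i _.
rewrite mulr_sumr; apply: eq_bigr => j _.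
have tE (a : 'cV[C]_m) (b : 'cV[C]_n) :
    (a *t b) (mxtens_index (i, j)) 0 = a i 0 * b j 0.
  by rewrite mxE mxtens_indexK; congr (a _ _ * b _ _); exact: ord1.
by rewrite !tE rmorphM /= mulrACA.
Qed.

Lemma cnorm_tens m n (u : 'cV[C]_m) (v : 'cV[C]_n) :
  @cnorm R (m * n) (u *t v) = cnorm u * cnorm v.
Proof.
apply: vnorm_eq; first by rewrite mulr_ge0 ?cnorm_ge0.
rewrite /= coldot_tens (fvvE (@coldot C m) u) (fvvE (@coldot C n) v) exprMn.
by rewrite [RHS]rmorphM.
Qed.

(** The matrix acts separately on the slices of v with fixed second index, and the squared norms of
    the slices add up. *)
Lemma mxbound_tens1r m n (A : 'M[C]_m) (M : R) : 0 <= M ->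
  mxbound A M -> mxbound (A *t (1%:M : 'M[C]_n)) M.
Proof.
move=> M0 AM v; rewrite -(@ler_pXn2r _ 2) ?nnegrE ?mulr_ge0 ?cnorm_ge0//.
pose s (w : 'cV[C]_(m * n)) j : 'cV[C]_m := \col_i w (mxtens_index (i, j)) 0.
have nE (w : 'cV[C]_(m * n)) : cnorm w ^+ 2 = \sum_j cnorm (s w j) ^+ 2.
  rewrite cnorm_sqr sum_mxtens exchange_big; apply: eq_bigr => j _.
  by rewrite cnorm_sqr; apply: eq_bigr => i _; rewrite mxE.
rewrite exprMn !nE mulr_sumr; apply: ler_sum => j _.
have -> : s ((A *t 1%:M) *m v) j = A *m s v j.
  apply/matrixP => i k; rewrite ord1 !mxE sum_mxtens; apply: eq_bigr => i' _.
  rewrite (bigD1 j)//= tensmxE !mxE eqxx mulr1 big1 ?addr0// => j' jj.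
  by rewrite tensmxE mxE eq_sym (negPf jj) mulr0 mul0r.
by rewrite -exprMn ler_pXn2r ?nnegrE ?mulr_ge0 ?cnorm_ge0.
Qed.

Lemma mxbound_tens1l m n (B : 'M[C]_n) (M : R) : 0 <= M ->
  mxbound B M -> mxbound ((1%:M : 'M[C]_m) *t B) M.
Proof.
move=> M0 BM v; rewrite -(@ler_pXn2r _ 2) ?nnegrE ?mulr_ge0 ?cnorm_ge0//.
pose s (w : 'cV[C]_(m * n)) i : 'cV[C]_n := \col_j w (mxtens_index (i, j)) 0.
have nE (w : 'cV[C]_(m * n)) : cnorm w ^+ 2 = \sum_i cnorm (s w i) ^+ 2.
  rewrite cnorm_sqr sum_mxtens; apply: eq_bigr => i _.
  by rewrite cnorm_sqr; apply: eq_bigr => j _; rewrite mxE.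
rewrite exprMn !nE mulr_sumr; apply: ler_sum => i _.
have -> : s ((1%:M *t B) *m v) i = B *m s v i.
  apply/matrixP => j k; rewrite ord1 !mxE sum_mxtens (bigD1 i)//= [X in _ + X]big1.
    by rewrite addr0; apply: eq_bigr => j' _; rewrite tensmxE !mxE eqxx mul1r.
  move=> i' ii; apply: big1 => j' _.
  by rewrite tensmxE mxE eq_sym (negPf ii) mul0r mul0r.
by rewrite -exprMn ler_pXn2r ?nnegrE ?mulr_ge0 ?cnorm_ge0.
Qed.

End Tensor.

(** * Polar decomposition, Gram-Schmidt and completion to a unitary *)

Section Polar.
Context (R : realType).
Local Notation C := R[i].
Local Notation Re := (@complex.Re R).

Lemma diag_mx_bound n (d : 'rV[C]_n) (M : R) : 0 <= M ->
  (forall i, cabs (d 0 i) <= M) -> mxbound (diag_mx d) M.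
Proof.
move=> M0 dM v; rewrite -(@ler_pXn2r _ 2) ?nnegrE ?mulr_ge0 ?cnorm_ge0//.
rewrite exprMn !cnorm_sqr mulr_sumr; apply: ler_sum => i _.
rewrite mul_diag_mx mxE cabsM exprMn ler_wpM2r ?sqr_ge0//.
by rewrite ler_pXn2r ?nnegrE ?cabs_ge0.
Qed.

Lemma mulmx_coldot m n p (A : 'M[C]_(m, n)) (B : 'M[C]_(m, p)) i j :
  (A ^t* *m B) i j = coldot (col j B) (col i A).
Proof. by rewrite !mxE; apply: eq_bigr => k _; rewrite !mxE mulrC. Qed.

Lemma spectral_decomposition n (B : 'M[C]_n) : B ^t* = B ->
  exists Q : 'M[C]_n, exists D : 'rV[C]_n,
    [/\ Q ^t* *m Q = 1%:M, Q *m Q ^t* = 1%:M & B = Q ^t* *m diag_mx D *m Q].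
Proof.
move=> Bherm.
have Bnormal : B \is normalmx by apply/normalmxP; rewrite Bherm.
exists (spectralmx B), (spectral_diag B).
have QQ' := unitarymxP (spectral_unitarymx B).
split=> //; first exact: mulmx1C.
by rewrite -invmx_unitary ?spectral_unitarymx//; exact/orthomx_spectralP.
Qed.

(** With B = A^* A diagonalised by Q, the isometry is u = A B^(-1/2), and u - A = u (1 - B^(1/2)).
    The bound d is kept because |1 - sqrt l| <= |1 - l| for every eigenvalue l. *)
Lemma polar m n (A : 'M[C]_(m, n)) (d : R) : 0 <= d -> d < 1 ->
  mxbound (A ^t* *m A - 1%:M) d ->
  exists2 u : 'M[C]_(m, n), u ^t* *m u = 1%:M & mxbound (u - A) d.
Proof.
move=> d0 d1; move BA : (A ^t* *m A) => B Bd.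
have Bherm : B ^t* = B by rewrite -BA trmxC_mul trmxCK.
have [Q [D [QQ QQ' BE]]] := spectral_decomposition Bherm.
have BE' : Q *m B *m Q ^t* = diag_mx D.
  by rewrite BE !mulmxA QQ' mul1mx -mulmxA QQ' mulmx1.
(* An eigenvalue of B is the squared norm of the image under A of a unit eigenvector, hence real;
   being within d < 1 of 1, it is positive. *)
pose l i := cnorm (A *m (Q ^t* *m delta_mx i 0)) ^+ 2.
have DE i : D 0 i = ((l i)%:C)%C.
  rewrite -conjc_real -[LHS]conjCK; congr (_^*).
  rewrite -(fvvE (@coldot C m)) /= coldot_adj mulmxA BA coldot_adj trmxCK.
  rewrite !mulmxA BE' /coldot (bigD1 i)//= big1 ?addr0.
    by rewrite -colE !mxE !eqxx mul1r.
  by move=> j ji; rewrite mxE (negPf ji) mul0r.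
have Dd i : `|l i - 1| <= d.
  rewrite -cabs_real rmorphB /= -DE rmorph1.
  have := Bd (Q ^t* *m delta_mx i 0).
  rewrite [X in _ <= _ * X]cnorm_isom ?trmxCK// cnorm_delta mulr1; apply: le_trans.
  rewrite -(@cnorm_isom _ _ _ Q)// !mulmxA mulmxBr mulmxBl BE' mulmx1 QQ'.
  apply: le_trans (cabs_le_cnorm _ i).
  by rewrite -colE !mxE !eqxx mulr1n.
have l0 i : 0 < l i.
  have := Dd i; rewrite ler_norml => /andP[+ _].
  by rewrite lerBrDr; apply: lt_le_trans; rewrite addrC subr_gt0.
pose a : 'rV[C]_n := \row_i ((Num.sqrt (l i))^-1%:C)%C.
pose b : 'rV[C]_n := \row_i ((Num.sqrt (l i))%:C)%C.
have ab : diag_mx a *m diag_mx b = 1%:M.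
  rewrite mulmx_diag -diag_const_mx; congr diag_mx; apply/rowP => i.
  by rewrite !mxE -rmorphM /= mulVf ?rmorph1// gt_eqF// sqrtr_gt0.
have aDa : diag_mx a *m diag_mx D *m diag_mx a = 1%:M.
  rewrite -mulmxA; have -> : diag_mx D *m diag_mx a = diag_mx b; last exact: ab.
  rewrite mulmx_diag; congr diag_mx; apply/rowP => i.
  rewrite !mxE DE -rmorphM /= -[X in X * _](@sqr_sqrtr _ (l i)) ?ltW// expr2.
  by rewrite mulfK// gt_eqF// sqrtr_gt0.
have ah : (diag_mx a) ^t* = diag_mx a.
  rewrite tr_diag_mx map_diag_mx; congr diag_mx; apply/rowP => i.
  by rewrite !mxE /= conjc_real.
move uE : (A *m (Q ^t* *m diag_mx a *m Q)) => u.
have uu : u ^t* *m u = 1%:M.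
  rewrite -uE !trmxC_mul trmxCK ah -mulmxA (mulmxA _ A) BA BE.
  rewrite -!mulmxA (mulmxA Q) QQ' mul1mx (mulmxA Q) QQ' mul1mx.
  by rewrite (mulmxA (diag_mx a)) (mulmxA _ _ Q) aDa mul1mx.
exists u => //.
have -> : u - A = u *m (Q ^t* *m (diag_mx (const_mx 1 - b) *m Q)).
  rewrite raddfB /= diag_const_mx mulmxBl mul1mx mulmxBr QQ mulmxBr mulmx1.
  congr (_ - _); rewrite -uE -!mulmxA (mulmxA Q) QQ' mul1mx (mulmxA (diag_mx a)).
  by rewrite ab mul1mx QQ mulmx1.
have QdB : mxbound (diag_mx (const_mx 1 - b)) d; last first.
  move=> v; rewrite -!mulmxA cnorm_isom// cnorm_isom ?trmxCK//.
  by rewrite (le_trans (QdB _))// cnorm_isom.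
apply: diag_mx_bound => // i; rewrite !mxE -(rmorph1 (@real_complex R)) -rmorphB cabs_real.
apply: le_trans (Dd i); set s := Num.sqrt _.
have s0 : 0 <= s by exact: sqrtr_ge0.
have -> : l i - 1 = - ((1 - s) * (1 + s)).
  by rewrite -[l i]sqr_sqrtr ?ltW// -/s; ring.
by rewrite normrN normrM ler_peMr// ger0_norm ?addr_ge0// lerDl.
Qed.

End Polar.

Section GramSchmidt.
Context (R : realType).
Local Notation C := R[i].
Context (V : lmodType C) (f : {dot V for Num.conj}).

Definition orthon (e : seq V) : Prop := forall i j, (i < size e)%N ->
  (j < size e)%N -> f e`_i e`_j = (i == j)%:R.

Definition synth (e : seq V) (c : 'cV[C]_(size e)) : V := \sum_i c i 0 *: e`_i.

(** For orthonormal [e], [synth (coord e v)] is the orthogonal projection of v on the span of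
    [e]. *)
Definition coord (e : seq V) (v : V) : 'cV[C]_(size e) := \col_i f v e`_i.

Lemma coord_linear e : linear (coord e).
Proof. by move=> a u v; apply/colP => i; rewrite !mxE linearPl. Qed.

Section Orthon.
Context (e : seq V) (eon : orthon e).

Lemma coord_synth (c : 'cV[C]_(size e)) : coord e (synth c) = c.
Proof.
apply/colP => i; rewrite mxE /synth linear_sumlz (bigD1 i)//= big1 ?addr0.
  by rewrite linearZl_LR /= eon// eqxx mulr1.
by move=> j /negPf ji; rewrite linearZl_LR /= eon// val_eqE ji mulr0.
Qed.

Lemma dot_synth (c : 'cV[C]_(size e)) v : f (synth c) v = coldot c (coord e v).
Proof.
rewrite /synth linear_sumlz; apply: eq_bigr => i _.
by rewrite linearZl_LR /= mxE -dot_conj.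
Qed.

Lemma vnorm_synth (c : 'cV[C]_(size e)) : vnorm f (synth c) = cnorm c.
Proof.
by apply: vnorm_eq; rewrite ?cnorm_ge0// dot_synth coord_synth (fvvE (@coldot C _)).
Qed.

Lemma pythagoras v :
  vnorm f v ^+ 2 = cnorm (coord e v) ^+ 2 + vnorm f (v - synth (coord e v)) ^+ 2.
Proof.
rewrite vnormBE vnorm_synth dot_conj dot_synth (fvvE (@coldot C _)) /=.
by rewrite mulr2n -/(cnorm _); ring.
Qed.

Lemma cnorm_coord v : cnorm (coord e v) <= vnorm f v.
Proof.
rewrite -(@ler_pXn2r _ 2) ?nnegrE ?vnorm_ge0 ?cnorm_ge0//.
by rewrite pythagoras lerDl sqr_ge0.
Qed.

Lemma residue_ortho v i : (i < size e)%N -> f (v - synth (coord e v)) e`_i = 0.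
Proof.
move=> ie; have := congr1 (fun c : 'cV_ _ => c (Ordinal ie) 0) (coord_synth (coord e v)).
by rewrite !mxE /= linearBl /= => ->; rewrite subrr.
Qed.

End Orthon.

(** The normalised residue of each vector of [l] is appended unless it vanishes. The last clause
    says that the new vectors stay in every linear subspace S containing [e] and [l]. *)
Lemma gram_schmidt (e : seq V) : orthon e -> forall l : seq V,
  exists e' : seq V, [/\ orthon (e ++ e'),
    forall v, v \in l -> synth (coord (e ++ e') v) = v &
    forall S : V -> Prop, S 0 -> (forall a u v, S u -> S v -> S (a *: u + v)) ->
      (forall v, v \in e ++ l -> S v) -> forall v, v \in e' -> S v].
Proof.
move=> eon; elim=> [|v l [e' [e'on IH IS]]].
  by exists [::]; split; rewrite ?cats0.
set b := e ++ e' in e'on IH.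
pose r := v - synth (coord b v).
have [r0|r0] := eqVneq r 0.
  exists e'; split=> // [w|S S0 SL Sl].
    rewrite inE => /predU1P[->|/IH//].
    by apply/eqP; rewrite eq_sym -subr_eq0; apply/eqP.
  by apply: IS => // w wl; apply: Sl; move: wl; rewrite !mem_cat inE => /orP[->//|->]; rewrite !orbT.
pose n := vnorm f r.
have n0 : 0 < n.
  rewrite lt_def vnorm_ge0 andbT; apply: contra_neq r0; exact: vnorm_eq0.
pose x := (n^-1%:C)%C *: r.
have xx : f x x = 1.
  rewrite fvvE vnormZ cabs_real ger0_norm ?invr_ge0 ?ltW// mulVf ?gt_eqF//.
  by rewrite expr1n.
have xb i : (i < size b)%N -> f x b`_i = 0.
  by move=> ib; rewrite linearZl_LR /= residue_ortho// mulr0.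
have bx i : (i < size b)%N -> f b`_i x = 0.
  by move=> ib; rewrite dot_conj xb// rmorph0.
have con : orthon (rcons b x).
  move=> i j; rewrite size_rcons !ltnS !nth_rcons.
  case: (ltngtP i (size b)) => [ib|//|ib] _; case: (ltngtP j (size b)) => [jb|//|jb] _.
  - exact: e'on.
  - by rewrite bx// jb ltn_eqF.
  - by rewrite xb// ib gtn_eqF.
  - by rewrite ib jb eqxx.
have synE w : synth (coord (rcons b x) w) = synth (coord b w) + f w x *: x.
  rewrite /synth.
  have big_nthE (s : seq V) : \sum_(i < size s) coord s w i 0 *: s`_i
      = \sum_(y <- s) f w y *: y.
    rewrite (big_nth 0) big_mkord; apply: eq_bigr => i _.
    by rewrite mxE.
  by rewrite !big_nthE -cats1 big_cat big_seq1.
exists (rcons e' x); rewrite -rcons_cat -/b; split=> // [|S S0 SL Sl w]; last first.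
  have Se' : forall w, w \in e' -> S w.
    apply: IS => // y yl; apply: Sl; move: yl.
    by rewrite !mem_cat inE => /orP[->//|->]; rewrite !orbT.
  rewrite mem_rcons inE => /predU1P[->|/Se'//].
  rewrite -[x]addr0; apply: (SL) => //.
  rewrite /r addrC -scaleN1r; apply: (SL); last by apply: Sl; rewrite mem_cat mem_head orbT.
  rewrite /synth; apply: big_ind => // [y z Sy Sz|i _].
    by rewrite -[y]scale1r; exact: (SL).
  rewrite -[_ *: _]addr0; apply: SL => //.
  have := mem_nth 0 (ltn_ord i); rewrite mem_cat => /orP[ie|/Se'//].
  by apply: Sl; rewrite mem_cat ie.
move=> w; rewrite synE inE.
move=> /predU1P[->|wl].
  have -> : f v x = (n%:C)%C.
    rewrite -[v](subrK (synth (coord b v))) -/r linearDl /= dot_synth//.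
    have -> : coord b x = 0 by apply/colP => i; rewrite !mxE xb.
    rewrite linear0r addr0 linearZr_LR /= fvvE -/n.
    by rewrite conjc_real -rmorphM /= expr2 mulrA mulVf ?gt_eqF// mul1r.
  by rewrite scalerA -rmorphM /= mulfV ?gt_eqF// scale1r addrC subrK.
have wx : f w x = 0.
  rewrite -(IH _ wl) dot_synth//.
  have -> : coord b x = 0 by apply/colP => i; rewrite !mxE xb.
  by rewrite linear0r.
by rewrite wx scale0r addr0 IH.
Qed.

End GramSchmidt.

Section UnitaryCompletion.
Context (R : realType).
Local Notation C := R[i].

Definition inclmx m n : 'M[C]_(m, n) := \matrix_(i, j) (i == j :> nat)%:R.

(** The columns of J are completed to an orthonormal basis, and Q takes coordinates in it.
    Conjugation by Q then turns the range of J into the first r coordinates. *)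
Lemma unitary_completion N r (J : 'M[C]_(N, r)) : J ^t* *m J = 1%:M ->
  exists Q : 'M[C]_N, [/\ Q ^t* *m Q = 1%:M, Q *m Q ^t* = 1%:M &
    Q *m J = inclmx N r].
Proof.
move=> JJ; pose e := [seq col j J | j <- enum 'I_r].
have se : size e = r by rewrite size_map size_enum_ord.
have eE (j : 'I_r) : e`_j = col j J.
  by rewrite (nth_map j) ?size_enum_ord// nth_ord_enum.
have eon : orthon (@coldot C N) e.
  move=> i j; rewrite se => ir jr; rewrite (eE (Ordinal ir)) (eE (Ordinal jr)).
  by rewrite /= -mulmx_coldot JJ mxE eq_sym.
have [e' [con sp _]] := gram_schmidt eon [seq delta_mx i 0 | i <- enum 'I_N].
set b := e ++ e' in con sp.
pose Q : 'M[C]_(size b, N) := \matrix_(i, j) (b`_i j 0)^*.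
have Qc (i : 'I_(size b)) : col i (Q ^t*) = b`_i.
  by apply/colP => j; rewrite !mxE conjCK.
have QQ' : Q *m Q ^t* = 1%:M.
  rewrite -{1}[Q]trmxCK; apply/matrixP => i j; rewrite mulmx_coldot !Qc con//.
  by rewrite mxE eq_sym.
have QQ : Q ^t* *m Q = 1%:M.
  have Qd (v : 'cV[C]_N) : Q ^t* *m (Q *m v) = synth (coord (@coldot C N) b v).
    have -> : Q *m v = coord (@coldot C N) b v.
      by apply/colP => i; rewrite !mxE; apply: eq_bigr => j _; rewrite mxE mulrC.
    apply/colP => j; rewrite !mxE summxE; apply: eq_bigr => i _.
    by rewrite !mxE conjCK mulrC.
  apply/matrixP => i j; have := Qd (delta_mx j 0); rewrite sp.
    by move=> /(congr1 (fun v : 'cV_N => v i 0)); rewrite mulmxA -colE !mxE andbT.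
  by apply: map_f; rewrite mem_enum.
have sb : size b = N.
  by apply/eqP; rewrite eqn_leq (mulmx1_min QQ') (mulmx1_min QQ).
have QJ (i : 'I_(size b)) j : (Q *m J) i j = (i == j :> nat)%:R.
  rewrite -{1}[Q]trmxCK mulmx_coldot Qc -eE.
  have jb : (j < size b)%N by rewrite size_cat se ltn_addr.
  by have := con _ _ jb (ltn_ord i); rewrite {1}/b nth_cat se ltn_ord eq_sym => <-.
(* [size b] and [N] are equal but not convertible, so [size b] is generalised before the
   substitution. *)
move: (size b) sb Q Qc QQ' QQ QJ => k; move=> -> Q _ QQ' QQ QJ.
by exists Q; split=> //; apply/matrixP => i j; rewrite QJ mxE.
Qed.

End UnitaryCompletion.

(** * Hahn-Banach separation and Reiter functions *)

Section HahnBanach.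
Context (R : realType) (V : zmodType).

(** Homogeneity under natural multiples makes sense on any abelian group, in particular on tuples of
    [grpalg]; the functionals obtained are additive. *)
Definition nat_sublinear (p : V -> R) : Prop :=
  (forall u v, p (u + v) <= p u + p v) /\ (forall v n, p (v *+ n) = p v *+ n).

Lemma nat_sublinear0 p : nat_sublinear p -> p 0 = 0.
Proof. by move=> [_ pn]; rewrite -(mulr0n (0 : V)) pn mulr0n. Qed.

Lemma nat_sublinear_oppr p v : nat_sublinear p -> - p (- v) <= p v.
Proof.
move=> ps; rewrite -subr_ge0 opprK -(nat_sublinear0 ps) -(subrr v).
exact: (proj1 ps).
Qed.

(* For fixed [x], the functional [y |-> inf_n p (y + n x) - n p x] is again
   sublinear and below [p], hence equal to [p]. *)
Lemma minimal_nat_sublinear_additive p : nat_sublinear p ->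
  (forall q, nat_sublinear q -> (forall v, q v <= p v) -> q = p) ->
  forall u v, p (u + v) = p u + p v.
Proof.
move=> ps pmin u x; have [pD pM] := ps; apply/eqP; rewrite eq_le pD /=.
pose A y : set R := [set r | exists n, r = p (y + x *+ n) - p x *+ n].
pose q y := inf (A y).
have An y : A y !=set0 by exists (p (y + x *+ 0) - p x *+ 0), 0%N.
have Al y r : A y r -> - p (- y) <= r.
  move=> [n ->]; rewrite lerBrDr addrC lerBlDr -pM.
  by have := pD (y + x *+ n) (- y); rewrite addrAC subrr add0r.
have Ab y : has_lbound (A y) by exists (- p (- y)) => r /Al.
have qle y n : q y <= p (y + x *+ n) - p x *+ n by apply: ge_inf; [|exists n].
have mono y n m : p (y + x *+ (n + m)) - p x *+ (n + m) <= p (y + x *+ n) - p x *+ n.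
  have := pD (y + x *+ n) (x *+ m).
  by rewrite pM -addrA -mulrnDr mulrnDr; lra.
have qs : nat_sublinear q.
  split=> [y z|y [|k]].
  - rewrite -lerBlDr; apply: lb_le_inf => // _ [n ->].
    rewrite lerBlDr -lerBlDl; apply: lb_le_inf => // _ [m ->].
    have := qle (y + z) (n + m)%N; have := pD (y + x *+ n) (z + x *+ m).
    by rewrite addrACA -mulrnDr [p x *+ (n + m)]mulrnDr; lra.
  - rewrite !mulr0n; apply/eqP; rewrite eq_le; apply/andP; split.
      by have := qle 0 0%N; rewrite !mulr0n addr0 subr0 (nat_sublinear0 ps).
    apply: lb_le_inf => // r /Al; apply: le_trans.
    by rewrite oppr0 (nat_sublinear0 ps) oppr0.
  - have e n : p (y *+ k.+1 + x *+ (n * k.+1)) - p x *+ (n * k.+1) =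
        (p (y + x *+ n) - p x *+ n) *+ k.+1.
      by rewrite mulrnA -mulrnDl pM mulrnBl mulrnA.
    apply/eqP; rewrite eq_le; apply/andP; split.
      rewrite -[q y *+ _]mulr_natr -ler_pdivrMr ?ltr0n//.
      apply: lb_le_inf => // _ [n ->].
      by rewrite ler_pdivrMr ?ltr0n// mulr_natr -e qle.
    apply: lb_le_inf => // _ [n ->].
    apply: le_trans (mono _ n (n * k)%N).
    by rewrite -mulnS e lerMn2r qle orbT.
have qp v : q v <= p v by have := qle v 0%N; rewrite !mulr0n subr0 addr0.
have qE := pmin _ qs qp.
have := qle u 1%N; rewrite qE !mulr1n; lra.
Qed.

(** Zorn's lemma for the reverse pointwise order on the sublinear functionals below p: the infimum
    of a nonempty chain is again sublinear, and a minimal functional is additive. *)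
Lemma nat_hahn_banach p : nat_sublinear p ->
  exists phi : V -> R, (forall u v, phi (u + v) = phi u + phi v) /\
    (forall v, phi v <= p v).
Proof.
move=> ps; pose T := {q : V -> R | nat_sublinear q /\ forall v, q v <= p v}.
pose r (s t : T) := `[< forall v, sval t v <= sval s v >].
have [|||A Atot|t tmin] := @Zorn T r.
- by move=> t; apply/asboolP.
- move=> s t u /asboolP st /asboolP tu; apply/asboolP => v.
  exact: le_trans (tu v) (st v).
- move=> [s ss] [t ts] /asboolP /= st /asboolP /= ts'; apply: eq_exist.
  by apply/funext => v; apply/eqP; rewrite eq_le st ts'.
- have [[t0 At0]|A0] := pselect (exists t, A t); last first.
    exists (exist _ p (conj ps (fun v => lexx (p v)))) => s As.
    by case: A0; exists s.
  pose B v : set R := [set a | exists2 t, A t & a = sval t v].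
  have Bn v : B v !=set0 by exists (sval t0 v), t0.
  have Bb v : has_lbound (B v).
    exists (- p (- v)) => _ [t _ ->]; have [ts tp] := svalP t.
    by rewrite (le_trans _ (nat_sublinear_oppr v ts))// lerN2.
  pose q v := inf (B v).
  have qle t v : A t -> q v <= sval t v by move=> At; apply: ge_inf => //; exists t.
  have qs : nat_sublinear q.
    split=> [u v|v [|n]].
    - rewrite -lerBlDr; apply: lb_le_inf => // _ [s As ->].
      rewrite lerBlDr -lerBlDl; apply: lb_le_inf => // _ [t At ->].
      rewrite lerBlDl; have [] := Atot _ _ As At => /asboolP st.
        apply: le_trans (qle _ _ At) _; have [[tD _] _] := svalP t.
        by rewrite (le_trans (tD _ _))// lerD2r st.
      apply: le_trans (qle _ _ As) _; have [[sD _] _] := svalP s.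
      by rewrite (le_trans (sD _ _))// lerD2l st.
    - have B0 (t : T) : sval t 0 = 0 by have [ts _] := svalP t; exact: nat_sublinear0 ts.
      rewrite !mulr0n; apply/eqP; rewrite eq_le -{1}(B0 t0) qle//=.
      by apply: lb_le_inf => // _ [t _ ->]; rewrite B0.
    - have e (t : T) : sval t (v *+ n.+1) = sval t v *+ n.+1 by have [[_ ->]] := svalP t.
      apply/eqP; rewrite eq_le; apply/andP; split.
        rewrite -[q v *+ _]mulr_natr -ler_pdivrMr ?ltr0n//.
        apply: lb_le_inf => // _ [t At ->].
        by rewrite ler_pdivrMr ?ltr0n// mulr_natr -e qle.
      by apply: lb_le_inf => // _ [t At ->]; rewrite e lerMn2r qle ?orbT.
  have qp v : q v <= p v.
    by apply: le_trans (qle _ v At0) _; have [_] := svalP t0.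
  exists (exist _ q (conj qs qp)) => s As; apply/asboolP => v /=; exact: qle.
have [ts tp] := svalP t.
exists (sval t); split=> //; apply: minimal_nat_sublinear_additive => // q qs qt.
have qp v : q v <= p v by exact: le_trans (qt v) (tp v).
have := tmin (exist _ q (conj qs qp)).
by move=> <-//; apply/asboolP.
Qed.

(* Averages over finite sequences stand for the rational convex hull of [x]. *)
Lemma separation (N : V -> R) (S : Type) (x : S -> V) (e : R) :
  nat_sublinear N -> (forall v, N (- v) = N v) ->
  (forall M : seq S, (size M)%:R * e <= N (\sum_(s <- M) x s)) ->
  exists phi : V -> R, [/\ forall u v, phi (u + v) = phi u + phi v,
    forall v, phi v <= N v & forall s, e <= phi (x s)].
Proof.
move=> Ns NN Ne; have [ND NM] := Ns.
pose X (M : seq S) := \sum_(s <- M) x s.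
have XE n (J : seq S) : X (flatten (nseq n J)) = X J *+ n.
  elim: n => [|n IHn]; first by rewrite /X big_nil mulr0n.
  by rewrite /= /X big_cat -/(X _) mulrS; congr (_ + _).
have sE n (J : seq S) : size (flatten (nseq n J)) = (n * size J)%N.
  by elim: n => //= n IHn; rewrite size_cat IHn mulSn.
(* The infimum q of these values lies below N (k = 0, M empty) and satisfies q (- x s) <= - e (k =
   0, M = s alone), so an additive functional below q separates. *)
pose val v k M := (N (v *+ k.+1 + X M) - (size M)%:R * e) / k.+1%:R.
pose A v : set R := [set r | exists k, exists M, r = val v k M].
have An v : A v !=set0 by exists (val v 0 [::]), 0%N, [::].
have Al v r : A v r -> - N v <= r.
  move=> [k [M ->]]; rewrite ler_pdivlMr ?ltr0n// mulNr mulr_natr -NM.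
  have := Ne M; have := ND (v *+ k.+1 + X M) (- (v *+ k.+1)).
  by rewrite addrAC subrr add0r NN; lra.
have Ab v : has_lbound (A v) by exists (- N v) => r /Al.
pose q v := inf (A v).
have qle v k M : q v <= val v k M by apply: ge_inf => //; exists k, M.
have k0 (k : nat) : 0 < k.+1%:R :> R by rewrite ltr0n.
have qs : nat_sublinear q.
  split=> [u v|v [|n]].
  - rewrite -lerBlDr; apply: lb_le_inf => // _ [k [K ->]].
    rewrite lerBlDr -lerBlDl; apply: lb_le_inf => // _ [l [L ->]].
    rewrite lerBlDl.
    (* Reduction to the common denominator: K is repeated l + 1 times and L is repeated k + 1
       times. *)
    pose M := flatten (nseq l.+1 K) ++ flatten (nseq k.+1 L).
    apply: le_trans (qle _ (k.+1 * l.+1).-1 M) _.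
    rewrite /val prednK ?muln_gt0// ler_pdivrMr ?ltr0n ?muln_gt0//.
    have -> : ((N (u *+ k.+1 + X K) - (size K)%:R * e) / k.+1%:R +
       (N (v *+ l.+1 + X L) - (size L)%:R * e) / l.+1%:R) * (k.+1 * l.+1)%:R =
       N (v *+ l.+1 + X L) *+ k.+1 + N (u *+ k.+1 + X K) *+ l.+1 -
       (size L)%:R * e *+ k.+1 - (size K)%:R * e *+ l.+1.
      have e1 (a : R) (i j : nat) : a / i.+1%:R * (i.+1 * j.+1)%:R = a *+ j.+1.
        by rewrite natrM mulrA divfK ?pnatr_eq0// mulr_natr.
      by rewrite mulrDl e1 mulnC e1 !mulrnBl; lra.
    have := ND ((v *+ l.+1 + X L) *+ k.+1) ((u *+ k.+1 + X K) *+ l.+1).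
    have -> : (u + v) *+ (k.+1 * l.+1) + X M =
        (v *+ l.+1 + X L) *+ k.+1 + (u *+ k.+1 + X K) *+ l.+1.
      have -> : X M = X K *+ l.+1 + X L *+ k.+1.
        by rewrite /M {1}/X big_cat -!/(X _) !XE.
      rewrite !mulrnDl addrACA [RHS]addrC; congr (_ + _ + (_ + _)).
        by rewrite mulrnA.
      by rewrite mulnC mulrnA.
    have -> : (size M)%:R * e = (size K)%:R * e *+ l.+1 + (size L)%:R * e *+ k.+1.
      by rewrite size_cat !sE natrD !natrM mulrDl -!mulrA !mulr_natl.
    by rewrite !NM => h; rewrite opprD addrA [leRHS]addrAC !lerD2r.
  - rewrite !mulr0n; apply/eqP; rewrite eq_le; apply/andP; split.
      apply: le_trans (qle 0 0%N [::]) _.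
      by rewrite /val /X big_nil mul0r subr0 addr0 mul0rn (nat_sublinear0 Ns) mul0r.
    apply: lb_le_inf => // r /Al; apply: le_trans.
    by rewrite (nat_sublinear0 Ns) oppr0.
  - apply/eqP; rewrite eq_le; apply/andP; split.
      rewrite -[q v *+ _]mulr_natr -ler_pdivrMr//; apply: lb_le_inf => // _ [k [M ->]].
      rewrite ler_pdivrMr//; apply: le_trans (qle _ k (flatten (nseq n.+1 M))) _.
      rewrite /val XE sE mulrnAC -mulrnDl NM.
      have -> : (n.+1 * size M)%:R * e = (size M)%:R * e *+ n.+1.
        by rewrite mulnC natrM mulrAC mulr_natr.
      by rewrite [leRHS]mulr_natr -[leRHS]mulrnAl mulrnBl lexx.
    apply: lb_le_inf => // _ [k [M ->]].
    have := qle v (n.+1 * k.+1).-1 M.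
    rewrite /val prednK ?muln_gt0// mulrnA => h.
    rewrite -[q v *+ _]mulr_natr -ler_pdivlMr//; apply: le_trans h _.
    by rewrite natrM invfM mulrA mulrAC.
have [phi [phiD phiq]] := nat_hahn_banach qs.
have phi0 : phi 0 = 0 by apply: (addrI (phi 0)); rewrite -phiD !addr0.
exists phi; split=> // [v|s].
  apply: le_trans (phiq v) _; apply: le_trans (qle v 0%N [::]) _.
  by rewrite /val /X big_nil mul0r subr0 addr0 mulr1n divr1.
have phiN v : phi (- v) = - phi v.
  by apply: (addrI (phi v)); rewrite -phiD !subrr.
rewrite -lerN2 -phiN; apply: le_trans (phiq _) _.
apply: le_trans (qle _ 0%N [:: s]) _.
by rewrite /val /X big_seq1 mulr1n addNr (nat_sublinear0 Ns) divr1 mul1r sub0r.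
Qed.

End HahnBanach.

Section Reiter.
Context (R : realType) (G : groupType).
Local Notation C := R[i].
Local Notation grpalg := (grpalg C G).

Definition norm1 (x : grpalg) : R := \sum_(h <- gsupp x) cabs (x h).

Lemma norm1E (A : {fset G}) (x : grpalg) :
  (forall h, h \notin A -> x h = 0) -> norm1 x = \sum_(h <- A) cabs (x h).
Proof.
move=> xA; rewrite /norm1 -(fsbigTE _ (fun h => cabs (x h))).
  by apply: fsbigTE => h /xA ->; rewrite cabs0.
by move=> h /gsuppP ->; rewrite cabs0.
Qed.

Lemma norm1_ge0 x : 0 <= norm1 x.
Proof. by apply: sumr_ge0 => h _; exact: cabs_ge0. Qed.

Lemma norm1D (x y : grpalg) : norm1 (x + y) <= norm1 x + norm1 y.
Proof.
pose A := (gsupp x `|` gsupp y)%fset.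
have xA h : h \notin A -> x h = 0 by rewrite inE negb_or => /andP[/gsuppP].
have yA h : h \notin A -> y h = 0 by rewrite inE negb_or => /andP[_ /gsuppP].
have xyA h : h \notin A -> gcoef (x + y) h = 0.
  by move=> hA; rewrite /= (xA _ hA) (yA _ hA) addr0.
rewrite (norm1E xA) (norm1E yA) (norm1E xyA) -big_split /= ler_sum// => h _.
exact: cabsD.
Qed.

Lemma grpalg_natmul (x : grpalg) n h : gcoef (x *+ n) h = x h *+ n.
Proof. by elim: n => [//|n IHn]; rewrite !mulrS -IHn. Qed.

Lemma norm1_natmul (x : grpalg) n : norm1 (x *+ n) = norm1 x *+ n.
Proof.
rewrite (@norm1E (gsupp x)) => [|h /gsuppP]; last first.
  by rewrite grpalg_natmul => ->; rewrite mul0rn.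
rewrite -sumrMnl; apply: eq_bigr => h _.
have cn : cabs (n%:R : C) = n%:R.
  by rewrite -(rmorph_nat (@real_complex R)) cabs_real ger0_norm.
by rewrite grpalg_natmul -mulr_natr cabsM cn mulr_natr.
Qed.

Lemma sum_le_norm1 (x : grpalg) (B : seq G) : uniq B ->
  \sum_(h <- B) cabs (x h) <= norm1 x.
Proof.
move=> uB; rewrite (bigID (mem (gsupp x))) /= [X in _ + X]big1 ?addr0; last first.
  by move=> h /gsuppP ->; rewrite cabs0.
rewrite -big_filter (perm_big [seq h <- gsupp x | h \in B]).
  rewrite big_filter big_mkcond; apply: ler_sum => h _.
  by case: ifP => // _; exact: cabs_ge0.
apply: uniq_perm; rewrite ?filter_uniq ?fset_uniq// => h.
by rewrite !mem_filter andbC.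
Qed.

Lemma norm1N (x : grpalg) : norm1 (- x) = norm1 x.
Proof.
rewrite (@norm1E (gsupp x)) => [|h /gsuppP /= ->]; last by rewrite oppr0.
by apply: eq_bigr => h _; rewrite /= cabsN.
Qed.

Lemma norm1_delta s : norm1 (gdelta C s) = 1.
Proof.
rewrite (@norm1E [fset s]%fset) => [|h]; last by rewrite inE /= => /negPf ->.
by rewrite big_seq_fset1 /= eqxx cabs1.
Qed.

Section Mean.
Context (m : (G -> R) -> R) (mP : invariant_mean m).

Lemma mean_sum (I : Type) (r : seq I) (f : I -> G -> R) :
  (forall i, bounded_function (f i)) ->
  m (fun g => \sum_(i <- r) f i g) = \sum_(i <- r) m (f i) /\
  bounded_function (fun g => \sum_(i <- r) f i g).
Proof.
have [mL _ m1 _] := mP => fb.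
have m0 : m (fun=> 0) = 0.
  have b0 : bounded_function (fun _ : G => 0 : R) by exists 0 => g; rewrite normr0.
  have := mL (-1) _ _ b0 b0; rewrite mulr0 addr0 => ->.
  by rewrite mulN1r addNr.
elim: r => [|i r [IHm [M IHb]]].
  split; last by exists 0 => g; rewrite big_nil normr0.
  by rewrite big_nil -[RHS]m0; congr m; apply/funext => g; rewrite big_nil.
have [N fN] := fb i; split.
  rewrite big_cons -IHm -[m (f i)]mul1r -mL//; last by exists M.
  by congr m; apply/funext => g; rewrite big_cons mul1r.
exists (N + M) => g; rewrite big_cons (le_trans (ler_normD _ _))// lerD ?fN//.
Qed.

(** If no multiset worked, [separation] would give bounded functions f_i such that F(s) = sum_i
    (f_i(g_i s) - f_i(s)) is at least e everywhere. Invariance gives F the mean 0, against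
    positivity. Tuples indexed by [gs] treat all translations at once. *)
Lemma almost_invariant_multiset (gs : seq G) (e : R) : 0 < e ->
  exists2 M : seq G, (0 < size M)%N & forall g, g \in gs ->
  norm1 (\sum_(s <- M) (gdelta C (g * s)%g - gdelta C s)) < (size M)%:R * e.
Proof.
move=> e0; have [mL mpos m1 minv] := mP.
pose r := size gs; pose g_ (i : 'I_r) := nth 1%g gs i.
pose V := {ffun 'I_r -> grpalg}.
pose N (v : V) := \sum_i norm1 (v i).
have Ns : nat_sublinear N.
  split=> [u v|v n]; rewrite /N.
    rewrite -big_split /=; apply: ler_sum => i _.
    by rewrite ffunE norm1D.
  rewrite -sumrMnl; apply: eq_bigr => i _.
  by rewrite ffunMnE norm1_natmul.
have NN v : N (- v) = N v.
  by apply: eq_bigr => i _; rewrite ffunE norm1N.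
pose x s : V := [ffun i => gdelta C (g_ i * s)%g - gdelta C s].
have [h|/existsNP[M /negP]] := pselect (forall M, (size M)%:R * e <= N (\sum_(s <- M) x s)); last first.
  rewrite -ltNge => NM.
  have Mg g : g \in gs -> norm1 (\sum_(s <- M) (gdelta C (g * s)%g - gdelta C s)) < (size M)%:R * e.
    move=> ggs; apply: le_lt_trans NM.
    have ir : (index g gs < r)%N by rewrite index_mem.
    rewrite /N (bigD1 (Ordinal ir))//= sum_ffunE.
    have e1 s : x s (Ordinal ir) = gdelta C (g * s)%g - gdelta C s.
      by rewrite ffunE /g_ /= nth_index.
    by rewrite (eq_bigr _ (fun s _ => e1 s)) lerDl sumr_ge0// => i _; exact: norm1_ge0.
  exists M => //; rewrite lt0n; apply/eqP => M0; move: NM.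
  by rewrite M0 mul0r ltNge sumr_ge0// => i _; exact: norm1_ge0.
have [phi [phiD phiN phix]] := separation Ns NN h.
have phi0 : phi 0 = 0 by apply: (addrI (phi 0)); rewrite -phiD !addr0.
have phiO v : phi (- v) = - phi v by apply: (addrI (phi v)); rewrite -phiD !subrr.
(* [d i s] is the point mass at s in slot i; it has norm 1, so [f i] is bounded by 1 and the mean
   applies to it. *)
pose d (i : 'I_r) s : V := [ffun j => if j == i then gdelta C s else 0].
pose f i s := phi (d i s).
have fb i : bounded_function (f i).
  exists 1 => s; have Nd : N (d i s) = 1.
    rewrite /N (bigD1 i)//= ffunE eqxx norm1_delta big1 ?addr0// => j /negPf ji.
    by rewrite ffunE ji -[0](mulr0n 0) norm1_natmul mulr0n.
  rewrite ler_norml -Nd phiN andbT -NN lerNl -phiO; exact: phiN.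
pose F s := \sum_i (f i (g_ i * s)%g - f i s).
have fbt i g : bounded_function (fun s => f i (g * s)%g).
  by have [M fM] := fb i; exists M.
have Fb i : bounded_function (fun s => f i (g_ i * s)%g - f i s).
  have [M fM] := fb i; exists (M + M) => s.
  by rewrite (le_trans (ler_normB _ _))// lerD.
have [mF bF] := mean_sum (index_enum 'I_r) Fb.
have mF0 : m F = 0.
  rewrite mF big1// => i _.
  have -> : (fun s => f i (g_ i * s)%g - f i s) = (fun s => -1 * f i s + f i (g_ i * s)%g).
    by apply/funext => s; rewrite mulN1r addrC.
  rewrite mL// -[in X in _ + X](invgK (g_ i)) (minv _ (f i))//.
  by rewrite mulN1r addNr.
have Fe s : e <= F s.
  apply: le_trans (phix s) _; rewrite /F.
  have phi_sum (J : Type) (q : seq J) (v : J -> V) : phi (\sum_(j <- q) v j) = \sum_(j <- q) phi (v j).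
    by elim/big_ind2 : _ => // a b a' b' <- <-.
  rewrite le_eqVlt; apply/orP; left; apply/eqP.
  transitivity (phi (\sum_i (d i (g_ i * s)%g - d i s))).
    congr phi; apply/ffunP => j; rewrite !ffunE sum_ffunE (bigD1 j)//= big1.
      by rewrite !ffunE eqxx addr0.
    by move=> i ij; rewrite !ffunE eq_sym (negPf ij) subrr.
  by rewrite phi_sum; apply: eq_bigr => i _; rewrite phiD phiO.
have b1 : bounded_function (fun _ : G => 1 : R) by exists 1 => g; rewrite normr1.
have := mpos (fun s => - e * 1 + F s).
rewrite mL// m1 mF0 addr0 mulr1 oppr_ge0 leNgt e0 => /(_ _ _)/negP[]//.
  have [M FM] := bF; exists (e + M) => s.
  by rewrite (le_trans (ler_normD _ _))// normrN gtr0_norm// lerD2l FM.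
by move=> s; rewrite addrC subr_ge0.
Qed.

(** Converts an l^1 estimate on densities into an l^2 estimate on their square roots. *)
Lemma sqrt_dist (a b : R) : 0 <= a -> 0 <= b ->
  (Num.sqrt a - Num.sqrt b) ^+ 2 <= `|a - b|.
Proof.
move=> a0 b0; wlog ab : a b a0 b0 / b <= a.
  move=> h; have [/h|/ltW/h] := leP b a; first exact.
  by rewrite distrC -sqrrN opprB; exact.
rewrite ger0_norm ?subr_ge0// -{2}(sqr_sqrtr a0) -{2}(sqr_sqrtr b0) subr_sqr.
rewrite expr2 ler_wpM2l ?subr_ge0 ?ler_sqrt//.
by rewrite lerD2l -subr_ge0 opprK addr_ge0 ?sqrtr_ge0.
Qed.

(** The function a is the square root of the normalised counting function of an almost invariant
    multiset. Duplicate-free lists B stand for the sum over G. *)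
Lemma reiter (gs : seq G) (e : R) : 0 < e ->
  exists A : seq G, exists a : G -> R, [/\ uniq A, forall h, 0 <= a h,
    forall h, h \notin A -> a h = 0, \sum_(h <- A) a h ^+ 2 = 1 &
    forall g, g \in gs -> forall B : seq G, uniq B ->
      \sum_(h <- B) (a (g^-1 * h)%g - a h) ^+ 2 <= e].
Proof.
move=> e0; have [M M0 Mg] := almost_invariant_multiset gs e0.
pose n : R := (size M)%:R.
have n0 : 0 < n by rewrite ltr0n.
pose p h : R := (count_mem h M)%:R / n.
have p0 h : 0 <= p h by rewrite divr_ge0// ltW.
exists (undup M), (fun h => Num.sqrt (p h)); split.
- exact: undup_uniq.
- by move=> h; exact: sqrtr_ge0.
- move=> h; rewrite mem_undup => /count_memPn hM.
  by rewrite /p hM mul0r sqrtr0.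
- under eq_bigr do rewrite sqr_sqrtr//.
  rewrite -mulr_suml -natr_sum; have -> : (\sum_(h <- undup M) count_mem h M = size M)%N.
    rewrite -[RHS](perm_size (perm_count_undup M)) size_flatten sumnE !big_map.
    by apply: eq_bigr => h _; rewrite size_nseq.
  by rewrite divff// gt_eqF.
- move=> g /Mg; set x := \sum_(s <- M) _ => xM B uB.
  have xE h : gcoef x h = (((count_mem (g^-1 * h)%g M)%:R - (count_mem h M)%:R : R)%:C)%C.
    rewrite /x; elim: (M) => [|s K IHK]; first by rewrite big_nil /= subrr.
    rewrite big_cons [LHS]/= IHK /= !natrD.
    have -> : (h == (g * s)%g) = (s == (g^-1 * h)%g).
      by rewrite -[in RHS](inj_eq (mulgI g)) mulVKg eq_sym.
    have nR (k : nat) : (k%:R : C) = ((k%:R : R)%:C)%C by rewrite rmorph_nat.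
    by rewrite (eq_sym h s) opprD addrACA !nR -rmorphB -rmorphD.
  apply: (@le_trans _ _ (\sum_(h <- B) `|p (g^-1 * h)%g - p h|)).
    by apply: ler_sum => h _; exact: sqrt_dist.
  apply: (@le_trans _ _ (\sum_(h <- B) cabs (gcoef x h) / n)).
    apply: ler_sum => h _; rewrite xE cabs_real -mulrBl normrM.
    by rewrite (@gtr0_norm _ n^-1) ?invr_gt0.
  rewrite -mulr_suml ler_pdivrMr// mulrC.
  by apply: le_trans (ltW xM); exact: sum_le_norm1.
Qed.

End Mean.
End Reiter.

(** * Approximate representations from the MF property *)

Lemma eventually_all (T : eqType) (l : seq T) (P : T -> nat -> Prop) :
  (forall x, x \in l -> exists K, forall k, (K <= k)%N -> P x k) ->
  exists K, forall k, (K <= k)%N -> forall x, x \in l -> P x k.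
Proof.
elim: l => [|x l IH] lP; first by exists 0%N.
have [K KP] : exists K, forall k, (K <= k)%N -> P x k by apply: lP; rewrite mem_head.
have [|L LP] := IH; first by move=> y yl; apply: lP; rewrite inE yl orbT.
exists (maxn K L) => k; rewrite geq_max => /andP[Kk Lk] y.
by rewrite inE => /predU1P[->|/(LP _ Lk)//]; exact: KP.
Qed.

Lemma cvg0P (R : realType) (u : nat -> R) : (forall k, 0 <= u k) ->
  u @ \oo --> (0 : R) <->
  forall e, 0 < e -> exists K, forall k, (K <= k)%N -> u k <= e.
Proof.
move=> u0; split=> [/cvgrPdist_le h e e0|h].
  have [K _ KP] := h _ e0; exists K => k Kk.
  by have := KP k Kk; rewrite sub0r normrN ger0_norm.
apply/cvgrPdist_le => e e0; have [K KP] := h _ e0.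
exists K => // k Kk; rewrite sub0r normrN ger0_norm//; exact: KP.
Qed.

Section Block.
Context (R : realType).
Local Notation C := R[i].

Lemma coldot_col m n (a a' : 'cV[C]_m) (x x' : 'cV[C]_n) :
  coldot (col_mx a x) (col_mx a' x') = coldot a a' + coldot x x'.
Proof.
by rewrite /coldot big_split_ord /=; congr (_ + _); apply: eq_bigr => i _;
  rewrite ?col_mxEu ?col_mxEd.
Qed.

Lemma cnorm_col m n (a : 'cV[C]_m) (x : 'cV[C]_n) :
  cnorm (col_mx a x) ^+ 2 = cnorm a ^+ 2 + cnorm x ^+ 2.
Proof. by rewrite !vnorm_sqr /= coldot_col; case: (coldot a a) (coldot x x) => [? ?] [? ?]. Qed.

Lemma mul_diag_block m n (A : 'M[C]_m) (B : 'M[C]_n)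
    (a : 'cV[C]_m) (x : 'cV[C]_n) :
  block_mx A 0 0 B *m col_mx a x = col_mx (A *m a) (B *m x).
Proof. by rewrite mul_block_col !mul0mx addr0 add0r. Qed.

Lemma mxbound_block m n (A : 'M[C]_m) (B : 'M[C]_n) (M : R) : 0 <= M ->
  mxbound A M -> mxbound B M -> mxbound (block_mx A 0 0 B) M.
Proof.
move=> M0 AM BM v; rewrite -(vsubmxK v) mul_diag_block.
rewrite -(@ler_pXn2r _ 2) ?nnegrE ?mulr_ge0 ?cnorm_ge0// exprMn !cnorm_col mulrDr.
by rewrite -!exprMn lerD// ler_pXn2r ?nnegrE ?mulr_ge0 ?cnorm_ge0 ?AM ?BM.
Qed.

Lemma diag_block_mul m n (A A' : 'M[C]_m) (B B' : 'M[C]_n) :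
  block_mx A 0 0 B *m block_mx A' 0 0 B' = block_mx (A *m A') 0 0 (B *m B').
Proof. by rewrite mulmx_block !mulmx0 !mul0mx !addr0 add0r. Qed.

Lemma diag_block_adj m n (A : 'M[C]_m) (B : 'M[C]_n) :
  (block_mx A 0 0 B) ^t* = block_mx (A ^t*) 0 0 (B ^t*).
Proof. by rewrite tr_block_mx map_block_mx !trmx0 !raddf0. Qed.

Lemma diag_block_sub m n (A A' : 'M[C]_m) (B B' : 'M[C]_n) :
  block_mx A 0 0 B - block_mx A' 0 0 B' = block_mx (A - A') 0 0 (B - B').
Proof. by rewrite opp_block_mx add_block_mx !oppr0 !addr0. Qed.

Lemma diag_block1 m n : block_mx 1%:M 0 0 1%:M = 1%:M :> 'M[C]_(m + n).
Proof. by rewrite -scalar_mx_block. Qed.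

End Block.

Section QuotientRepresentatives.
Context (C : numClosedFieldType) (A : starAlgType C) (I : starIdeal A).
Implicit Types X Y : quotalg I.

Lemma coset_repM X Y : coset I (rep X * rep Y) = X * Y.
Proof. by rewrite cosetM !repK. Qed.

Lemma coset_repSM X Y : coset I (star (rep X) * rep Y) = star X * Y.
Proof. by rewrite cosetM cosetS !repK. Qed.

End QuotientRepresentatives.

Section ApproximateRepresentations.
Context (R : realType) (G : groupType).
Local Notation C := R[i].

(** Unitarity is exact and only multiplicativity is approximate: polar decomposition removes the
    first defect once and for all. *)
Definition approx_rep (F : seq G) (e : R) d (s : G -> 'M[C]_d) : Prop :=
  (forall g, (s g) ^t* *m s g = 1%:M) /\
  (forall g h, g \in F -> h \in F -> mxbound (s g *m s h - s (g * h)%g) e).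

(** The bound b is uniform in F and e: models of any accuracy have a unit vector whose coefficients
    it dominates. The condition [1 < d] makes the dimensions grow strictly along the chain. *)
Definition coef_bound (b : G -> R) : Prop := forall (F : seq G) (e : R), 0 < e ->
  exists d, exists s : G -> 'M[C]_d, exists x : 'cV[C]_d,
  [/\ (1 < d)%N, approx_rep F e s, cnorm x = 1 &
      forall g, cabs (coldot (s g *m x) x) <= b g].

Lemma coef_bound_le b b' : (forall g, b g <= b' g) ->
  coef_bound b -> coef_bound b'.
Proof.
move=> bb bP F e e0; have [d [s [x [d1 sF x1 sb]]]] := bP F e e0.
by exists d, s, x; split=> // g; exact: le_trans (sb g) (bb g).
Qed.

Lemma coef_bound1 : coef_bound (fun=> 1).
Proof.
move=> F e e0; exists 2%N, (fun=> 1%:M), (delta_mx 0 0); split=> //.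
- split=> [g|g h _ _]; first by rewrite trmx1 map_mx1 mulmx1.
  by rewrite mulmx1 subrr; apply: mxbound0; exact: ltW.
- exact: cnorm_delta.
- move=> g; rewrite mul1mx (le_trans (dot_cabs (@coldot C 2) _ _))//.
  by rewrite -/(cnorm _) cnorm_delta mulr1.
Qed.

Lemma approx_rep_tens F (e e' : R) d d' (s : G -> 'M[C]_d) (s' : G -> 'M[C]_d') :
  0 <= e -> 0 <= e' -> approx_rep F e s -> approx_rep F e' s' ->
  approx_rep F (e + e') (fun g => s g *t s' g).
Proof.
move=> e0 e'0 [su sm] [s'u s'm]; split=> [g|g h gF hF].
  exact: tensmx_isom.
rewrite tensmx_mul.
have -> : (s g *m s h) *t (s' g *m s' h) - s (g * h)%g *t s' (g * h)%g =
  (s g *m s h - s (g * h)%g) *t (s' g *m s' h) +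
  s (g * h)%g *t (s' g *m s' h - s' (g * h)%g).
  by rewrite tensmxBl tensmxBr addrA subrK.
apply: mxboundD.
  rewrite -[e]mulr1 tensmx_decr; apply: mxboundM => //.
    by apply: mxbound_tens1r => //; exact: sm.
  apply: mxbound_tens1l => //; rewrite -[1]mulr1; apply: mxboundM => //; exact: mxbound_isom.
rewrite -[e']mul1r tensmx_decr; apply: mxboundM => //.
  by apply: mxbound_tens1r => //; exact: mxbound_isom.
by apply: mxbound_tens1l => //; exact: s'm.
Qed.

(** On a tensor product, the coefficient at x (x) x' is the product of the two coefficients. *)
Lemma coef_boundM b b' : coef_bound b -> coef_bound b' ->
  coef_bound (fun g => b g * b' g).
Proof.
move=> bP b'P F e e0; have e2 : 0 < e / 2 by rewrite divr_gt0.
have [d [s [x [d1 sF x1 sb]]]] := bP F _ e2.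
have [d' [s' [x' [d'1 s'F x'1 s'b]]]] := b'P F _ e2.
exists (d * d')%N, (fun g => s g *t s' g), (x *t x'); split.
- by rewrite (leq_trans d1)// leq_pmulr// ltnW.
- by rewrite [e]splitr; apply: approx_rep_tens => //; exact: ltW.
- by rewrite cnorm_tens x1 x'1 mulr1.
- by move=> g; rewrite tensmx_mulv coldot_tens cabsM ler_pM ?cabs_ge0.
Qed.

Definition point_bound (g0 : G) (r : R) (g : G) : R := if g == g0 then r else 1.

(** Tensor powers bring r below e at one point, and a product over the points of F treats them
    together. *)
Lemma coef_bound_small :
  (forall g0, g0 != 1%g -> exists r, [/\ 0 <= r, r < 1 & coef_bound (point_bound g0 r)]) ->
  forall (F : seq G) (e : R), 0 < e -> e <= 1 ->
  exists d, exists s : G -> 'M[C]_d, exists x : 'cV[C]_d,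
  [/\ (1 < d)%N, approx_rep F e s, cnorm x = 1 &
      forall g, g \in F -> g != 1%g -> cabs (coldot (s g *m x) x) <= e].
Proof.
move=> bP F e e0 e1.
have point g0 : g0 != 1%g -> coef_bound (point_bound g0 e).
  move=> /bP[r [r0 r1 rP]].
  have [n rn] : exists n, r ^+ n <= e.
    have : (fun n => r ^+ n) @ \oo --> (0 : R) by apply: cvg_expr; rewrite ger0_norm.
    move/cvg0P => /(_ _)/(_ _ e0)[n|K KP]; first by rewrite exprn_ge0.
    by exists K; exact: KP.
  have: coef_bound (point_bound g0 (r ^+ n)).
    elim: n {rn} => [|n IHn].
      by apply: coef_bound_le coef_bound1 => g; rewrite /point_bound expr0 if_same.
    apply: coef_bound_le (coef_boundM rP IHn) => g.
    by rewrite /point_bound exprS; case: ifP; rewrite ?mul1r.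
  by apply: coef_bound_le => g; rewrite /point_bound; case: ifP.
pose b (l : seq G) g : R := if (g \in l) && (g != 1%g) then e else 1.
have bb (l : seq G) : coef_bound (b l).
  elim: l => [|g0 l IHl]; first exact: coef_bound1.
  have [->|g01] := eqVneq g0 1%g.
    apply: coef_bound_le IHl => g; rewrite /b inE.
    by case: eqVneq => [->|]; rewrite ?andbF.
  apply: coef_bound_le (coef_boundM (point _ g01) IHl) => g.
  rewrite /b /point_bound inE; case: eqVneq => [->|] /=; last by rewrite mul1r.
  by rewrite g01 andbT /=; case: ifP => _; rewrite ?mulr1// ler_piMr// ltW.
have [d [s [x [d1 sF x1 sb]]]] := bb F F e e0.
exists d, s, x; split=> // g gF g1.
by have := sb g; rewrite /b gF g1.
Qed.

Lemma cabs_1D (z : C) : cabs z <= 1 ->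
  cabs (1 + z) ^+ 2 <= 2 + 2 * complex.Re z.
Proof.
rewrite -(@ler_pXn2r _ 2) ?nnegrE ?cabs_ge0// !cabs_sqr_Re.
case: z => a b /=; lra.
Qed.

(* Passing from [a] to [1 (+) a] turns [a v != v] into a coefficient of
   modulus < 1, even when [a] is a scalar. *)
Lemma separating_coef d (u : 'M[C]_d) (t : R) : 0 < t -> u ^t* *m u = 1%:M ->
  ~ mxbound (u - 1%:M) t ->
  exists2 x : 'cV[C]_(1 + d), cnorm x = 1 &
    cabs (coldot (block_mx 1%:M 0 0 u *m x) x) <= Num.sqrt (1 - t ^+ 2 / 4).
Proof.
move=> t0 uu /existsNP[v /negP]; rewrite -ltNge => tv.
have v0 : 0 < cnorm v.
  rewrite lt_def cnorm_ge0 andbT; apply/negP => /eqP v0; move: tv.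
  by rewrite v0 mulr0 (vnorm_eq0 v0) mulmx0 /cnorm vnorm0 ltxx.
pose w : 'cV[C]_d := ((cnorm v)^-1%:C)%C *: v.
have w1 : cnorm w = 1.
  by rewrite /cnorm vnormZ cabs_real ger0_norm ?invr_ge0 ?ltW// mulVf// gt_eqF.
have tw : t < cnorm (u *m w - w).
  rewrite -[X in _ - X]mul1mx -mulmxBl -scalemxAr /cnorm vnormZ cabs_real.
  by rewrite ger0_norm ?invr_ge0 ?(ltW v0)// mulrC ltr_pdivlMr.
set z := coldot (u *m w) w.
have zRe : t ^+ 2 < 2 - 2 * complex.Re z.
  have : t ^+ 2 < cnorm (u *m w - w) ^+ 2 by rewrite ltr_pXn2r ?nnegrE ?cnorm_ge0// ltW.
  rewrite vnormBE -!/(cnorm _) cnorm_isom// w1 expr1n /= -/z.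
  by rewrite mulr_natl.
have z1 : cabs z <= 1.
  by rewrite (le_trans (dot_cabs (@coldot C d) _ _))// -!/(cnorm _) cnorm_isom// w1 mulr1.
pose h : C := ((Num.sqrt (2^-1))%:C)%C.
have hh : cabs h ^+ 2 = 2^-1 by rewrite cabs_real real_normK ?num_real// sqr_sqrtr ?invr_ge0.
exists (h *: col_mx 1%:M w).
  have : cnorm (h *: col_mx 1%:M w) ^+ 2 = 1.
    rewrite /cnorm vnormZ exprMn hh -/(cnorm _) cnorm_col w1.
    have -> : cnorm (1%:M : 'cV[C]_1) = 1.
      by rewrite -(cnorm_delta R (0 : 'I_1)); congr cnorm; apply/colP => i; rewrite !ord1 !mxE.
    by rewrite expr1n; field.
  by move=> /eqP; rewrite sqrf_eq1 => /orP[/eqP//|/eqP h1]; have := cnorm_ge0 (h *: col_mx 1%:M w); rewrite h1 ler0N1.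
rewrite -scalemxAr mul_diag_block mul1mx.
have -> : coldot (h *: col_mx 1%:M (u *m w)) (h *: col_mx 1%:M w) = h * h^* * (1 + z).
  rewrite (linearZl_LR (@coldot C (1 + d))) /= (linearZr_LR (@coldot C (1 + d))) /= coldot_col mulrA.
  have -> : coldot (1%:M : 'cV[C]_1) 1%:M = 1.
    by rewrite /coldot big_ord1 !mxE eqxx mulr1n rmorph1 mulr1.
  by [].
(* The coefficient is (1 + z) / 2, and |1 + z|^2 / 4 <= (2 + 2 Re z) / 4 < 1 - t^2 / 4. *)
rewrite -cabs_sqr hh cabsM cabs_real ger0_norm ?invr_ge0//.
rewrite -[leLHS]ger0_norm ?mulr_ge0 ?cabs_ge0 ?invr_ge0// -sqrtr_sqr ler_wsqrtr//.
rewrite exprMn; have := cabs_1D z1.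
move: zRe; move: (complex.Re z) (cabs _ ^+ 2) (t ^+ 2) => r q p; clear - r q p.
by rewrite expr2; lra.
Qed.

Lemma mxadj_star n (A : 'M[C]_n) : star A = A ^t*.
Proof. by rewrite -map_trmx. Qed.

Lemma unitary_idempotent (A : starAlgType C) (u : A) :
  unitary u -> u = u * u -> u = 1.
Proof. by move=> [uu _] uE; rewrite -[LHS]mul1r -uu -mulrA -uE. Qed.

Lemma matrix_cosetP n (x y : subalg (matrix_prod R n)) :
  coset (matrix_sum R n) x = coset _ y <->
  forall e, 0 < e -> exists K, forall k, (K <= k)%N ->
    mxbound (subval x k - subval y k : 'M[C]_(n k)) e.
Proof.
split=> [/cosetP xy e e0|h].
  have [K KP] := proj1 (cvg0P (fun k => sn_ge0 (mx_seminorm R (n k)) _)) xy e e0.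
  by exists K => k /KP le; exact: (mxbound_le le (@mxbound_opnorm _ _ _)).
apply/cosetP/cvg0P => [k|e e0]; first exact: sn_ge0.
have [K KP] := h e e0; exists K => k /KP xyk.
by apply: opnorm_mxbound => //; exact: ltW.
Qed.

(** Representatives of the classes satisfy the relations up to errors tending to 0. Separation from
    1 is obtained only for infinitely many k, since a nonzero class means a positive upper limit. *)
Lemma MF_lift : MF R G -> exists n : nat -> nat, exists a : forall k, G -> 'M[C]_(n k),
  [/\ forall k, (0 < n k)%N,
    forall g h e, 0 < e -> exists K, forall k, (K <= k)%N ->
      mxbound (a k g *m a k h - a k (g * h)%g) e,
    forall g e, 0 < e -> exists K, forall k, (K <= k)%N ->
      mxbound ((a k g) ^t* *m a k g - 1%:M) e &
    forall g, g != 1%g -> exists2 t, 0 < t & forall K, exists2 k, (K <= k)%N &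
      ~ mxbound (a k g - 1%:M) t].
Proof.
move=> [n [n0 _ [phi [phiu phiM phiI]]]]; exists n.
pose A g := rep (phi g); pose a k g : 'M[C]_(n k) := subval (A g) k.
exists a.
have phi1 : phi 1%g = 1.
  by apply: unitary_idempotent => //; rewrite -phiM mulg1.
split=> // [g h e e0|g e e0|g g1].
- have : coset (matrix_sum R n) (A g * A h) = coset _ (A (g * h)%g).
    exact: (etrans (coset_repM (phi g) (phi h)) (etrans (esym (phiM g h)) (esym (repK _)))).
  by move/matrix_cosetP => /(_ _ e0).
- have : coset (matrix_sum R n) (star (A g) * A g) = coset _ 1.
    exact: (etrans (coset_repSM (phi g) (phi g)) (proj1 (phiu g))).
  move/matrix_cosetP => /(_ _ e0)[K KP]; exists K => k /KP.
  by rewrite -mxadj_star.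
- have : coset (matrix_sum R n) (A g) <> coset _ 1.
    move=> Ag1; have /phiI/eqP : phi g = phi 1%g by exact: (etrans (esym (repK _)) (etrans Ag1 (esym phi1))).
    by rewrite (negPf g1).
  move=> /matrix_cosetP/existsNP[t /not_implyP[t0 /forallNP tP]].
  exists t => // K; have /existsNP[k /not_implyP[Kk kP]] := tP K.
  by exists k.
Qed.

(** At a late k where g0 is separated, polar decomposition corrects the matrices to unitaries; half
    of the separation survives. As r depends only on that separation, it is uniform in F and e. *)
Lemma MF_coef_bound : MF R G -> forall g0, g0 != 1%g ->
  exists r, [/\ 0 <= r, r < 1 & coef_bound (point_bound g0 r)].
Proof.
move=> /MF_lift[n [a [n0 aM aU aI]]] g0 g01.
have [t0 t00 tP] := aI _ g01; pose t := t0 / 2.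
have t2 : 0 < t by rewrite divr_gt0.
exists (Num.sqrt (1 - t ^+ 2 / 4)); split; first exact: sqrtr_ge0.
  rewrite -[ltRHS]sqrtr1 ltr_sqrt// ltrBlDr ltrDl divr_gt0// exprn_gt0//.
(* With d <= 1/2 the multiplicativity errors add up to 4 d + d^2 <= 5 d; d <= t keeps g0 separated
   from 1, and d < 1 allows the polar decomposition. *)
move=> F e e_gt0; pose d := Num.min (e / 5) (Num.min t 2^-1).
have d0 : 0 < d by rewrite !lt_min !divr_gt0 ?t2 ?invr_gt0//=.
have [de dt d2] : [/\ d <= e / 5, d <= t & d <= 2^-1].
  by rewrite /d !ge_min !lexx !orbT.
pose L := g0 :: F ++ [seq (x * y)%g | x <- F, y <- F].
have [K1 K1P] : exists K, forall k, (K <= k)%N -> forall g, g \in L ->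
    mxbound ((a k g) ^t* *m a k g - 1%:M) d.
  by apply: eventually_all => g _; exact: aU.
have [K2 K2P] : exists K, forall k, (K <= k)%N -> forall x,
    x \in [seq (g, h) | g <- F, h <- F] ->
    mxbound (a k x.1 *m a k x.2 - a k (x.1 * x.2)%g) d.
  by apply: eventually_all => x _; exact: aM.
have [k] := tP (maxn K1 K2); rewrite geq_max => /andP[Kk1 Kk2] kP.
have d1 : d < 1 by apply: le_lt_trans d2 _; rewrite invf_lt1// ltr1n.
have /choice[u uP] : forall g, exists u : 'M[C]_(n k), u ^t* *m u = 1%:M /\
    (g \in L -> mxbound (u - a k g) d).
  move=> g; have [gL|gL] := boolP (g \in L); last first.
    by exists 1%:M; split=> //; rewrite trmx1 map_mx1 mulmx1.
  by have [u uu ua] := polar (ltW d0) d1 (K1P _ Kk1 _ gL); exists u.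
have uu g : (u g) ^t* *m u g = 1%:M by case: (uP g).
have ua g : g \in L -> mxbound (u g - a k g) d by case: (uP g).
have uM g h : g \in F -> h \in F -> mxbound (u g *m u h - u (g * h)%g) e.
  move=> gF hF.
  have gL : g \in L by rewrite inE mem_cat gF orbT.
  have hL : h \in L by rewrite inE mem_cat hF orbT.
  have ghL : (g * h)%g \in L.
    by rewrite inE mem_cat; apply/orP; right; apply/orP; right; exact: allpairs_f.
  apply: (@mxbound_le _ _ _ _ (d * 1 + (1 + d) * d + d + d)).
    by rewrite mulr1; nra.
  have -> : u g *m u h - u (g * h)%g = (u g - a k g) *m u h + a k g *m (u h - a k h)
      + (a k g *m a k h - a k (g * h)%g) + (a k (g * h)%g - u (g * h)%g).
    rewrite mulmxBl mulmxBr !addrA subrK addrNK.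
    by rewrite subrK.
  have dge := ltW d0.
  apply: mxboundD; last by apply: mxboundBC; exact: ua.
  apply: mxboundD; last by apply: (K2P _ Kk2 (g, h)); exact: allpairs_f.
  apply: mxboundD; apply: mxboundM => //.
  - exact: ua.
  - exact: mxbound_isom.
  - by rewrite addr_ge0.
  - have -> : a k g = u g - (u g - a k g) by rewrite opprB addrC subrK.
    by apply: mxboundD; [exact: mxbound_isom|apply: mxboundN; exact: ua].
  - exact: ua.
have ut : ~ mxbound (u g0 - 1%:M) t.
  move=> ut; apply: kP; rewrite [t0]splitr; apply: mxboundBt ut.
  apply: mxboundBC; apply: mxbound_le dt _; apply: ua.
  by rewrite inE eqxx.
have [x x1 xt] := separating_coef t2 (uu g0) ut.
exists (1 + n k)%N, (fun g => block_mx 1%:M 0 0 (u g)), x; split=> //.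
- by rewrite add1n ltnS n0.
- split=> [g|g h gF hF].
    by rewrite diag_block_adj diag_block_mul uu trmx1 map_mx1 mulmx1 diag_block1.
  rewrite diag_block_mul diag_block_sub mulmx1 subrr; apply: mxbound_block.
  + exact: ltW.
  + by apply: mxbound0; exact: ltW.
  + exact: uM.
- move=> g; rewrite /point_bound; case: eqVneq => [->//|_].
  rewrite (le_trans (dot_cabs (@coldot C _) _ _))// -!/(cnorm _) cnorm_isom ?x1 ?mulr1//.
  by rewrite diag_block_adj diag_block_mul uu trmx1 map_mx1 mulmx1 diag_block1.
Qed.

(* The vectors [f g] imitate the canonical basis of l^2(G) under left
   translation. *)
Definition shift_system (F : seq G) (e : R) d (s : G -> 'M[C]_d)
    (f : G -> 'cV[C]_d) : Prop :=
  (forall g h, g \in F -> h \in F -> coldot (f g) (f h) = (g == h)%:R) /\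
  (forall g h, g \in F -> h \in F -> (g * h)%g \in F ->
     cnorm (s g *m f h - f (g * h)%g) <= e).

(** When the coefficients of x off the identity are small, the vectors s(g) x have a Gram matrix
    close to 1, since their products are nearly the coefficients at h^-1 g. The polar part of the
    matrix with these columns is an orthonormal family close to them. *)
Lemma MF_shift_system : MF R G -> forall (F : seq G) (e : R), 0 < e ->
  exists d, exists s : G -> 'M[C]_d, exists f : G -> 'cV[C]_d,
  [/\ (1 < d)%N, approx_rep F e s & shift_system F e s f].
Proof.
move=> GMF F e e0.
pose n := size (undup F); pose g_ (i : 'I_n) := nth 1%g (undup F) i.
pose L := F ++ [seq g^-1 * h | g <- F, h <- F]%g.
pose d := Num.min (e / 3) 2^-1.
have d0 : 0 < d by rewrite !lt_min !divr_gt0 ?invr_gt0//=.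
have [de d2] : d <= e / 3 /\ d <= 2^-1 by rewrite /d !ge_min !lexx !orbT.
(* Each of the n^2 entries of B^* B - 1 will be at most 2 c, so they sum to at most d; the added 1
   keeps the denominator positive when F is empty. *)
pose c := d / (2 * (n * n)%:R + 1).
have nn0 : 0 < 2 * (n * n)%:R + 1 :> R by rewrite ltr_wpDl// mulr_ge0.
have c0 : 0 < c by rewrite divr_gt0.
have cd : c <= d by rewrite ler_pdivrMr// -[leLHS]mulr1 ler_pM2l// lerDr mulr_ge0.
have c1 : c <= 1 by rewrite (le_trans cd)// (le_trans d2)// invf_le1// ler1n.
have [D [s [x [D1 [su sM] x1 sc]]]] :=
  coef_bound_small (MF_coef_bound GMF) L c0 c1.
have FL g : g \in F -> g \in L by rewrite mem_cat => ->.
pose B : 'M[C]_(D, n) := \matrix_(i, j) (s (g_ j) *m x) i 0.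
have colB j : col j B = s (g_ j) *m x by apply/colP => i; rewrite !mxE.
have gF i : g_ i \in F by rewrite -mem_undup mem_nth.
have BB : mxbound (B ^t* *m B - 1%:M) d.
  apply: mxbound_le (mxbound_entries _).
  apply: (@le_trans _ _ (\sum_(i < n) \sum_(j < n) (c + c))).
    apply: ler_sum => i _; apply: ler_sum => j _.
    have -> : (B ^t* *m B - 1%:M) i j = (B ^t* *m B) i j - (i == j)%:R by rewrite !mxE.
    rewrite mulmx_coldot !colB.
    have [->|ij] := eqVneq i j.
      rewrite coldot_isom// (fvvE (@coldot C D)) -/(cnorm _) x1 expr1n subrr cabs0.
      by rewrite addr_ge0// ltW.
    rewrite subr0.
    set g := g_ j; set h := g_ i.
    have hg : (h^-1 * g)%g \in L by rewrite mem_cat (allpairs_f (fun x y => x^-1 * y)%g (gF i) (gF j)) orbT.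
    have -> : s g = (s g - s h *m s (h^-1 * g)%g) + s h *m s (h^-1 * g)%g.
      by rewrite subrK.
    rewrite mulmxDl linearDl -mulmxA (le_trans (cabsD _ _))// lerD//.
      rewrite (le_trans (dot_cabs (@coldot C D) _ _))// -!/(cnorm _).
      rewrite [cnorm (s h *m x)]cnorm_isom// x1 mulr1.
      have := mxboundBC (sM h (h^-1 * g)%g (FL _ (gF i)) hg) x.
      by rewrite mulVKg x1 mulr1.
    rewrite /= coldot_isom// sc// -(inj_eq (mulgI h)) mulVKg mulg1.
    by rewrite nth_uniq ?undup_uniq// val_eqE eq_sym.
  rewrite !sumr_const !card_ord -mulr2n -!mulrnA -mulr_natr /c mulrAC.
  rewrite ler_pdivrMr// ler_pM2l// -(natrM _ 2) (_ : (2 * (n * n) = 2 * n * n)%N) ?lerDl//.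
  by rewrite mulnA.
have d1 : d < 1 by apply: le_lt_trans d2 _; rewrite invf_lt1// ltr1n.
have [u uu uB] := polar (ltW d0) d1 BB.
(* For g outside F the indicator column vanishes, so [f g] takes the default value 0. *)
pose f g : 'cV[C]_D := u *m (\col_i (g == g_ i)%:R).
have gE g : g \in F -> exists2 i, g = g_ i & (\col_j (g == g_ j)%:R : 'cV[C]_n) = delta_mx i 0.
  rewrite -mem_undup => gF'; have gn : (index g (undup F) < n)%N by rewrite index_mem.
  exists (Ordinal gn); first by rewrite /g_ nth_index.
  apply/colP => j; rewrite !mxE andbT -{1}(nth_index 1%g gF') nth_uniq ?undup_uniq//.
  by rewrite eq_sym.
have fB g : g \in F -> cnorm (f g - s g *m x) <= d.
  move=> /gE[i gi ci]; rewrite /f ci.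
  have -> : s g *m x = B *m delta_mx i 0 by rewrite -colE colB gi.
  by rewrite -mulmxBl (le_trans (uB _))// cnorm_delta mulr1.
exists D, s, f; split=> //.
  split=> // g h gF' hF; apply: mxbound_le (sM _ _ (FL _ gF') (FL _ hF)).
  by have := cd; have := de; have := e0; lra.
split=> [g h /gE[i -> ci] /gE[j -> cj]|g h gF' hF ghF].
  rewrite /f ci cj coldot_isom// nth_uniq ?undup_uniq// val_eqE.
  rewrite /coldot (bigD1 i)//= big1 => [|k ki]; last by rewrite mxE (negPf ki) mul0r.
  by rewrite !mxE !eqxx /= andbT mul1r addr0 rmorph_nat.
apply: (@le_trans _ _ (d + c + d)); last first.
  by have := cd; have := de; lra.
have -> : s g *m f h - f (g * h)%g = s g *m (f h - s h *m x)
    + (s g *m s h - s (g * h)%g) *m x + (s (g * h)%g *m x - f (g * h)%g).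
  by rewrite mulmxBr mulmxBl !mulmxA !addrA !subrK.
rewrite (le_trans (ler_vnormD _ _ _))// -!/(cnorm _) lerD//; last first.
  by rewrite /cnorm vnormB fB.
rewrite (le_trans (ler_vnormD _ _ _))// -!/(cnorm _) cnorm_isom// lerD// ?fB//.
by rewrite -[leRHS]mulr1 -x1; exact: sM (FL _ gF') (FL _ hF) x.
Qed.

End ApproximateRepresentations.

(** * Approximate absorption *)

Section TensorVectors.
Context (R : realType).
Local Notation C := R[i].

(** The product [u *t v] has [1 * 1] columns; the name fixes the convertible type of column
    vectors. *)
Definition tensv m n (u : 'cV[C]_m) (v : 'cV[C]_n) : 'cV[C]_(m * n) := u *t v.

Lemma tensvBl m n (u u' : 'cV[C]_m) (v : 'cV[C]_n) :
  tensv (u - u') v = tensv u v - tensv u' v.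
Proof. exact: (tensmxBl u u' v). Qed.

Lemma tensvBr m n (u : 'cV[C]_m) (v v' : 'cV[C]_n) :
  tensv u (v - v') = tensv u v - tensv u v'.
Proof. exact: (tensmxBr u v v'). Qed.

Lemma tensv_linear m n (u : 'cV[C]_m) : linear (@tensv m n u).
Proof.
by move=> a v w; apply/matrixP => i j; rewrite !mxE mulrDr mulrCA.
Qed.

Lemma coldot_tensv m n (u u' : 'cV[C]_m) (v v' : 'cV[C]_n) :
  coldot (tensv u v) (tensv u' v') = coldot u u' * coldot v v'.
Proof. exact: coldot_tens. Qed.

Lemma cnorm_tensv m n (u : 'cV[C]_m) (v : 'cV[C]_n) :
  cnorm (tensv u v) = cnorm u * cnorm v.
Proof. exact: cnorm_tens. Qed.

Lemma mul_tensv m n p q (A : 'M[C]_(m, n)) (B : 'M[C]_(p, q)) u v :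
  (A *t B) *m tensv u v = tensv (A *m u) (B *m v).
Proof. exact: tensmx_mulv. Qed.

Lemma cnorm_dist n (u v w : 'cV[C]_n) : cnorm (u - w) <= cnorm (u - v) + cnorm (v - w).
Proof. exact: ler_vnormB. Qed.

(** Pythagoras: tensors with orthonormal first factors are mutually orthogonal. *)
Lemma cnorm_orthosum (T : eqType) (l : seq T) d m (f : T -> 'cV[C]_d) (w : T -> 'cV[C]_m) :
  uniq l -> (forall x y, x \in l -> y \in l -> coldot (f x) (f y) = (x == y)%:R) ->
  cnorm (\sum_(x <- l) tensv (f x) (w x)) ^+ 2 = \sum_(x <- l) cnorm (w x) ^+ 2.
Proof.
move=> ul fon; apply: (@complexI R); rewrite -fvvE rmorph_sum /=.
rewrite (linear_sumlz (@coldot C (d * m)%N)) [LHS]big_seq [RHS]big_seq /=.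
apply: eq_bigr => x xl; rewrite (linear_sumr (@coldot C (d * m)%N)) /= (bigD1_seq x)//=.
rewrite coldot_tensv fon// eqxx mul1r -(fvvE (@coldot C m)) big_seq_cond big1 ?addr0//.
by move=> y /andP[yl yx]; rewrite coldot_tensv fon// eq_sym (negPf yx) mul0r.
Qed.

Lemma linear_colmx m n (phi : 'cV[C]_m -> 'cV[C]_n) : linear phi ->
  exists J : 'M[C]_(n, m), forall c, J *m c = phi c.
Proof.
move=> lphi; exists (\matrix_(i, j) phi (delta_mx j 0) i 0) => c.
pose L : {linear 'cV[C]_m -> 'cV[C]_n} := HB.pack phi (GRing.isLinear.Build _ _ _ _ phi lphi).
rewrite -[RHS]/(L c) [c in RHS]matrix_sum_delta linear_sum; apply/colP => i.
rewrite mxE summxE; apply: eq_bigr => j _.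
by rewrite big_ord1 linearZ /= !mxE mulrC.
Qed.

Lemma isom_of_cnorm m n (J : 'M[C]_(n, m)) : (forall c, cnorm (J *m c) = cnorm c) ->
  J ^t* *m J = 1%:M.
Proof.
move=> Jn.
have lJ : linear (mulmx J : 'cV[C]_m -> 'cV[C]_n) by move=> a u v; rewrite mulmxDr scalemxAr.
have Jd := isometry_dot (f := @coldot C m) (g := @coldot C n) lJ Jn.
apply/matrixP => i j; rewrite mulmx_coldot !colE -[LHS]/(coldot _ _) [LHS]Jd.
rewrite /= -[delta_mx j 0]mul1mx -[delta_mx i 0]mul1mx -!colE -mulmx_coldot.
by rewrite mulmx1 trmx1 map_mx1.
Qed.

End TensorVectors.

Section ShiftEstimate.
Context (R : realType) (G : groupType).
Local Notation C := R[i].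

(* [a] stands for the square root of a finitely supported Reiter function. *)
Definition reiter_vector (gs : seq G) (e : R) (A : seq G) (a : G -> R) : Prop :=
  [/\ uniq A, forall h, 0 <= a h,
    forall h, h \notin A -> a h = 0, \sum_(h <- A) a h ^+ 2 = 1 &
    forall g, g \in gs -> forall B : seq G, uniq B ->
      \sum_(h <- B) (a (g^-1 * h)%g - a h) ^+ 2 <= e ^+ 2].

Definition translates_in (gs A F : seq G) : Prop :=
  [/\ forall g, g \in gs -> g \in F, forall h, h \in A -> h \in F &
      forall g h, g \in gs -> h \in A -> (g * h)%g \in F].

Context (gs A F : seq G) (a : G -> R) (e0 : R).
Hypotheses (e00 : 0 <= e0) (ra : reiter_vector gs e0 A a) (tF : translates_in gs A F).
Context (D : nat) (s : G -> 'M[C]_D) (f : G -> 'cV[C]_D) (e : R).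
Hypothesis sh : shift_system F e s f.
Context (m : nat).

(** A model of the function h -> a(h) w(h) in l^2(G) (x) C^m, with [f] in the role of the canonical
    basis. *)
Definition spread (w : G -> 'cV[C]_m) : 'cV[C]_(D * m) :=
  \sum_(h <- A) tensv (f h) ((a h)%:C%C *: w h).

Lemma cnorm_spread (w : G -> 'cV[C]_m) (N : R) :
  (forall h, h \in A -> cnorm (w h) = N) -> 0 <= N -> cnorm (spread w) = N.
Proof.
move=> wN N0; have [uA a0 _ a1 _] := ra; have [_ AF _] := tF.
apply/eqP; rewrite -(@eqrXn2 _ 2)// ?cnorm_ge0// /spread cnorm_orthosum//; last first.
  by move=> x y xA yA; apply: (proj1 sh); exact: AF.
rewrite big_seq; under eq_bigr => h hA do
  rewrite /cnorm vnormZ -/(cnorm _) wN// exprMn cabs_real ger0_norm//.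
by rewrite -big_seq -mulr_suml a1 mul1r.
Qed.

Lemma coef_le1 h : h \in A -> a h <= 1.
Proof.
move=> hA; have [uA a0 _ a1 _] := ra.
rewrite -(@ler_pXn2r _ 2) ?nnegrE// expr1n -a1 (bigD1_seq h)//= lerDl.
by apply: sumr_ge0 => i _; rewrite sqr_ge0.
Qed.

(** Three errors: s(g) f_h against f_(gh), summed by the triangle inequality and thus multiplied by
    [size A]; w(h) against w'(gh), free of such a factor by orthogonality; and a(g^-1 h) against
    a(h), the Reiter error. *)
Lemma spread_shift (g : G) (w w' : G -> 'cV[C]_m) (N d : R) : g \in gs -> 0 <= N -> 0 <= d ->
  (forall h, h \in A -> cnorm (w h) <= N) -> (forall h, cnorm (w' h) <= N) ->
  (forall h, h \in A -> cnorm (w h - w' (g * h)%g) <= d) ->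
  cnorm ((s g *t 1%:M) *m spread w - spread w') <= (size A)%:R * e * N + d + e0 * N.
Proof.
move=> ggs N0 d0 wN w'N ww'; have [uA a0 aA a1 ae] := ra; have [gF AF gAF] := tF.
have [fon fsh] := sh.
pose T1 : 'cV[C]_(D * m) := \sum_(h <- A) tensv (f (g * h)%g) ((a h)%:C%C *: w h).
pose T2 : 'cV[C]_(D * m) := \sum_(h <- A) tensv (f (g * h)%g) ((a h)%:C%C *: w' (g * h)%g).
apply: le_trans (cnorm_dist _ T2 _) _; apply: lerD.
  apply: le_trans (cnorm_dist _ T1 _) _; apply: lerD.
    rewrite /spread mulmx_sumr -sumrB (le_trans (vnorm_sum _ _ _))//.
    rewrite -sum1_size natr_sum !mulr_suml big_seq [leRHS]big_seq; apply: ler_sum => h hA.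
    rewrite mul_tensv mul1mx -tensvBl -/(cnorm _) cnorm_tensv mul1r.
    apply: ler_pM; rewrite ?cnorm_ge0//; first by apply: fsh; [exact: gF|exact: AF|exact: gAF].
    rewrite /cnorm vnormZ -/(cnorm _) cabs_real ger0_norm// -[leRHS]mul1r.
    by rewrite ler_pM ?cnorm_ge0 ?coef_le1 ?wN.
  rewrite -(@ler_pXn2r _ 2) ?nnegrE ?cnorm_ge0// /T1 /T2 -sumrB.
  under eq_bigr do rewrite -tensvBr -scalerBr.
  rewrite (cnorm_orthosum (f := fun h => f (g * h)%g))//; last first.
    by move=> x y xA yA; rewrite fon ?gAF// (inj_eq (mulgI g)).
  rewrite -[leRHS]mul1r -a1 mulr_suml big_seq [leRHS]big_seq; apply: ler_sum => h hA.
  rewrite /cnorm vnormZ -/(cnorm _) cabs_real ger0_norm// exprMn ler_wpM2l ?sqr_ge0//.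
  by rewrite ler_pXn2r ?nnegrE ?cnorm_ge0// ww'.
(* Both sums are extended by zero to the union of A and its translate gA, where they can be
   subtracted termwise. *)
pose B := undup (A ++ [seq (g * h)%g | h <- A]).
have uB : uniq B by exact: undup_uniq.
have BF h : h \in B -> h \in F.
  by rewrite mem_undup mem_cat => /orP[/AF//|/mapP[k kA ->]]; exact: gAF.
have ext (b : G -> R) (S : seq G) : uniq S -> {subset S <= B} ->
    (forall h, h \notin S -> b h = 0) ->
    \sum_(h <- S) tensv (f h) ((b h)%:C%C *: w' h) =
    \sum_(h <- B) tensv (f h) ((b h)%:C%C *: w' h).
  move=> uS SB bS; rewrite [RHS](bigID (mem S)) /= [X in _ = _ + X]big1 ?addr0; last first.
    move=> h /bS ->; rewrite rmorph0 scale0r; apply/matrixP => i j.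
    by rewrite !mxE mulr0.
  rewrite -[RHS]big_filter; apply: perm_big; apply: uniq_perm; rewrite ?filter_uniq//.
  by move=> h; rewrite mem_filter; case: (boolP (h \in S)) => //= /SB ->.
have -> : T2 - spread w' = \sum_(h <- B) tensv (f h) ((a (g^-1 * h)%g - a h)%:C%C *: w' h).
  rewrite /spread (ext a)//; last by move=> h hA; rewrite mem_undup mem_cat hA.
  have -> : T2 = \sum_(h <- [seq (g * h)%g | h <- A]) tensv (f h) ((a (g^-1 * h)%g)%:C%C *: w' h).
    by rewrite big_map; apply: eq_bigr => h _; rewrite mulKg.
  rewrite (ext (fun h => a (g^-1 * h)%g)).
  - by rewrite -sumrB; apply: eq_bigr => h _; rewrite -tensvBr -scalerBl -rmorphB.
  - by rewrite map_inj_uniq//; exact: mulgI.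
  - by move=> h hA; rewrite mem_undup mem_cat hA orbT.
  - move=> h hA; apply: aA; apply: contra hA => hA.
    by apply/mapP; exists (g^-1 * h)%g => //; rewrite mulVKg.
rewrite -(@ler_pXn2r _ 2) ?nnegrE ?cnorm_ge0 ?mulr_ge0// cnorm_orthosum//; last first.
  by move=> x y xB yB; apply: fon; exact: BF.
rewrite exprMn; apply: le_trans (ler_wpM2r (sqr_ge0 N) (ae _ ggs _ uB)).
rewrite mulr_suml; apply: ler_sum => h _.
rewrite /cnorm vnormZ -/(cnorm _) cabs_real exprMn real_normK ?num_real//.
by rewrite ler_wpM2l ?sqr_ge0// ler_pXn2r ?nnegrE ?cnorm_ge0.
Qed.

End ShiftEstimate.

Section Step.
Context (R : realType) (G : groupType).
Local Notation C := R[i].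

(* Fell absorption: [J c] spreads the vectors [s(h)^* c] over the orbit [f]. *)
Lemma unitary_step (gs A F : seq G) (a : G -> R) (e0 e e' : R) D (t : G -> 'M[C]_D)
    (f : G -> 'cV[C]_D) m (s : G -> 'M[C]_m) :
  0 <= e0 -> 0 <= e' -> reiter_vector gs e0 A a ->
  translates_in gs A F -> shift_system F e t f ->
  (forall g, (s g) ^t* *m s g = 1%:M) ->
  (forall g h, g \in gs -> h \in A -> mxbound (s g *m s h - s (g * h)%g) e') ->
  exists J : 'M[C]_(D * m, m), J ^t* *m J = 1%:M /\
    forall g, g \in gs ->
      mxbound ((t g *t 1%:M) *m J - J *m s g) ((size A)%:R * e + e' + e0).
Proof.
move=> e00 e'0 ra tF sh su sM.
have su' g : s g *m (s g) ^t* = 1%:M by exact: mulmx1C.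
have [J JE] : exists J : 'M[C]_(D * m, m), forall c,
    J *m c = spread A a f (fun h => (s h) ^t* *m c).
  apply: linear_colmx => b u v; rewrite /spread scaler_sumr -big_split /=.
  apply: eq_bigr => h _; rewrite -tensv_linear; congr tensv.
  by rewrite mulmxDr scalerDr -scalemxAr !scalerA mulrC.
have nS h c : cnorm ((s h) ^t* *m c) = cnorm c by rewrite cnorm_isom// trmxCK.
exists J; split.
  apply: isom_of_cnorm => c; rewrite JE.
  by apply: (cnorm_spread ra tF sh) => [h _|]; rewrite ?nS ?cnorm_ge0.
move=> g ggs c; rewrite mulmxBl -!mulmxA !JE.
have := @spread_shift _ _ _ _ _ _ _ e00 ra tF _ _ _ _ sh _ g
  (fun h => (s h) ^t* *m c) (fun h => (s h) ^t* *m (s g *m c)) (cnorm c) (e' * cnorm c) ggs.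
rewrite -mulrDl -mulrDl; apply; rewrite ?mulr_ge0 ?cnorm_ge0//.
- by move=> h _; rewrite nS.
- by move=> h; rewrite nS cnorm_isom.
(* Applying the unitary s(gh) turns the difference into the multiplicativity defect at (g, h)
   evaluated at s(h)^* c. *)
- move=> h hA; rewrite -(@cnorm_isom _ _ _ (s (g * h)%g))// mulmxBr [_ *m (_ *m (_ *m c))]mulmxA su' mul1mx.
  have -> : s g *m c = s g *m s h *m ((s h) ^t* *m c).
    by rewrite -!mulmxA (mulmxA (s h)) su' mul1mx.
  rewrite -mulmxBl -[in leRHS](nS h); apply: mxboundBC; exact: sM.
Qed.

End Step.

(** * A chain of approximate representations, each nested in the next *)

Section Chain.
Context (R : realType) (G : groupType).
Local Notation C := R[i].

Lemma dependent_sequence (T : Type) (P : nat -> T -> Prop) (S : nat -> T -> T -> Prop) :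
  (exists x, P 0 x) -> (forall n x, P n x -> exists2 y, P n.+1 y & S n x y) ->
  exists u : nat -> T, forall n, P n (u n) /\ S n (u n) (u n.+1).
Proof.
move=> /cid[x0 Px0] step.
pose next n (x : {x | P n x}) : {y | P n.+1 y & S n (sval x) y} :=
  cid2 (step n (sval x) (svalP x)).
pose fix u n : {x | P n x} := match n with
  | 0 => exist _ x0 Px0
  | m.+1 => let y := next m (u m) in exist _ (s2val y) (s2valP y) end.
exists (fun n => sval (u n)) => n; split; first exact: svalP.
exact: (s2valP' (next n (u n))).
Qed.

Definition window (gamma : nat -> G) (n : nat) : seq G := [seq gamma i | i <- iota 0 n.+1].

(** Stage n+1 is t (x) 1, for a new approximate representation t with an orthonormal orbit,
    conjugated by the unitary Q that turns the absorption isometry J into the inclusion of the first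
    coordinates. *)
Lemma unitary_chain (gamma : nat -> G) : amenable R G -> MF R G ->
  exists (d : nat -> nat) (s : forall n, G -> 'M[C]_(d n))
    (A B : nat -> seq G) (a : nat -> G -> R) (e : nat -> R),
  [/\ forall n, (d n < d n.+1)%N,
    forall n, 0 <= e n /\ (size (A n))%:R * e n + e n <= 2^-1 ^+ n,
    forall n, reiter_vector (window gamma n) (2^-1 ^+ n) (A n) (a n) /\
      translates_in (window gamma n) (A n) (B n),
    forall n, approx_rep (B n) (e n) (s n) /\
      exists f, shift_system (B n) (e n) (s n) f &
    forall n g, g \in window gamma n ->
      mxbound (s n.+1 g *m inclmx R (d n.+1) (d n) - inclmx R (d n.+1) (d n) *m s n g)
        (3 * 2^-1 ^+ n)].
Proof.
move=> [mu mean] GMF; pose W := window gamma.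
have h0 n : 0 < 2^-1 ^+ n :> R by rewrite exprn_gt0 ?invr_gt0.
have /choice[Aa AaP] : forall n, exists Aa : seq G * (G -> R),
    reiter_vector (W n) (2^-1 ^+ n) Aa.1 Aa.2.
  move=> n; have [A [a Aa]] := reiter mean (W n) (exprn_gt0 2 (h0 n)).
  by exists (A, a).
pose A n := (Aa n).1; pose a n := (Aa n).2.
pose L n := W n ++ A n ++ [seq (g * h)%g | g <- W n, h <- A n].
(* Stage n serves twice: on [L n.-1] it absorbs the previous stage, and on [L n] it is absorbed by
   the next one. *)
pose B n := L n ++ L n.-1.
(* The denominator dominates both [size (A n) + 1] and [size (A n.-1)], one for each of the two uses
   of stage n. *)
pose e n : R := 2^-1 ^+ n / ((size (A n))%:R + (size (A n.-1))%:R + 1).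
have den n : 0 < (size (A n))%:R + (size (A n.-1))%:R + 1 :> R.
  by rewrite ltr_wpDl// addr_ge0.
have e0 n : 0 < e n by rewrite divr_gt0.
have LE n : translates_in (W n) (A n) (L n).
  split=> [g gW|h hA|g h gW hA]; rewrite /L mem_cat.
  - by rewrite gW.
  - by rewrite mem_cat hA orbT.
  - apply/orP; right; rewrite mem_cat; apply/orP; right.
    exact: (allpairs_f (fun x y => x * y)%g).
have tLB n F : {subset L n <= F} -> translates_in (W n) (A n) F.
  move=> LF; have [t1 t2 t3] := LE n.
  by split=> [g gW|h hA|g h gW hA]; apply: LF; [exact: t1|exact: t2|exact: t3].
have LB n : {subset L n <= B n} by move=> g gL; rewrite mem_cat gL.
have LB1 n : {subset L n <= B n.+1} by move=> g gL; rewrite mem_cat gL orbT.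
have eM n (x : R) : x <= (size (A n))%:R + (size (A n.-1))%:R + 1 -> x * e n <= 2^-1 ^+ n.
  move=> xn; rewrite /e mulrCA -[leRHS]mulr1; apply: ler_wpM2l; first exact: ltW.
  by rewrite ler_pdivrMr// mul1r.
have ebound n : (size (A n))%:R * e n + e n <= 2^-1 ^+ n.
  rewrite -[X in _ + X]mul1r -mulrDl; apply: eM.
  by rewrite lerD2r lerDl.
have ebound1 n : (size (A n))%:R * e n.+1 <= 2^-1 ^+ n.
  apply: (@le_trans _ _ (2^-1 ^+ n.+1)).
    by apply: eM; rewrite [_ + (size (A n))%:R]addrC -addrA lerDl addr_ge0.
  by rewrite exprS ler_piMl ?(ltW (h0 n))// invf_le1// ler1n.
have ele n : e n <= 2^-1 ^+ n.
  by apply: le_trans (ebound n); rewrite lerDr mulr_ge0// ltW.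
pose T := {d : nat & G -> 'M[C]_d}.
pose P n (x : T) := [/\ (0 < tag x)%N, approx_rep (B n) (e n) (tagged x) &
  exists f, shift_system (B n) (e n) (tagged x) f].
pose S n (x y : T) := (tag x < tag y)%N /\ forall g, g \in W n ->
  mxbound (tagged y g *m inclmx R (tag y) (tag x) - inclmx R (tag y) (tag x) *m tagged x g)
    (3 * 2^-1 ^+ n).
have [||u uP] := @dependent_sequence T P S.
- have [d [s [f [d1 sB sh]]]] := MF_shift_system GMF (B 0) (e0 0).
  by exists (Tagged (fun d => G -> 'M[C]_d) s); split=> //=; [exact: ltnW|exists f].
- move=> n [d s] [/= d0 [su sM] _].
  have [D [t [f [D1 [tu tM] sh]]]] := MF_shift_system GMF (B n.+1) (e0 n.+1).
  have [|J [JJ JI]] := unitary_step (ltW (h0 n)) (ltW (e0 n)) (AaP n) (tLB n _ (LB1 n)) sh su.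
    move=> g h gW hA; have [t1 t2 _] := tLB n _ (LB n).
    by apply: sM; [exact: t1|exact: t2].
  have [Q [QQ QQ' QJ]] := unitary_completion JJ.
  pose s' g := Q *m (t g *t (1%:M : 'M[C]_d)) *m Q ^t*.
  exists (Tagged (fun d => G -> 'M[C]_d) s').
    split=> /=; first by rewrite muln_gt0 d0 (ltnW D1).
    + split=> [g|g h gB hB]; rewrite /s'.
        have tt : (t g *t (1%:M : 'M[C]_d)) ^t* *m (t g *t 1%:M) = 1%:M.
          by apply: tensmx_isom; rewrite ?tu// trmx1 map_mx1 mulmx1.
        rewrite !trmxC_mul trmxCK -!mulmxA (mulmxA _ Q) QQ mul1mx.
        by rewrite (mulmxA (_ ^t*) _ (Q ^t*)) tt mul1mx QQ'.
      have -> : Q *m (t g *t 1%:M) *m Q ^t* *m (Q *m (t h *t 1%:M) *m Q ^t*) -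
          Q *m (t (g * h)%g *t 1%:M) *m Q ^t* =
          Q *m ((t g *m t h - t (g * h)%g) *t (1%:M : 'M[C]_d)) *m Q ^t*.
        rewrite tensmxBl mulmxBr mulmxBl; congr (_ - _).
        rewrite -!mulmxA (mulmxA _ Q) QQ mul1mx; congr (_ *m _).
        by rewrite mulmxA tensmx_mul mulmx1.
      move=> c; rewrite -!mulmxA cnorm_isom//.
      have -> : cnorm c = cnorm (Q ^t* *m c) by rewrite cnorm_isom// trmxCK.
      by apply: mxbound_tens1r; [exact: ltW|exact: tM].
    (* Tensoring with one fixed unit vector turns the orbit of t into an orbit of t (x) 1; [d0]
       provides that vector. *)
    + have [fon fsh] := sh; pose v : 'cV[C]_d := delta_mx (Ordinal d0) 0.
      exists (fun g => Q *m tensv (f g) v); split=> [g h gB hB|g h gB hB ghB].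
        rewrite coldot_isom// coldot_tensv fon// (fvvE (@coldot C d)) -/(cnorm _).
        by rewrite cnorm_delta expr1n mulr1.
      rewrite /s' -!mulmxA (mulmxA (Q ^t*)) QQ mul1mx mul_tensv mul1mx.
      rewrite -mulmxBr cnorm_isom// -tensvBl cnorm_tensv cnorm_delta mulr1.
      exact: fsh.
  split=> /=; first by rewrite ltn_Pmull.
  move=> g gW; rewrite /s' -QJ -!mulmxA (mulmxA (Q ^t*)) QQ mul1mx -mulmxBr => c.
  rewrite -mulmxA cnorm_isom//; apply: mxbound_le (JI g gW) c.
  (* The factor 3 collects the orbit error, the multiplicativity defect and the Reiter error, each
     at most 2^-n. *)
  have := ebound1 n; have := ele n; clear; move: (2^-1 ^+ n) => h; lra.
exists (fun n => tag (u n)), (fun n => tagged (u n)), A, B, a, e; split.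
- by move=> n; have [_ []] := uP n.
- by move=> n; split=> //; exact: ltW.
- by move=> n; split; [exact: AaP|exact: tLB].
- by move=> n; have [[]] := uP n.
- by move=> n; have [_ []] := uP n.
Qed.

End Chain.

(** * The Hilbert space of square-summable sequences *)

Section ComplexSequences.
Context (R : realType).
Local Notation C := R[i].
Local Notation Re := (@complex.Re R).
Local Notation Im := (@complex.Im R).

Definition ccvg (z : nat -> C) (l : C) : Prop :=
  (fun n => Re (z n)) @ \oo --> Re l /\ (fun n => Im (z n)) @ \oo --> Im l.

Definition clim (z : nat -> C) : C :=
  (limn (fun n => Re (z n)) +i* limn (fun n => Im (z n)))%C.

Lemma ccvg_clim z l : ccvg z l -> clim z = l.
Proof.
move=> [zr zi]; rewrite /clim; case: l zr zi => a b /= zr zi.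
by congr (_ +i* _)%C; apply/cvg_lim.
Qed.

Lemma ccvg_unique z l l' : ccvg z l -> ccvg z l' -> l = l'.
Proof. by move=> /ccvg_clim <- /ccvg_clim <-. Qed.

Lemma cvgn_le (u : nat -> R) (l M : R) : u @ \oo --> l -> (forall n, u n <= M) -> l <= M.
Proof.
move=> ul uM; rewrite -(cvg_lim _ ul)//; apply: limr_le; first exact: cvgP ul.
by exists 0%N => // n _.
Qed.

Lemma cvgn_ge (u : nat -> R) (l M : R) : u @ \oo --> l -> (forall n, M <= u n) -> M <= l.
Proof.
move=> ul uM; rewrite -(cvg_lim _ ul)//; apply: limr_ge; first exact: cvgP ul.
by exists 0%N => // n _.
Qed.

Lemma ccvg_lin (a : C) z w l m : ccvg z l -> ccvg w m ->
  ccvg (fun n => a * z n + w n) (a * l + m).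
Proof.
move=> [zr zi] [wr wi]; case: a l m zr zi wr wi => a b [l1 l2] [m1 m2] /= zr zi wr wi.
split=> /=.
  rewrite (_ : (fun n => _) = (fun n => a * Re (z n) - b * Im (z n) + Re (w n))); last first.
    by apply/funext => n; case: (z n) (w n) => [? ?] [? ?].
  by apply: cvgD => //; apply: cvgB; apply: cvgM => //; exact: cvg_cst.
rewrite (_ : (fun n => _) = (fun n => a * Im (z n) + b * Re (z n) + Im (w n))); last first.
  by apply/funext => n; case: (z n) (w n) => [? ?] [? ?].
by apply: cvgD => //; apply: cvgD; apply: cvgM => //; exact: cvg_cst.
Qed.

Lemma ccvg_conj z l : ccvg z l -> ccvg (fun n => (z n)^*) l^*.
Proof.
have ReJ w : Re w^* = Re w by case: w.
have ImJ w : Im w^* = - Im w by case: w.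
move=> [zr zi]; split.
  have -> : (fun n => Re (z n)^*) = (fun n => Re (z n)) by apply/funext => n; exact: ReJ.
  by rewrite ReJ.
have -> : (fun n => Im (z n)^*) = (fun n => - Im (z n)) by apply/funext => n; exact: ImJ.
by rewrite ImJ; exact: cvgN.
Qed.

Lemma cabs_i : cabs (0 +i* 1)%C = 1 :> R.
Proof. by apply: cabs_eq; rewrite normc_def /= expr0n expr1n add0r sqrtr1. Qed.

Lemma ccvg_real (u : nat -> R) (l : R) : u @ \oo --> l ->
  ccvg (fun n => ((u n)%:C)%C) (l%:C)%C.
Proof. by move=> ul; split=> //=; exact: cvg_cst. Qed.

(** Any two of the intervals of centre u n and radius 2^-n meet, so the supremum of the left ends
    lies in all of them. *)
Lemma real_cauchy (u : nat -> R) :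
  (forall n m, `|u n - u m| <= 2^-1 ^+ n + 2^-1 ^+ m) ->
  exists l, forall n, `|u n - l| <= 2^-1 ^+ n.
Proof.
move=> uC; pose A : set R := [set x | exists n, x = u n - 2^-1 ^+ n].
have ub m : ubound A (u m + 2^-1 ^+ m).
  by move=> _ [n ->]; have := uC n m; rewrite ler_norml => /andP[_]; lra.
have A0 : A !=set0 by exists (u 0%N - 2^-1 ^+ 0), 0%N.
exists (sup A) => n; rewrite ler_norml; apply/andP; split.
  by have : sup A <= u n + 2^-1 ^+ n by [exact: ge_sup]; lra.
have : u n - 2^-1 ^+ n <= sup A.
  by apply: ub_le_sup; [exists (u 0%N + 2^-1 ^+ 0); exact: ub|exists n].
lra.
Qed.

Lemma complex_cauchy (z : nat -> C) :
  (forall n m, cabs (z n - z m) <= 2^-1 ^+ n + 2^-1 ^+ m) ->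
  exists l, forall n, cabs (z n - l) <= 2 * 2^-1 ^+ n.
Proof.
move=> zC.
have ReC w : `|Re w| <= cabs w.
  by rewrite -[leRHS]/(cabs w) -lecR cabsE; exact: normc_ge_Re.
have ImE w : Im w = Re (- (0 +i* 1)%C * w).
  by case: w => a b /=; rewrite oppr0 mul0r sub0r mulN1r opprK.
have ImC w : `|Im w| <= cabs w.
  by rewrite ImE (le_trans (ReC _))// cabsM cabsN cabs_i mul1r.
have [a aP] : exists a, forall n, `|Re (z n) - a| <= 2^-1 ^+ n.
  apply: real_cauchy => n m; rewrite (le_trans _ (zC n m))// (le_trans _ (ReC _))//.
  by case: (z n) (z m) => [? ?] [? ?].
have [b bP] : exists b, forall n, `|Im (z n) - b| <= 2^-1 ^+ n.
  apply: real_cauchy => n m; rewrite (le_trans _ (zC n m))// (le_trans _ (ImC _))//.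
  by case: (z n) (z m) => [? ?] [? ?].
exists (a +i* b)%C => n.
have -> : z n - (a +i* b)%C = ((Re (z n) - a)%:C)%C + (0 +i* 1)%C * ((Im (z n) - b)%:C)%C.
  by case: (z n) => x y; apply/eqP; rewrite eq_complex /=; apply/andP; split; apply/eqP; ring.
rewrite (le_trans (cabsD _ _))// cabsM !cabs_real mulr2n mulrDl mul1r lerD//.
rewrite cabs_i mul1r; exact: bP.
Qed.

End ComplexSequences.

Definition trunc (R : realType) n (v : nat -> R[i]) : 'cV[R[i]]_n := \col_i v i.

(** Square-summability is a uniform bound on the norms of truncations, which reduces the theory to
    column vectors. *)
Definition ell2 (R : realType) : Type :=
  {v : nat -> R[i] | exists M : R, forall n, cnorm (trunc n v) <= M}.

Lemma cnormDE (R : realType) n (u v : 'cV[R[i]]_n) : cnorm (u + v) ^+ 2 =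
  cnorm u ^+ 2 + cnorm v ^+ 2 + (complex.Re (coldot u v)) *+ 2.
Proof. exact: vnormDE. Qed.

Section Ell2.
Context (R : realType).
Local Notation C := R[i].
Local Notation Re := (@complex.Re R).
Local Notation Im := (@complex.Im R).
Local Notation T := (ell2 R).

HB.instance Definition _ := gen_eqMixin T.
HB.instance Definition _ := gen_choiceMixin T.

Definition entry (v : T) : nat -> C := proj1_sig v.

Lemma entry_inj (u v : T) : entry u =1 entry v -> u = v.
Proof. by case: u v => [u pu] [v pv] /= /funext uv; exact: eq_exist. Qed.

Let trunc_lin n (a : C) (u v : nat -> C) :
  trunc n (fun k => a * u k + v k) = a *: trunc n u + trunc n v.
Proof. by apply/colP => i; rewrite !mxE. Qed.

Let lin_bound (a : C) (u v : T) :
  exists M : R, forall n, cnorm (trunc n (fun k => a * entry u k + entry v k)) <= M.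
Proof.
have [M uM] := proj2_sig u; have [N vN] := proj2_sig v.
exists (cabs a * M + N) => n; rewrite trunc_lin.
apply: (le_trans (ler_vnormD _ _ _)); rewrite vnormZ; apply: lerD; last exact: vN.
by rewrite ler_wpM2l ?cabs_ge0 ?uM.
Qed.

Let zero_bound : exists M : R, forall n, cnorm (trunc n (fun=> 0 : C)) <= M.
Proof.
exists 0 => n; rewrite (_ : trunc _ _ = 0) ?/cnorm ?vnorm0//.
by apply/colP => i; rewrite !mxE.
Qed.

Let zero : T := exist _ (fun=> 0) zero_bound.
Let lin a u v : T := exist _ _ (lin_bound a u v).
Let add u v : T := lin 1 u v.
Let opp u : T := lin (-1) u zero.
Let scale a u : T := lin a u zero.

Let addA : associative add.
Proof. by move=> x y z; apply: entry_inj => k /=; rewrite !mul1r addrA. Qed.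
Let addC : commutative add.
Proof. by move=> x y; apply: entry_inj => k /=; rewrite !mul1r addrC. Qed.
Let add0 : left_id zero add.
Proof. by move=> x; apply: entry_inj => k /=; rewrite !mul1r add0r. Qed.
Let addN : left_inverse zero opp add.
Proof. by move=> x; apply: entry_inj => k /=; rewrite mul1r mulN1r addr0 addNr. Qed.
HB.instance Definition _ := GRing.isZmodule.Build T addA addC add0 addN.

Lemma entryD (u v : T) k : entry (u + v) k = entry u k + entry v k.
Proof. by rewrite /= mul1r. Qed.

Let scaleA a b v : scale a (scale b v) = scale (a * b) v.
Proof. by apply: entry_inj => k /=; rewrite !addr0 mulrA. Qed.
Let scale1 : left_id 1 scale.
Proof. by move=> v; apply: entry_inj => k /=; rewrite addr0 mul1r. Qed.
Let scaleDr : right_distributive scale +%R.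
Proof. by move=> a u v; apply: entry_inj => k; rewrite entryD /= !mul1r !addr0 mulrDr. Qed.
Let scaleDl v : {morph scale^~ v : a b / a + b}.
Proof. by move=> a b; apply: entry_inj => k; rewrite entryD /= !addr0 mulrDl. Qed.
HB.instance Definition _ := GRing.Zmodule_isLmodule.Build C T scaleA scale1 scaleDr scaleDl.

Lemma entryZ (a : C) (u : T) k : entry (a *: u) k = a * entry u k.
Proof. by rewrite /= addr0. Qed.

Definition tr n (v : T) : 'cV[C]_n := trunc n (entry v).

Lemma tr_linear n : linear (tr n).
Proof.
by move=> a u v; apply/colP => i; rewrite !mxE entryD entryZ.
Qed.
HB.instance Definition _ n := GRing.isLinear.Build C T 'cV[C]_n *:%R (tr n) (tr_linear n).

Lemma trD n (u v : T) : tr n (u + v) = tr n u + tr n v.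
Proof. exact: linearD. Qed.

Lemma trB n (u v : T) : tr n (u - v) = tr n u - tr n v.
Proof. exact: linearB. Qed.

Lemma cnorm_tr_sqr n v : cnorm (tr n v) ^+ 2 = \sum_(i < n) cabs (entry v i) ^+ 2.
Proof. by rewrite cnorm_sqr; apply: eq_bigr => i _; rewrite mxE. Qed.

Lemma cnorm_tr_nd v : nondecreasing_seq (fun n => cnorm (tr n v) ^+ 2).
Proof.
apply/nondecreasing_seqP => n; rewrite !cnorm_tr_sqr big_ord_recr /=.
by rewrite lerDl sqr_ge0.
Qed.

Lemma cnorm_tr_cvg v : cvgn (fun n => cnorm (tr n v) ^+ 2).
Proof.
apply: nondecreasing_is_cvgn; first exact: cnorm_tr_nd.
have [M vM] := proj2_sig v; exists (M ^+ 2) => _ [n _ <-].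
have M0 : 0 <= M by apply: le_trans (vM 0%N); exact: cnorm_ge0.
by rewrite ler_pXn2r ?nnegrE ?cnorm_ge0//; exact: vM.
Qed.

Definition l2dot (u v : T) : C := clim (fun n => coldot (tr n u) (tr n v)).

(** By polarization the real part is a combination of squared norms of truncations, which converge
    as bounded nondecreasing sequences. *)
Let Re_cvg u v : cvgn (fun n => Re (coldot (tr n u) (tr n v))).
Proof.
rewrite (_ : (fun n => _) = (fun n => 2^-1 * (cnorm (tr n (u + v)) ^+ 2 -
    (cnorm (tr n u) ^+ 2 + cnorm (tr n v) ^+ 2)))); last first.
  apply/funext => n; rewrite trD (cnormDE (tr n u)).
  move: (cnorm (tr n u) ^+ 2 + cnorm (tr n v) ^+ 2) (complex.Re _) => q r.
  rewrite [q + _]addrC addrK.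
  by rewrite -[X in _ = _ * X]mulr_natl mulKf// pnatr_eq0.
apply: is_cvgM; first exact: is_cvg_cst.
by apply: is_cvgB; [|apply: is_cvgD]; exact: (@cnorm_tr_cvg).
Qed.

Lemma l2dot_ccvg u v : ccvg (fun n => coldot (tr n u) (tr n v)) (l2dot u v).
Proof.
split; first exact: Re_cvg.
pose i' : C := - (0 +i* 1)%C; have := @Re_cvg (i' *: u) v.
rewrite (_ : (fun n => _) = (fun n => Im (coldot (tr n u) (tr n v))))//.
apply/funext => n; rewrite linearZ (linearZl_LR (@coldot C n)) /=.
by case: (coldot _ _) => a b /=; rewrite oppr0 mul0r sub0r mulN1r opprK.
Qed.

Let l2dot_lin a u v w : l2dot (a *: u + v) w = a * l2dot u w + l2dot v w.
Proof.
apply: ccvg_clim; have := ccvg_lin a (l2dot_ccvg u w) (l2dot_ccvg v w).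
rewrite (_ : (fun n => _) = (fun n => coldot (tr n (a *: u + v)) (tr n w)))//.
apply/funext => n; rewrite linearP (linearDl (@coldot C n)) /=.
by rewrite (linearZl_LR (@coldot C n)).
Qed.

Let l2dot_conj u v : l2dot u v = (l2dot v u)^*.
Proof.
apply: ccvg_clim; have := ccvg_conj (l2dot_ccvg v u).
rewrite (_ : (fun n => _) = (fun n => coldot (tr n u) (tr n v)))//.
by apply/funext => n; rewrite [RHS](dot_conj (@coldot C n)).
Qed.

Let l2dot_bilinear : bilinear_for
  (GRing.Scale.Law.clone _ _ *%R _)
  (GRing.Scale.Law.clone _ _ (Num.conj \; *%R) _) l2dot.
Proof.
split=> [w|w] a u v /=; first exact: l2dot_lin.
by rewrite l2dot_conj l2dot_lin rmorphD rmorphM /= (l2dot_conj w u) (l2dot_conj w v).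
Qed.
HB.instance Definition _ := bilinear_isBilinear.Build C T T C
  *%R (Num.conj \; *%R) l2dot l2dot_bilinear.

Let l2dot_herm u v : l2dot u v = (-1) ^+ false * (l2dot v u)^*.
Proof. by rewrite expr0 mul1r -l2dot_conj. Qed.
HB.instance Definition _ := isHermitianSesquilinear.Build C T
  false Num.conj l2dot l2dot_herm.

Let l2dotvv v : l2dot v v = ((limn (fun n => cnorm (tr n v) ^+ 2))%:C)%C.
Proof.
apply: ccvg_clim; have := @ccvg_real _ (fun n => cnorm (tr n v) ^+ 2) _ (@cnorm_tr_cvg v).
by rewrite (_ : (fun n => _) = (fun n => coldot (tr n v) (tr n v)))//;
  apply/funext => n; rewrite -(fvvE (@coldot C n)).
Qed.

Let tr_le n v : cnorm (tr n v) ^+ 2 <= limn (fun n => cnorm (tr n v) ^+ 2).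
Proof. exact: (nondecreasing_cvgn_le (@cnorm_tr_nd v) (@cnorm_tr_cvg v) n). Qed.

Let l2dot_gt0 v : v != 0 -> 0 < l2dot v v.
Proof.
move=> v0; have [k vk] : exists k, entry v k != 0.
  apply: contrapT => h; move/negP: v0; apply; apply/eqP; apply: entry_inj => k.
  by apply/eqP; apply: contrapT => vk; apply: h; exists k; apply/negP.
rewrite l2dotvv ltcR; apply: lt_le_trans (tr_le k.+1 v).
rewrite cnorm_tr_sqr big_ord_recr /= ltr_wpDl ?sumr_ge0//.
  by move=> i _; rewrite sqr_ge0.
rewrite exprn_gt0// lt_def cabs_ge0 andbT.
by apply: contra_neq vk; exact: cabs_eq0.
Qed.
HB.instance Definition _ := isDotProduct.Build C T l2dot l2dot_gt0.

Definition l2norm (v : T) : R := vnorm l2dot v.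

Let l2norm_sqrE v : l2norm v ^+ 2 = limn (fun n => cnorm (tr n v) ^+ 2).
Proof. by apply: (@complexI R); rewrite -l2dotvv (fvvE l2dot). Qed.

Lemma l2norm_sqr_cvg v : (fun n => cnorm (tr n v) ^+ 2) @ \oo --> l2norm v ^+ 2.
Proof. by rewrite l2norm_sqrE; exact: (@cnorm_tr_cvg). Qed.

Lemma cnorm_tr n v : cnorm (tr n v) <= l2norm v.
Proof.
rewrite -(@ler_pXn2r _ 2) ?nnegrE ?cnorm_ge0 ?vnorm_ge0//.
by rewrite l2norm_sqrE.
Qed.

Lemma l2norm_le v M : (forall n, cnorm (tr n v) <= M) -> l2norm v <= M.
Proof.
move=> vM; have M0 : 0 <= M by apply: le_trans (vM 0%N); exact: cnorm_ge0.
rewrite -(@ler_pXn2r _ 2) ?nnegrE ?vnorm_ge0//.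
apply: (@cvgn_le _ _ _ _ (@l2norm_sqr_cvg v)) => n.
by rewrite ler_pXn2r ?nnegrE ?cnorm_ge0.
Qed.

Let nrm (v : T) : C := ((l2norm v)%:C)%C.
Let nrmD u v : nrm (u + v) <= nrm u + nrm v.
Proof. by rewrite -rmorphD lecR ler_vnormD. Qed.
Let nrmZ (a : C) v : nrm (a *: v) = `|a| * nrm v.
Proof. by rewrite /nrm /l2norm vnormZ rmorphM /= cabsE. Qed.
Let nrm0 v : nrm v = 0 -> v = 0.
Proof. by move=> /(@complexI R); exact: vnorm_eq0. Qed.

HB.instance Definition _ := Lmodule_isNormed.Build C T nrmD nrmZ nrm0.

Lemma ell2_normE (v : T) : `|v| = ((l2norm v)%:C)%C.
Proof. by []. Qed.

(** The limit is taken entrywise; on each truncation, letting m tend to infinity in the bound for x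
    n - x m gives the rate uniformly. *)
Lemma ell2_cauchy (x : nat -> T) :
  (forall n m, l2norm (x n - x m) <= 2^-1 ^+ n + 2^-1 ^+ m) ->
  exists v, forall n, l2norm (x n - v) <= 2^-1 ^+ n.
Proof.
move=> xC; have /choice[l lP] k : exists l, forall n, cabs (entry (x n) k - l) <= 2 * 2^-1 ^+ n.
  apply: complex_cauchy => n m; rewrite (le_trans _ (xC n m))//.
  apply: le_trans (cnorm_tr k.+1 _); apply: le_trans (cabs_le_cnorm _ ord_max).
  by rewrite trB !mxE.
have xl N n : cnorm (tr N (x n) - trunc N l) <= 2^-1 ^+ n.
  (* The term 1 comes from x n - x m, and N * 2 from the N entries of x m, each within 2 * 2^-m of
     its limit. *)
  have h0 : (fun m => 2^-1 ^+ n + (1 + N%:R * 2) * 2^-1 ^+ m) @ \oo --> (2^-1 ^+ n + (1 + N%:R * 2) * 0 : R).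
    apply: cvgD; first exact: cvg_cst; apply: cvgM; first exact: cvg_cst.
    by apply: cvg_expr; rewrite ger0_norm ?invr_ge0// invf_lt1// ltr1n.
  rewrite mulr0 addr0 in h0; apply: (cvgn_ge h0) => m.
  apply: le_trans (cnorm_dist _ (tr N (x m)) _) _.
  rewrite mulrDl mul1r addrA lerD//.
    by rewrite -trB (le_trans (cnorm_tr _ _)).
  rewrite (le_trans (cnorm_le_sum _))// -mulrA mulr_natl -[X in _ *+ X]card_ord -sumr_const.
  by apply: ler_sum => i _; rewrite !mxE lP.
have lb : exists M : R, forall n, cnorm (trunc n l) <= M.
  exists (l2norm (x 0%N) + 1) => n.
  rewrite -[trunc n l](subKr (tr n (x 0%N))) (le_trans (ler_vnormD _ _ _))// lerD//.
    exact: cnorm_tr.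
  by rewrite vnormN; exact: xl.
exists (exist _ l lb) => n; apply: l2norm_le => N.
by rewrite trB; exact: xl.
Qed.

Lemma ell2_complete (F : set_system T) : ProperFilter F -> cauchy F -> cvg F.
Proof.
move=> FF /cauchyP FC.
have h0 n : 0 < (2^-1 ^+ n)%:C%C :> C by rewrite ltcR exprn_gt0 ?invr_gt0.
have /choice[x xP] n : exists x : T, F (ball x (2^-1 ^+ n)%:C%C) by exact: FC.
have ballE (y z : T) (r : R) : ball y (r%:C)%C z -> l2norm (y - z) < r.
  by rewrite -ball_normE /= ell2_normE ltcR.
have [v vP] : exists v, forall n, l2norm (x n - v) <= 2^-1 ^+ n.
  apply: ell2_cauchy => n m.
  have [z [/ballE xn /ballE xm]] := filter_ex (filterI (xP n) (xP m)).
  apply: le_trans (ler_vnormB _ _ z _) _; apply: lerD; first exact: ltW.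
  by rewrite vnormB ltW.
apply/cvg_ex; exists v; apply/cvg_ballP => e e0.
have e0' : 0 < Re e by move: e0; rewrite ltcE => /andP[].
have eE : e = ((Re e)%:C)%C by apply/esym; rewrite RRe_real// gtr0_real.
have [n ne] : exists n, 2^-1 ^+ n + 2^-1 ^+ n < Re e.
  have : (fun n => 2^-1 ^+ n : R) @ \oo --> (0 : R).
    by apply: cvg_expr; rewrite ger0_norm ?invr_ge0// invf_lt1// ltr1n.
  move/cvg0P => /(_ (fun k => ltW _))/(_ _ (divr_gt0 e0' (ltr0n R 4)))[].
    by move=> k; rewrite exprn_gt0 ?invr_gt0.
  move=> K KP; exists K; have := KP K (leqnn _); lra.
apply: filterS (xP n) => z /ballE xz; rewrite -ball_normE /= ell2_normE eE ltcR.
apply: le_lt_trans ne; apply: le_trans (ler_vnormB _ _ (x n) _) _.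
by apply: lerD; [rewrite vnormB; exact: vP|exact: ltW].
Qed.

HB.instance Definition _ := Uniform_isComplete.Build T ell2_complete.

Lemma ell2_inner_norm (v : T) : l2dot v v = `|v| ^+ 2.
Proof. by rewrite (fvvE l2dot) ell2_normE rmorphXn. Qed.

Definition ell2_hilbert : hilbert R := @Hilbert R T l2dot ell2_inner_norm.

End Ell2.

Lemma ler_sqr_le (R : realType) (a b : R) : 0 <= b -> a ^+ 2 <= b ^+ 2 -> a <= b.
Proof.
move=> b0 ab; have [a0|/ltW a0] := leP 0 a; last exact: le_trans a0 b0.
by rewrite -(@ler_pXn2r _ 2).
Qed.

Lemma vnorm_proj_sqr (R : realType) (V : lmodType R[i]) (f : {dot V for Num.conj})
    (v p : V) : f v p = f p p ->
  vnorm f (v - p) ^+ 2 = vnorm f v ^+ 2 - vnorm f p ^+ 2.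
Proof.
by move=> e; rewrite vnormBE e -vnorm_sqr mulr2n opprD addrA addrK.
Qed.

Section Ell2Theory.
Context (R : realType).
Local Notation C := R[i].
Local Notation H := (ell2_hilbert R).
Local Notation nm := (vnorm (inner H)).

Lemma inner_tr_cvg (u v : H) : ccvg (fun n => coldot (tr n u) (tr n v)) (inner H u v).
Proof. exact: l2dot_ccvg. Qed.

Let emb_bound n (c : 'cV[C]_n) : exists M : R, forall m,
  cnorm (trunc m (fun k => \sum_(i < n) (k == i :> nat)%:R * c i 0)) <= M.
Proof.
exists (\sum_(i < n) cabs (c i 0)) => m.
have -> : trunc m (fun k => \sum_(i < n) (k == i :> nat)%:R * c i 0) =
    \sum_(i < n) c i 0 *: (\col_(k < m) (k == i :> nat)%:R).
  apply/colP => k; rewrite mxE summxE; apply: eq_bigr => i _.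
  by rewrite !mxE mulrC.
apply: le_trans (vnorm_sum _ _ _) _; apply: ler_sum => i _.
rewrite vnormZ -[leRHS]mulr1; apply: ler_wpM2l; first exact: cabs_ge0.
have [im|im] := ltnP i m.
  rewrite (_ : \col_k _ = delta_mx (Ordinal im) 0).
    by rewrite -/(cnorm _) cnorm_delta.
  by apply/colP => k; rewrite !mxE andbT -val_eqE.
rewrite (_ : \col_k _ = 0) ?vnorm0//.
by apply/colP => k; rewrite !mxE ltn_eqF// (leq_trans (ltn_ord k)).
Qed.

Definition emb n (c : 'cV[C]_n) : H := exist _ _ (emb_bound c).

Lemma entry_emb n (c : 'cV[C]_n) (i : 'I_n) : entry (emb c) i = c i 0.
Proof.
rewrite /= (bigD1 i)//= eqxx mul1r big1 ?addr0// => j ji.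
by rewrite val_eqE eq_sym (negPf ji) mul0r.
Qed.

Lemma entry_emb0 n (c : 'cV[C]_n) k : (n <= k)%N -> entry (emb c) k = 0.
Proof.
move=> nk; rewrite /= big1// => i _.
by rewrite gtn_eqF ?mul0r// (leq_trans (ltn_ord i)).
Qed.

Lemma emb_linear n : linear (@emb n).
Proof.
move=> a u v; apply: entry_inj => k; rewrite entryD entryZ.
have [kn|kn] := ltnP k n; last by rewrite !entry_emb0// mulr0 addr0.
by rewrite -[k]/(nat_of_ord (Ordinal kn)) !entry_emb !mxE.
Qed.

Lemma emb_incl m n (c : 'cV[C]_n) : (n <= m)%N -> emb (inclmx R m n *m c) = emb c.
Proof.
move=> nm; apply: entry_inj => k; have [km|km] := ltnP k m; last first.
  by rewrite !entry_emb0// (leq_trans nm).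
rewrite -[k in LHS]/(nat_of_ord (Ordinal km)) entry_emb mxE /=.
by apply: eq_bigr => i _; rewrite mxE.
Qed.

Lemma tr_emb n (c : 'cV[C]_n) : tr n (emb c) = c.
Proof. by apply/colP => i; rewrite mxE entry_emb. Qed.

Lemma coldot_tr_emb m n (v : H) (c : 'cV[C]_n) : (n <= m)%N ->
  coldot (tr m v) (tr m (emb c)) = coldot (tr n v) c.
Proof.
move=> nm; rewrite /coldot.
pose F k := entry v k * (entry (emb c) k)^*.
transitivity (\sum_(0 <= k < m) F k).
  by rewrite big_mkord; apply: eq_bigr => i _; rewrite !mxE.
rewrite (@big_cat_nat _ _ _ n)//= [X in _ + X]big_nat_cond [X in _ + X]big1 ?addr0.
  by rewrite big_mkord; apply: eq_bigr => i _; rewrite /F !mxE entry_emb.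
by move=> k /andP[/andP[nk _] _]; rewrite /F entry_emb0// rmorph0 mulr0.
Qed.

Lemma inner_emb n (v : H) (c : 'cV[C]_n) : inner H v (emb c) = coldot (tr n v) c.
Proof.
apply: (ccvg_unique (inner_tr_cvg v (emb c))).
by split; apply: cvg_near_cst; exists n => // m /= nm; rewrite coldot_tr_emb.
Qed.

Lemma nm_emb n (c : 'cV[C]_n) : nm (emb c) = cnorm c.
Proof.
by apply: vnorm_eq; rewrite ?cnorm_ge0// inner_emb tr_emb (fvvE (@coldot C n)).
Qed.

Lemma tail_sqr n (v : H) : nm (v - emb (tr n v)) ^+ 2 = nm v ^+ 2 - cnorm (tr n v) ^+ 2.
Proof.
rewrite -(nm_emb (tr n v)); apply: (@vnorm_proj_sqr R H (inner H)).
by apply: etrans (inner_emb v _) _; apply: esym; rewrite inner_emb tr_emb.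
Qed.

Lemma tail_small (v : H) e : 0 < e -> exists K, forall k, (K <= k)%N ->
  nm (v - emb (tr k v)) <= e.
Proof.
move=> e0; have : (fun n => nm v ^+ 2 - cnorm (tr n v) ^+ 2) @ \oo --> (0 : R).
  rewrite -(subrr (nm v ^+ 2)); apply: cvgB; first exact: cvg_cst.
  exact: (@l2norm_sqr_cvg R v).
move/cvg0P => /(_ _)/(_ (e ^+ 2) (exprn_gt0 _ e0))[n|K KP].
  by rewrite -tail_sqr sqr_ge0.
exists K => k /KP; rewrite -tail_sqr; apply: ler_sqr_le; exact: ltW.
Qed.

Lemma cnorm_tr_mono m n (v : H) : (m <= n)%N -> cnorm (tr m v) <= cnorm (tr n v).
Proof.
move=> mn; apply: ler_sqr_le; first exact: cnorm_ge0.
exact: (@cnorm_tr_nd R v _ _ mn).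
Qed.

End Ell2Theory.

(** * The limit representation *)

Section VectorLimits.
Context (R : realType) (H : hilbert R).
Local Notation C := R[i].
Local Notation nm := (vnorm (inner H)).

Lemma hilbert_normE (v : H) : `|v| = ((nm v)%:C)%C.
Proof.
have := inner_norm v; rewrite (fvvE (inner H)) rmorphXn /= => /eqP.
by rewrite eqrXn2// ?lecR ?vnorm_ge0// => /eqP.
Qed.

(** Norm convergence with real epsilons; the norm of [H] as a normed module takes its values in the
    complex numbers. *)
Definition vcvg (x : nat -> H) (l : H) : Prop :=
  forall e : R, 0 < e -> exists N, forall n, (N <= n)%N -> nm (x n - l) <= e.

Lemma vcvgP x l : vcvg x l <-> x @ \oo --> l.
Proof.
split=> [xl|/cvgrPdist_le xl e e0].
  apply/cvgrPdist_le => e e0.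
  have e0' : 0 < complex.Re e by move: e0; rewrite ltcE => /andP[].
  have eE : e = ((complex.Re e)%:C)%C by apply/esym; rewrite RRe_real// gtr0_real.
  have [N NP] := xl _ e0'; exists N => // n /NP.
  by rewrite eE hilbert_normE lecR vnormB.
have [|N _ NP] := xl (e%:C)%C; first by rewrite ltcR.
by exists N => n /NP; rewrite hilbert_normE lecR vnormB.
Qed.

Lemma vcvg_unique x l l' : vcvg x l -> vcvg x l' -> l = l'.
Proof.
by move=> /vcvgP xl /vcvgP xl'; rewrite -(cvg_lim _ xl)// -(cvg_lim _ xl').
Qed.

Lemma vcvg_cst l : vcvg (fun=> l) l.
Proof. by move=> e e0; exists 0%N => n _; rewrite subrr vnorm0 ltW. Qed.

Lemma vcvg_lin (a : C) x y l m : vcvg x l -> vcvg y m ->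
  vcvg (fun n => a *: x n + y n) (a *: l + m).
Proof.
move=> /vcvgP xl /vcvgP ym; apply/vcvgP; apply: cvgD => //.
by apply: cvgZr.
Qed.

Lemma vcvg_le x l M : vcvg x l -> (exists N, forall n, (N <= n)%N -> nm (x n) <= M) ->
  nm l <= M.
Proof.
move=> xl [K KP]; apply/ler_addgt0Pr => e e0; have [N NP] := xl e e0.
have := NP _ (leq_maxr K N); have := KP _ (leq_maxl K N); set n := maxn K N => h1 h2.
rewrite -[l](subKr (x n)) (le_trans (ler_vnormD _ _ _))// vnormN.
exact: lerD.
Qed.

Lemma vcvg_cauchy x : (forall e : R, 0 < e -> exists N, forall m n,
    (N <= m)%N -> (N <= n)%N -> nm (x m - x n) <= e) ->
  exists l, vcvg x l.
Proof.
move=> xC; have : cauchy (x @ \oo).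
  apply: cauchy_exP => e e0.
  have e0' : 0 < complex.Re e by move: e0; rewrite ltcE => /andP[].
  have eE : e = ((complex.Re e)%:C)%C by apply/esym; rewrite RRe_real// gtr0_real.
  have [N NP] := xC _ (divr_gt0 e0' (ltr0n R 2)).
  exists (x N); exists N => // n Nn /=; rewrite -ball_normE /= eE hilbert_normE ltcR.
  by rewrite (le_lt_trans (NP N n _ _))// ltr_pdivrMr// ltr_pMr// ltr1n.
by move=> /cauchy_cvg /cvg_ex[l xl]; exists l; apply/vcvgP.
Qed.

Definition mklinear (f : H -> H) (lf : linear f) : {linear H -> H} :=
  HB.pack f (GRing.isLinear.Build _ _ _ _ f lf).

(** Uniform boundedness reduces strong convergence to vectors u close to v on which the operators
    are eventually Cauchy up to e. *)
Lemma operator_limit (T : nat -> H -> H) (M : R) : 0 <= M ->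
  (forall n, linear (T n)) -> (forall n v, nm (T n v) <= M * nm v) ->
  (forall v (e : R), 0 < e -> exists u, nm (v - u) <= e /\ exists N, forall m n,
    (N <= m)%N -> (N <= n)%N -> nm (T m u - T n u) <= e) ->
  exists L : {linear H -> H}, forall v, vcvg (fun n => T n v) (L v).
Proof.
move=> M0 lT TM dense.
have /choice[L LP] v : exists l, vcvg (fun n => T n v) l.
  apply: vcvg_cauchy => e e0.
  (* The error e is shared between two terms of size M times the distance of v to u and one Cauchy
     term. *)
  have M1 : 0 < 2 * M + 1 by rewrite ltr_wpDl// mulr_ge0.
  have [u [vu [N NP]]] := dense v _ (divr_gt0 e0 M1); exists N => m n Nm Nn.
  have TB k a b : T k (a - b) = T k a - T k b.
    by rewrite -scaleN1r addrC lT scaleN1r addrC.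
  have Tvu k : nm (T k (v - u)) <= M * (e / (2 * M + 1)).
    by rewrite (le_trans (TM _ _))// ler_wpM2l.
  have -> : T m v - T n v = T m (v - u) + (T m u - T n u) - T n (v - u).
    by rewrite !TB subrKA opprB subrKA.
  rewrite (le_trans (ler_vnormD _ _ _))// vnormN.
  apply: (@le_trans _ _ (M * (e / (2 * M + 1)) + e / (2 * M + 1) + M * (e / (2 * M + 1)))).
    by rewrite lerD// (le_trans (ler_vnormD _ _ _))// lerD// NP.
  by rewrite le_eqVlt; apply/orP; left; apply/eqP; field; rewrite gt_eqF.
have lL : linear L.
  move=> a u v; apply: vcvg_unique (LP _) _.
  have := vcvg_lin a (LP u) (LP v).
  by rewrite (_ : (fun n => _) = (fun n => T n (a *: u + v)))//; apply/funext => n; rewrite lT.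
by exists (mklinear lL).
Qed.

End VectorLimits.

(** A Hilbert space with an orthonormal basis indexed by the natural numbers, seen through its
    finite sections. The limit representation uses only this interface, of which [ell2_coords] is
    the model. *)
Record coord_system (R : realType) (H : hilbert R) := CoordSystem {
  cemb : forall n, 'cV[R[i]]_n -> H;
  ctr : forall n, H -> 'cV[R[i]]_n;
  cemb_linear : forall n, linear (@cemb n);
  ctr_linear : forall n, linear (ctr n);
  ctr_cemb : forall n c, ctr n (@cemb n c) = c;
  inner_cemb : forall n v c, inner H v (@cemb n c) = coldot (ctr n v) c;
  cemb_incl : forall m n (c : 'cV_n), (n <= m)%N -> cemb (inclmx R m n *m c) = cemb c;
  ctr_mono : forall m n v, (m <= n)%N -> cnorm (ctr m v) <= cnorm (ctr n v);
  ctr_tail : forall v (e : R), 0 < e -> exists K, forall k, (K <= k)%N ->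
    vnorm (inner H) (v - cemb (ctr k v)) <= e
}.

Definition ell2_coords (R : realType) : coord_system (ell2_hilbert R) :=
  @CoordSystem R (ell2_hilbert R) (@emb R) (@tr R) (@emb_linear R) (@tr_linear R)
    (@tr_emb R) (@inner_emb R) (@emb_incl R) (@cnorm_tr_mono R) (@tail_small R).

Section Coordinates.
Context (R : realType) (H : hilbert R) (cs : coord_system H).
Local Notation C := R[i].
Local Notation nm := (vnorm (inner H)).
Local Notation emb := (cemb cs).
Local Notation tr := (ctr cs).

HB.instance Definition _ n := GRing.isLinear.Build C 'cV[C]_n H *:%R (@cemb _ _ cs n) (@cemb_linear _ _ cs n).
HB.instance Definition _ n := GRing.isLinear.Build C H 'cV[C]_n *:%R (ctr cs n) (@ctr_linear _ _ cs n).

Lemma nm_cemb n (c : 'cV[C]_n) : nm (emb c) = cnorm c.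
Proof.
apply: vnorm_eq; rewrite ?cnorm_ge0// inner_cemb ctr_cemb.
exact: (fvvE (@coldot C n)).
Qed.

Lemma ctail_sqr n v : nm (v - emb (tr n v)) ^+ 2 = nm v ^+ 2 - cnorm (tr n v) ^+ 2.
Proof.
by rewrite -(nm_cemb (tr n v)); apply: vnorm_proj_sqr; rewrite !inner_cemb ctr_cemb.
Qed.

Lemma ctail_le n v : nm (v - emb (tr n v)) <= nm v.
Proof.
apply: ler_sqr_le; first exact: vnorm_ge0.
by rewrite ctail_sqr gerBl sqr_ge0.
Qed.

Lemma ctr_le n v : cnorm (tr n v) <= nm v.
Proof.
apply: ler_sqr_le; first exact: vnorm_ge0.
by rewrite -subr_ge0 -ctail_sqr sqr_ge0.
Qed.

End Coordinates.

Section ChainRepresentation.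
Context (R : realType) (G : groupType) (H : hilbert R) (cs : coord_system H).
Local Notation C := R[i].
Local Notation nm := (vnorm (inner H)).
Local Notation emb := (cemb cs).
Local Notation tr := (ctr cs).
Context (gamma : nat -> G) (gammaP : forall g, exists i, gamma i = g).
Context (d : nat -> nat) (s : forall n, G -> 'M[C]_(d n)) (B : nat -> seq G) (e : nat -> R).
Hypotheses (dS : forall n, (d n < d n.+1)%N)
  (e1 : forall n, e n <= 2^-1 ^+ n)
  (WB : forall n g, g \in window gamma n -> g \in B n)
  (sB : forall n, approx_rep (B n) (e n) (s n))
  (sI : forall n g, g \in window gamma n ->
      mxbound (s n.+1 g *m inclmx R (d n.+1) (d n) - inclmx R (d n.+1) (d n) *m s n g)
        (3 * 2^-1 ^+ n)).

Let su n g : (s n g) ^t* *m s n g = 1%:M. Proof. exact: (proj1 (sB n)). Qed.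

Lemma window_eventually g : exists K, forall n, (K <= n)%N -> g \in window gamma n.
Proof.
have [i <-] := gammaP g; exists i => n ni; apply: map_f.
by rewrite mem_iota add0n ltnS.
Qed.

Lemma window_mono m n g : (m <= n)%N -> g \in window gamma m -> g \in window gamma n.
Proof.
rewrite /window => mn gm; have [k] := seq.mapP gm; rewrite mem_iota add0n => /andP[_ im] ->.
by apply: map_f; rewrite mem_iota add0n (leq_trans im).
Qed.

Lemma d_mono : {homo d : m n / (m <= n)%N}.
Proof. by apply: homo_leq => [//||n]; [exact: leq_trans|exact: ltnW]. Qed.

Lemma d_ge n : (n <= d n)%N.
Proof. by elim: n => // n IHn; exact: leq_ltn_trans IHn (dS n). Qed.

(** It vanishes off the first [d n] coordinates, so it is a contraction; unitarity appears only in
    the limit. *)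
Definition stage n g (v : H) : H := emb (s n g *m tr (d n) v).

Lemma stage_linear n g : linear (stage n g).
Proof. by move=> a u v; rewrite /stage linearP mulmxDr -scalemxAr linearP. Qed.

Lemma stage_le n g v : nm (stage n g v) <= nm v.
Proof. by rewrite nm_cemb cnorm_isom// ctr_le. Qed.

Lemma stage_emb n g c : stage n g (emb c) = emb (s n g *m c).
Proof. by rewrite /stage ctr_cemb. Qed.

(** Makes the step errors telescope; this is the origin of the constant 6. *)
Lemma half_sum n : 3 * 2^-1 ^+ n = 6 * (2^-1 ^+ n - 2^-1 ^+ n.+1) :> R.
Proof. by rewrite exprS; field. Qed.

Lemma stage_dist m n g (c : 'cV[C]_(d m)) : (m <= n)%N -> g \in window gamma m ->
  nm (stage n g (emb c) - stage m g (emb c)) <= 6 * (2^-1 ^+ m - 2^-1 ^+ n) * cnorm c.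
Proof.
move=> mn gm; rewrite -(subnKC mn); elim: (n - m)%N => [|k IHk].
  by rewrite addn0 !subrr vnorm0 mulr0 mul0r.
rewrite addnS; set j := (m + k)%N in IHk *.
apply: le_trans (ler_vnormB _ _ (stage j g (emb c)) _) _.
have -> : 6 * (2^-1 ^+ m - 2^-1 ^+ j.+1) * cnorm c =
   3 * 2^-1 ^+ j * cnorm c + 6 * (2^-1 ^+ m - 2^-1 ^+ j) * cnorm c.
  rewrite half_sum; move: (2^-1 ^+ m) (2^-1 ^+ j) (2^-1 ^+ j.+1) (cnorm c) => x y z w.
  by clear; ring.
apply: lerD => //.
have mj : (m <= j)%N by exact: leq_addr.
rewrite -(cemb_incl cs c (d_mono mj)); set c' := inclmx _ _ _ *m c.
have c'c : cnorm c' = cnorm c by rewrite -(nm_cemb cs) cemb_incl ?nm_cemb// d_mono.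
rewrite (@stage_emb j) -{1}(cemb_incl cs c' (d_mono (leqnSn j))) stage_emb.
rewrite -(cemb_incl cs (s j g *m c') (d_mono (leqnSn j))) -linearB nm_cemb -c'c.
clearbody c'; rewrite (mulmxA (s _ _)) (mulmxA (inclmx _ _ _)) -mulmxBl; apply: sI; exact: window_mono gm.
Qed.

Lemma half_gt0 n : 0 < 2^-1 ^+ n :> R.
Proof. by rewrite exprn_gt0 ?invr_gt0. Qed.

Lemma half_small (r : R) : 0 < r -> exists N, forall n, (N <= n)%N -> 2^-1 ^+ n <= r.
Proof.
move=> r0; have : (fun n => 2^-1 ^+ n : R) @ \oo --> (0 : R).
  by apply: cvg_expr; rewrite ger0_norm ?invr_ge0// invf_lt1// ltr1n.
by move/cvg0P; apply => // k; exact: ltW (half_gt0 k).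
Qed.

(** The stages are contractions and, by [stage_dist], Cauchy on every finite section; the sections
    are dense. *)
Lemma chain_limits : exists U : G -> {linear H -> H},
  (forall g v, vcvg (fun n => stage n g v) (U g v)) /\
  forall g n (c : 'cV[C]_(d n)), g \in window gamma n ->
    nm (U g (emb c) - emb (s n g *m c)) <= 6 * 2^-1 ^+ n * cnorm c.
Proof.
have /choice[U UP] g : exists L : {linear H -> H}, forall v, vcvg (fun n => stage n g v) (L v).
  apply: (@operator_limit _ _ _ 1) => //.
  - by move=> n; exact: stage_linear.
  - by move=> n v; rewrite mul1r stage_le.
  - move=> v r r0; have [K KP] := ctr_tail cs v r0.
    have [L LP] := window_eventually g.
    have c0 : 0 <= nm v by exact: vnorm_ge0.
    (* With this choice 6 * 2^-m times the norm of v is at most r / 2, and two stages are compared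
       through stage m. *)
    have [M MP] := @half_small (r / (12 * (nm v + 1))) ltac:(by rewrite divr_gt0// mulr_gt0// ltr_wpDl).
    pose m := maxn K (maxn L M).
    have [Km Lm Mm] : [/\ K <= m, L <= m & M <= m]%N by rewrite /m; split; lia.
    exists (emb (tr (d m) v)); split; first by apply: KP; exact: leq_trans (d_ge m).
    exists m => p q mp mq.
    have hq n : (m <= n)%N -> nm (stage n g (emb (tr (d m) v)) - stage m g (emb (tr (d m) v))) <= r / 2.
      move=> mn; apply: le_trans (stage_dist _ mn (LP _ Lm)) _.
      apply: (@le_trans _ _ (6 * (r / (12 * (nm v + 1))) * (nm v + 1))).
        apply: ler_pM; rewrite ?cnorm_ge0//.
        - rewrite mulr_ge0// subr_ge0 -(subnKC mn) exprD ler_piMr ?(ltW (half_gt0 _))//.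
          by rewrite exprn_ile1 ?invr_ge0// invf_le1// ler1n.
        - rewrite ler_wpM2l// lerBlDr (le_trans (MP _ Mm))// lerDl.
          exact: ltW (half_gt0 n).
        - by rewrite (le_trans (ctr_le _ _ _))// lerDl.
      rewrite le_eqVlt; apply/orP; left; apply/eqP; field.
      by rewrite gt_eqF// ltr_wpDl.
    rewrite [r]splitr; apply: le_trans (ler_vnormB _ _ (stage m g (emb (tr (d m) v))) _) _.
    by apply: lerD; rewrite ?hq// vnormB hq.
exists U; split=> // g n c gn; apply: vcvg_le.
  have := vcvg_lin 1 (UP g (emb c)) (vcvg_cst (- emb (s n g *m c))); rewrite scale1r; exact.
exists n => k nk; rewrite scale1r -stage_emb; apply: le_trans (stage_dist _ nk gn) _.
rewrite ler_wpM2r ?cnorm_ge0// ler_wpM2l// gerBl; exact: ltW (half_gt0 k).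
Qed.

(** Approximate multiplicativity becomes exact in the strong limit, and norms are preserved because
    s n g is isometric on sections that exhaust H. *)
Lemma chain_rep : exists U : unitary_rep G H, forall g n (c : 'cV[C]_(d n)),
  g \in window gamma n -> nm (U g (emb c) - emb (s n g *m c)) <= 6 * 2^-1 ^+ n * cnorm c.
Proof.
have [U [Ulim Uemb]] := chain_limits.
have vgood v (r : R) : 0 < r -> exists N, forall n, (N <= n)%N -> 2^-1 ^+ n * nm v <= r.
  move=> r0; have v1 : 0 < nm v + 1 by rewrite ltr_wpDl ?vnorm_ge0.
  have [N NP] := half_small (divr_gt0 r0 v1); exists N => n /NP nr.
  apply: (@le_trans _ _ (r / (nm v + 1) * (nm v + 1))); last by rewrite divfK ?gt_eqF.
  by rewrite ler_pM ?vnorm_ge0// ?(ltW (half_gt0 n))// lerDl.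
have appr n g h v : g \in window gamma n -> h \in window gamma n ->
    nm (stage n (g * h)%g v - stage n g (stage n h v)) <= 2^-1 ^+ n * nm v.
  move=> gn hn; rewrite vnormB {2}/stage stage_emb -linearB mulmxA -mulmxBl nm_cemb.
  apply: le_trans (proj2 (sB n) g h (WB gn) (WB hn) _) _.
  have e0 : 0 <= 2^-1 ^+ n :> R by exact: ltW (half_gt0 n).
  apply: (@le_trans _ _ (2^-1 ^+ n * cnorm (tr (d n) v))).
    by rewrite ler_wpM2r ?cnorm_ge0.
  by rewrite ler_wpM2l ?ctr_le.
have U1 v : U 1%g v = v.
  apply: vcvg_unique (Ulim 1%g v) _ => r r0.
  have r2 : 0 < r / 2 by rewrite divr_gt0.
  have [N NP] := vgood v _ r2; have [K KP] := ctr_tail cs v r2.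
  have [L LP] := window_eventually 1%g.
  exists (maxn N (maxn K L)) => n; rewrite !geq_max => /and3P[Nn Kn Ln].
  rewrite [r]splitr; apply: le_trans (ler_vnormB _ _ (emb (tr (d n) v)) _) _.
  apply: lerD; last by rewrite vnormB; apply: KP; exact: leq_trans (d_ge n).
  (* Since s n 1 is isometric, its distance to the identity at y equals that of s(1) s(1) y to s(1)
     y, which is a multiplicativity defect. *)
  apply: le_trans (NP _ Nn); apply: le_trans (appr n 1%g 1%g v (LP _ Ln) (LP _ Ln)).
  rewrite mulg1 /stage ctr_cemb -!(linearB (emb (n := d n))) !nm_cemb.
  rewrite -mulmxBr cnorm_isom// le_eqVlt; apply/orP; left; apply/eqP; exact: vnormB.
have UM g h v : U (g * h)%g v = U g (U h v).
  apply: vcvg_unique (Ulim (g * h)%g v) _ => r r0.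
  have r3 : 0 < r / 3 by rewrite divr_gt0.
  have [N NP] := vgood v _ r3; have [K KP] := Ulim h v _ r3.
  have [L LP] := Ulim g (U h v) _ r3.
  have [M MP] := window_eventually g; have [M' MP'] := window_eventually h.
  exists (maxn (maxn N K) (maxn L (maxn M M'))) => n.
  rewrite !geq_max => /andP[/andP[Nn Kn] /and3P[Ln Mn Mn']].
  rewrite (_ : r = r / 3 + r / 3 + r / 3); last by field.
  apply: le_trans (ler_vnormB _ _ (stage n g (U h v)) _) _; apply: lerD; last exact: LP.
  apply: le_trans (ler_vnormB _ _ (stage n g (stage n h v)) _) _; apply: lerD.
    by apply: le_trans (NP _ Nn); apply: appr; [exact: MP|exact: MP'].
  rewrite -[stage n g (U h v)]scale1r -scaleN1r scale1r addrC -stage_linear scaleN1r addrC.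
  by apply: le_trans (stage_le _ _ _) _; exact: KP.
have Un g v : nm (U g v) = nm v.
  apply/eqP; rewrite eq_le; apply/andP; split.
    by apply: vcvg_le (Ulim g v) _; exists 0%N => n _; exact: stage_le.
  apply/ler_addgt0Pr => r r0; have r2 : 0 < r / 2 by rewrite divr_gt0.
  have [N NP] := Ulim g v _ r2; have [K KP] := ctr_tail cs v r2.
  pose n := maxn N K; have [Nn Kn] : (N <= n /\ K <= n)%N by rewrite /n; split; lia.
  have h1 := KP _ (leq_trans Kn (d_ge n)); have h2 := NP _ Nn.
  have h3 : nm v <= nm (v - emb (tr (d n) v)) + nm (emb (tr (d n) v)) by exact: ler_vnorm_dist.
  have h4 : nm (stage n g v) <= nm (stage n g v - U g v) + nm (U g v) by exact: ler_vnorm_dist.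
  have h5 : nm (emb (tr (d n) v)) = nm (stage n g v) by rewrite !nm_cemb cnorm_isom.
  move: h1 h2 h3 h4 h5; clear.
  by move: (nm _) (nm _) (nm _) (nm _) (nm _) (nm _) => x1 x2 x3 x4 x5 x6; lra.
have Ui g v w : inner H (U g v) (U g w) = inner H v w.
  by apply: (isometry_dot (f := inner H) (g := inner H)) => [a x y|x]; rewrite ?linearP.
by exists (UnitaryRep U1 UM Ui).
Qed.

End ChainRepresentation.

Section IntegratedTheory.
Context (R : realType) (G : groupType) (H : hilbert R) (U : unitary_rep G H).
Local Notation C := R[i].
Local Notation nm := (vnorm (inner H)).
Implicit Types x y : grpalg C G.

Lemma integratedE x v : integrated U x v = \sum_(g <- gsupp x) x g *: U g v.
Proof. by apply: fsbigTE => g /gsuppP ->; rewrite scale0r. Qed.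

Lemma integrated_linear x : linear (integrated U x).
Proof.
move=> a u v; rewrite !integratedE scaler_sumr -big_split; apply: eq_bigr => g _ /=.
by rewrite linearP scalerDr !scalerA mulrC.
Qed.

Lemma integrated0 v : integrated U (0 : grpalg C G) v = 0.
Proof. by rewrite -(subrr (0 : grpalg C G)) integratedB subrr. Qed.

Lemma integratedD x y v : integrated U (x + y) v = integrated U x v + integrated U y v.
Proof. by rewrite -[y in LHS]opprK integratedB -[- y]sub0r integratedB integrated0 sub0r opprK. Qed.

Lemma integrated_gdelta g v : integrated U (gdelta C g) v = U g v.
Proof.
rewrite /integrated (fsbigTE [fset g]%fset) ?big_seq_fset1 /= ?eqxx ?scale1r//.
by move=> t; rewrite inE => /negPf ->; rewrite scale0r.
Qed.

Lemma urep_adj g v w : inner H (U g v) w = inner H v (U g^-1%g w).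
Proof. by rewrite -(urep_inner U g v) -urepM mulgV urep1. Qed.

Lemma urep_nm g v : nm (U g v) = nm v.
Proof. by rewrite /vnorm urep_inner. Qed.

End IntegratedTheory.

(** * Weak containment of every representation in the limit *)

Section WeakContainment.
Context (R : realType) (G : groupType).
Local Notation C := R[i].
Context (gs A F : seq G) (a : G -> R) (e0 : R).
Hypotheses (e00 : 0 <= e0) (ra : reiter_vector gs e0 A a) (tF : translates_in gs A F).
Context (D : nat) (s : G -> 'M[C]_D) (f : G -> 'cV[C]_D) (e : R).
Hypothesis sh : shift_system F e s f.
Context (K : hilbert R) (W : unitary_rep G K) (x : grpalg C G).
Hypothesis xgs : forall g, g \in gsupp x -> g \in gs.
Local Notation nm := (vnorm (inner K)).

Lemma tensmx_suml (I : Type) (r : seq I) m n p q (b : I -> C) (S : I -> 'M[C]_(m, n))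
    (T : 'M[C]_(p, q)) :
  (\sum_(i <- r) b i *: S i) *t T = \sum_(i <- r) b i *: (S i *t T).
Proof.
apply/matrixP => i j; rewrite !(mxE, summxE) mulr_suml; apply: eq_bigr => k _.
by rewrite !mxE mulrA.
Qed.

Lemma spread_linear m b (w w' : G -> 'cV[C]_m) :
  spread A a f (fun h => b *: w h + w' h) = b *: spread A a f w + spread A a f w'.
Proof.
rewrite /spread scaler_sumr -big_split; apply: eq_bigr => h _ /=.
rewrite -(@tensv_linear R _ _ (f h)); congr tensv.
by rewrite scalerDr !scalerA mulrC.
Qed.

Lemma spread_sum m (I : Type) (r : seq I) (b : I -> C) (w : I -> G -> 'cV[C]_m) :
  spread A a f (fun h => \sum_(i <- r) b i *: w i h) = \sum_(i <- r) b i *: spread A a f (w i).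
Proof.
elim: r => [|i r IH].
  rewrite big_nil /spread big1// => h _.
  by rewrite big_nil scaler0; apply/matrixP => ? ?; rewrite !mxE mulr0.
rewrite big_cons -IH -spread_linear /spread; apply: eq_bigr => h _.
by rewrite big_cons.
Qed.

(* The same absorption estimate for an exact representation W: the vector
   [spread w], with [w h] the coordinates of W(h)^-1 v, is moved by [s g (x) 1]
   as v is moved by W(g). *)
Lemma rep_norm_shift (M : R) v : 0 <= M ->
  mxbound (\sum_(g <- gsupp x) x g *: s g) M ->
  nm (integrated W x v) <=
    (M + (\sum_(g <- gsupp x) cabs (x g)) * ((size A)%:R * e + e0)) * nm v.
Proof.
move=> M0 sM; pose y := integrated W x v.
(* K may have any dimension, but only finitely many vectors W(h)^-1 v and W(h)^-1 y occur;
   coordinates are taken in a basis of a space containing them. *)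
have [b [bon bP _]] := gram_schmidt (f := inner K) (e := [::]) (fun i j => False_ind _ \o notF)
  ([seq W h^-1%g v | h <- A] ++ [seq W h^-1%g y | h <- A]).
have nb u : synth (coord (inner K) b u) = u -> cnorm (coord (inner K) b u) = nm u.
  by move=> {2}<-; rewrite (vnorm_synth bon).
pose w u h := coord (inner K) b (W h^-1%g u).
have wN u : (forall h, h \in A -> synth (coord (inner K) b (W h^-1%g u)) = W h^-1%g u) ->
    cnorm (spread A a f (w u)) = nm u.
  move=> hu; apply: (cnorm_spread ra tF sh); last exact: vnorm_ge0.
  by move=> h hA; rewrite /w nb ?urep_nm//; exact: hu.
have vN := wN v _; have yN := wN y _.
rewrite -[nm (integrated W x v)]yN; last first.
  by move=> h hA; apply: bP; rewrite mem_cat (map_f (fun h => W h^-1%g y)) ?orbT.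
have -> : w y = fun h => \sum_(g <- gsupp x) x g *: w (W g v) h.
  apply/funext => h; rewrite /w /y integratedE linear_sum.
  pose L : {linear _ -> _} := HB.pack (coord (inner K) b)
     (GRing.isLinear.Build _ _ _ _ _ (coord_linear (inner K) b)).
  rewrite -[LHS]/(L _) linear_sum; apply: eq_bigr => g _.
  by rewrite linearZ linearZ.
rewrite spread_sum.
set Y := spread A a f (w v).
have -> : \sum_(g <- gsupp x) x g *: spread A a f (w (W g v)) =
  ((\sum_(g <- gsupp x) x g *: s g) *t 1%:M) *m Y -
   \sum_(g <- gsupp x) x g *: ((s g *t 1%:M) *m Y - spread A a f (w (W g v))).
  rewrite tensmx_suml mulmx_suml -sumrB; apply: eq_bigr => g _.
  by rewrite scalerBr -scalemxAl opprB addrCA subrr addr0.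
rewrite (le_trans (ler_vnormD _ _ _))// vnormN mulrDl; apply: lerD.
  rewrite -[nm v]vN; last by move=> h hA; apply: bP; rewrite mem_cat (map_f (fun h => W h^-1%g v)).
  exact: mxbound_tens1r.
rewrite -mulrA mulr_suml (le_trans (vnorm_sum _ _ _))// big_seq [leRHS]big_seq.
apply: ler_sum => g gx; rewrite vnormZ ler_wpM2l ?cabs_ge0//.
(* W is exactly multiplicative, so W(gh)^-1 W(g) v = W(h)^-1 v and the middle error of
   [spread_shift] is 0. *)
rewrite mulrDl -[_ * e * _]addr0; apply: (spread_shift e00 ra tF sh) => //.
- exact: xgs.
- exact: vnorm_ge0.
- by move=> h _; rewrite (le_trans (cnorm_coord bon _))// urep_nm.
- by move=> h; rewrite (le_trans (cnorm_coord bon _))// !urep_nm.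
move=> h _; rewrite /w -urepM invgM -mulgA mulVg mulg1 subrr.
by rewrite /cnorm vnorm0.
Qed.

End WeakContainment.

Section ChainNorm.
Context (R : realType) (G : groupType) (H : hilbert R) (cs : coord_system H).
Local Notation C := R[i].
Local Notation nm := (vnorm (inner H)).
Local Notation emb := (cemb cs).
Context (gamma : nat -> G) (gammaP : forall g, exists i, gamma i = g).
Context (d : nat -> nat) (s : forall n, G -> 'M[C]_(d n)).
Context (U : unitary_rep G H) (Us : forall g n (c : 'cV[C]_(d n)), g \in window gamma n ->
  nm (U g (emb c) - emb (s n g *m c)) <= 6 * 2^-1 ^+ n * cnorm c).
Context (A B : nat -> seq G) (a : nat -> G -> R) (e : nat -> R).
Hypotheses (eP : forall n, 0 <= e n /\ (size (A n))%:R * e n + e n <= 2^-1 ^+ n)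
  (rP : forall n, reiter_vector (window gamma n) (2^-1 ^+ n) (A n) (a n) /\
      translates_in (window gamma n) (A n) (B n))
  (sP : forall n, exists f, shift_system (B n) (e n) (s n) f).

Lemma windows_eventually (l : seq G) :
  exists K, forall n, (K <= n)%N -> forall g, g \in l -> g \in window gamma n.
Proof. by apply: eventually_all => g _; exact: window_eventually. Qed.

(** On section n the operator U(x) differs from the matrix of x by at most 6 S 2^-n, and absorbing
    an arbitrary W costs S 2^-n for the orbit and S 2^-n for the Reiter vector; hence the 8. Then n
    tends to infinity. *)
Lemma chain_univ_norm (x : grpalg C G) (M : R) : 0 <= M ->
  (forall v, nm (integrated U x v) <= M * nm v) -> univ_norm x <= M.
Proof.
move=> M0 xM; apply: univ_norm_le => // K W; apply: opnorm_le => // v.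
pose S := \sum_(g <- gsupp x) cabs (x g).
have S0 : 0 <= S by apply: sumr_ge0 => g _; exact: cabs_ge0.
have [N NP] := windows_eventually (gsupp x).
have step n : (N <= n)%N ->
    vnorm (inner K) (integrated W x v) <= (M + 8 * S * 2^-1 ^+ n) * vnorm (inner K) v.
  move=> Nn; have [r t] := rP n; have [f sf] := sP n; have [e0 en] := eP n.
  have h0 : 0 <= 2^-1 ^+ n :> R by exact: ltW (half_gt0 R n).
  have sM : mxbound (\sum_(g <- gsupp x) x g *: s n g) (M + 6 * S * 2^-1 ^+ n).
    move=> c; rewrite -(nm_cemb cs).
    have -> : emb ((\sum_(g <- gsupp x) x g *: s n g) *m c) = integrated U x (emb c) -
        \sum_(g <- gsupp x) x g *: (U g (emb c) - emb (s n g *m c)).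
      rewrite integratedE mulmx_suml linear_sum -sumrB; apply: eq_bigr => g _.
      by rewrite scalerBr subKr -scalemxAl linearZ.
    rewrite (le_trans (ler_vnormD _ _ _))// vnormN mulrDl -(nm_cemb cs); apply: lerD => //.
    rewrite nm_cemb (le_trans (vnorm_sum _ _ _))//.
    have -> : 6 * S * 2^-1 ^+ n * cnorm c =
      \sum_(g <- gsupp x) cabs (x g) * (6 * 2^-1 ^+ n * cnorm c).
      rewrite -mulr_suml -/S; move: (2^-1 ^+ n) (cnorm c) => u w; clear; ring.
    rewrite big_seq [leRHS]big_seq; apply: ler_sum => g gx.
    by rewrite vnormZ ler_wpM2l ?cabs_ge0// Us// NP.
  have M6 : 0 <= M + 6 * S * 2^-1 ^+ n by rewrite addr_ge0// mulr_ge0// mulr_ge0.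
  apply: le_trans (rep_norm_shift h0 r t sf W (x := x) _ v M6 sM) _; first by move=> g; exact: NP.
  rewrite ler_wpM2r ?vnorm_ge0//.
  have : (size (A n))%:R * e n <= 2^-1 ^+ n by apply: le_trans en; rewrite lerDl.
  rewrite -/S -addrA lerD2l; move: (2^-1 ^+ n) (_ * e n) => u w uw; clear - uw S0.
  have : S * (w + u) <= S * (u + u) by rewrite ler_wpM2l// lerD2r.
  by move=> h; apply: (le_trans (lerD (lexx _) h)); rewrite le_eqVlt; apply/orP; left; apply/eqP; ring.
apply/ler_addgt0Pr => r r0; have q0 : 0 < 8 * S * vnorm (inner K) v + 1.
  by rewrite ltr_wpDl// mulr_ge0 ?vnorm_ge0// mulr_ge0.
have [L LP] := half_small (divr_gt0 r0 q0).
apply: le_trans (step _ (leq_maxl N L)) _; rewrite mulrDl lerD2l mulrAC.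
have := LP _ (leq_maxr N L); have := half_gt0 R (maxn N L); move: (2^-1 ^+ _) => u u0.
rewrite ler_pdivlMr// mulrDr mulr1 => h; apply: le_trans h; rewrite mulrC lerDl.
exact: ltW.
Qed.

End ChainNorm.

(** * Representations of the completed group algebra *)

Section LimitTheory.
Context (R : realType) (H : hilbert R).
Local Notation C := R[i].
Local Notation nm := (vnorm (inner H)).

Lemma vcvg_inner (x y : nat -> H) (l m u w : H) : vcvg x l -> vcvg y m ->
  (forall n, inner H (x n) w = inner H u (y n)) -> inner H l w = inner H u m.
Proof.
move=> xl ym xy; apply/eqP; rewrite -subr_eq0; apply/eqP; apply: cabs_eq0.
apply/eqP; rewrite eq_le cabs_ge0 andbT; apply/ler_addgt0Pr => e e0.
have q0 : 0 < nm u + nm w + 1 by rewrite ltr_wpDl// addr_ge0 ?vnorm_ge0.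
have [N NP] := xl _ (divr_gt0 e0 q0); have [M MP] := ym _ (divr_gt0 e0 q0).
pose n := maxn N M.
have -> : inner H l w - inner H u m = inner H u (y n - m) - inner H (x n - l) w.
  by rewrite linearBr linearBl /= xy; ring.
apply: le_trans (cabsD _ _) _; rewrite cabsN add0r.
have h1 := dot_cabs (inner H) u (y n - m); have h2 := dot_cabs (inner H) (x n - l) w.
have h3 := NP _ (leq_maxl N M); have h4 := MP _ (leq_maxr N M).
have u0 := vnorm_ge0 (inner H) u; have w0 := vnorm_ge0 (inner H) w.
apply: le_trans (lerD h1 h2) _; rewrite -/n in h3 h4.
apply: (@le_trans _ _ (nm u * (e / (nm u + nm w + 1)) + e / (nm u + nm w + 1) * nm w)).
  by apply: lerD; [exact: ler_wpM2l|exact: ler_wpM2r].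
rewrite mulrC -mulrDr mulrAC ler_pdivrMr// ler_wpM2l ?(ltW e0)// lerDl; exact: ler01.
Qed.

Lemma bounded_linear_continuous (K : hilbert R) (L : {linear H -> K}) (M : R) :
  (forall v, vnorm (inner K) (L v) <= M * nm v) -> continuous L.
Proof.
move=> LM v; apply/cvgrPdist_le => e e0.
have e0' : 0 < complex.Re e by move: e0; rewrite ltcE => /andP[].
have eE : e = ((complex.Re e)%:C)%C by apply/esym; rewrite RRe_real// gtr0_real.
have q0 : 0 < `|M| + 1 by rewrite ltr_wpDl.
near=> w; rewrite -linearB eE hilbert_normE lecR (le_trans (LM _))//.
have : `|v - w| <= ((complex.Re e / (`|M| + 1))%:C)%C.
  near: w; apply: cvgr_dist_le; first exact: cvg_id.
  by rewrite ltcR divr_gt0.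
rewrite hilbert_normE lecR ler_pdivlMr// => h.
apply: le_trans h; rewrite mulrC ler_wpM2l ?vnorm_ge0// (le_trans (ler_norm _))//.
by rewrite lerDl.
Unshelve. all: by end_near. Qed.

End LimitTheory.

Section ExtendRep.
Context (R : realType) (G : groupType) (H : hilbert R) (U : unitary_rep G H).
Local Notation C := R[i].
Local Notation nm := (vnorm (inner H)).
Local Notation I := (integrated U).
Local Notation p := (univ_seminorm R G).
Local Notation cau := (cauchy_subalg p).
Local Notation nul := (@null_ideal R (fun=> grpalg C G) (fun=> p) cau (@cauchy_seq_bounded R _ p)).
Local Notation rp a := (@rep _ _ nul a : subalg cau).

Lemma cauchy_rep_limit (x : subalg cau) : exists L : {linear H -> H},
  forall v, vcvg (fun n => I (subval x n) v) (L v).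
Proof.
have [M xM] := cauchy_seq_bounded (proj2_sig x).
apply: (@operator_limit _ _ _ `|M|) => //.
- by move=> n; exact: integrated_linear.
- move=> n v; apply: le_trans (univ_norm_vnorm U _ v) _; rewrite ler_wpM2r ?vnorm_ge0//.
  exact: le_trans (xM n) (ler_norm M).
move=> v e e0; exists v; split; first by rewrite subrr vnorm0 ltW.
have q0 : 0 < nm v + 1 by rewrite ltr_wpDl ?vnorm_ge0.
have [N NP] := proj2_sig x _ (divr_gt0 e0 q0); exists N => m n Nm Nn.
rewrite -integratedB; apply: le_trans (univ_norm_vnorm U _ v) _.
apply: (@le_trans _ _ (e / (nm v + 1) * nm v)).
  by rewrite ler_wpM2r ?vnorm_ge0// ltW// NP.
by rewrite -mulrA ler_piMr ?(ltW e0)// mulrC ler_pdivrMr// mul1r lerDl.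
Qed.

(** The limit does not depend on the representative, since [univ_norm] dominates the operator norm
    and kills null sequences. *)
Lemma completion_rep : exists L : group_Cstar R G -> {linear H -> H},
  forall (x : subalg cau) v, vcvg (fun n => I (subval x n) v) (L (@coset _ _ nul x) v).
Proof.
have /choice[L LP] := cauchy_rep_limit.
exists (fun X => L (rp X)) => x v.
have := LP (rp (@coset _ _ nul x)) v; set y := rp _ => yv e e0.
have q0 : 0 < nm v + 1 by rewrite ltr_wpDl ?vnorm_ge0.
have /(cvg0P) : null_seq (fun=> p) (subval (y - x)) by exact: (@rep_coset _ _ nul x).
move=> /(_ (fun k => sn_ge0 _ _)) /(_ _ (divr_gt0 (divr_gt0 e0 (ltr0n R 2)) q0))[N NP].
have [K KP] := yv _ (divr_gt0 e0 (ltr0n R 2)).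
exists (maxn N K) => n; rewrite geq_max => /andP[Nn Kn].
rewrite [e]splitr; apply: le_trans (ler_vnormB _ _ (I (subval y n) v) _) _; apply: lerD; last exact: KP.
rewrite vnormB -integratedB; apply: le_trans (univ_norm_vnorm U _ v) _.
apply: (@le_trans _ _ (e / 2 / (nm v + 1) * nm v)).
  by rewrite ler_wpM2r ?vnorm_ge0//; exact: NP.
by rewrite -mulrA ler_piMr ?divr_ge0 ?(ltW e0)// mulrC ler_pdivrMr// mul1r lerDl.
Qed.

(** Extension of U by continuity. The approximation clause carries commutator estimates over to the
    completion; if U dominates the universal norm, equal images force the difference of
    representatives to be a null sequence. *)
Lemma group_Cstar_rep : exists pi : star_rep H (group_Cstar R G),
  (forall a (e : R), 0 < e -> exists x, forall v, nm (pi a v - I x v) <= e * nm v) /\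
  ((forall x M, 0 <= M -> (forall v, nm (I x v) <= M * nm v) -> univ_norm x <= M) ->
    faithful pi).
Proof.
have [L LP] := completion_rep.
have Lrep a v : vcvg (fun n => I (subval (rp a) n) v) (L a v).
  by rewrite -{2}[a]repK; exact: LP.
have appr a (e : R) : 0 < e -> exists N, forall n, (N <= n)%N ->
    forall v, nm (L a v - I (subval (rp a) n) v) <= e * nm v.
  move=> e0; have [N NP] := proj2_sig (rp a) _ e0.
  exists N => n Nn v; apply: vcvg_le.
    have := vcvg_lin 1 (Lrep a v) (vcvg_cst (- I (subval (rp a) n) v)); rewrite scale1r; exact.
  exists N => m Nm; rewrite scale1r -integratedB.
  by apply: le_trans (univ_norm_vnorm U _ v) _; rewrite ler_wpM2r ?vnorm_ge0// ltW// NP.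
have bound a : exists M, forall v, nm (L a v) <= M * nm v.
  have [N /(_ N (leqnn N)) NP] := appr a 1 ltr01.
  exists (1 + univ_norm (subval (rp a) N)) => v.
  apply: le_trans (ler_vnorm_dist _ _ (I (subval (rp a) N) v)) _; rewrite mulrDl.
  by apply: lerD => //; exact: univ_norm_vnorm.
have Lcont a : continuous (L a).
  by have [M LM] := bound a; exact: bounded_linear_continuous LM.
have LD a b v : L (a + b) v = L a v + L b v.
  have := LP (rp a + rp b) v; rewrite cosetD !repK => /vcvg_unique; apply.
  have := vcvg_lin 1 (Lrep a v) (Lrep b v); rewrite scale1r; congr vcvg.
  by apply/funext => n; rewrite scale1r -integratedD.
have LZ (c : C) a v : L (c *c a) v = c *: L a v.
  have := LP (c *c rp a) v; rewrite cosetZ repK => /vcvg_unique; apply.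
  have := vcvg_lin c (Lrep a v) (vcvg_cst 0); rewrite addr0; congr vcvg.
  by apply/funext => n; rewrite addr0 -integratedZ.
have LM a b v : L (a * b) v = L a (L b v).
  have := LP (rp a * rp b) v; rewrite cosetM !repK => /vcvg_unique; apply.
  have [M xM] := cauchy_seq_bounded (proj2_sig (rp a)).
  move=> e e0; have q0 : 0 < `|M| + 1 by rewrite ltr_wpDl.
  have [N NP] := Lrep b v _ (divr_gt0 (divr_gt0 e0 (ltr0n R 2)) q0).
  have [K KP] := Lrep a (L b v) _ (divr_gt0 e0 (ltr0n R 2)).
  exists (maxn N K) => n; rewrite geq_max => /andP[Nn Kn].
  rewrite [e]splitr; apply: le_trans (ler_vnormB _ _ (I (subval (rp a) n) (L b v)) _) _.
  apply: lerD; last exact: KP.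
  rewrite -[leLHS]/(nm (I (subval (rp a) n * subval (rp b) n) v - _)) integratedM.
  have IB x u w : I x u - I x w = I x (u - w).
    by rewrite !integratedE -sumrB; apply: eq_bigr => g _; rewrite linearB scalerBr.
  rewrite IB; apply: le_trans (univ_norm_vnorm U _ _) _.
  apply: (@le_trans _ _ (`|M| * (e / 2 / (`|M| + 1)))).
    apply: ler_pM; [exact: (sn_ge0 p)|exact: vnorm_ge0| |exact: NP].
    exact: le_trans (xM n) (ler_norm M).
  by rewrite mulrCA ler_piMr ?divr_ge0 ?(ltW e0)// ler_pdivrMr// mul1r lerDl.
have LS a v w : inner H (L a v) w = inner H v (L (star a) w).
  have := LP (star (rp a)) w; rewrite cosetS repK => h.
  by apply: vcvg_inner (Lrep a v) h _ => n; exact: integratedS.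
exists (StarRep Lcont LD LZ LM LS); split=> [a e e0|full a b ab].
  have [N /(_ N (leqnn N)) NP] := appr a e e0; by exists (subval (rp a) N).
rewrite -[a]repK -[b]repK; apply/cosetP; apply/cvg0P => [k|e e0].
  exact: (sn_ge0 p).
have [N NP] := appr a _ (divr_gt0 e0 (ltr0n R 2)).
have [K KP] := appr b _ (divr_gt0 e0 (ltr0n R 2)).
exists (maxn N K) => n; rewrite geq_max => /andP[Nn Kn].
apply: full => [|v]; first exact: ltW.
rewrite -[leLHS]/(nm (I (subval (rp a) n - subval (rp b) n) v)) integratedB.
rewrite [e]splitr mulrDl; apply: le_trans (ler_vnormB _ _ (L a v) _) _; apply: lerD.
  by rewrite vnormB; exact: NP.
by have -> : L a v = L b v := ab v; exact: KP.
Qed.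

End ExtendRep.

(** * Quasidiagonality of the limit representation *)

Section FiniteRank.
Context (R : realType) (H : hilbert R).
Local Notation C := R[i].
Local Notation nm := (vnorm (inner H)).

Lemma scale_continuous (w : H) : continuous (fun t : R => (t%:C)%C *: w).
Proof.
move=> x; apply/cvgrPdist_le => e e0.
have e0' : 0 < complex.Re e by move: e0; rewrite ltcE => /andP[].
have eE : e = ((complex.Re e)%:C)%C by apply/esym; rewrite RRe_real// gtr0_real.
have q0 : 0 < nm w + 1 by rewrite ltr_wpDl// vnorm_ge0.
near=> y; rewrite eE hilbert_normE lecR -scalerBl vnormZ -rmorphB cabs_real.
have : `|x - y| <= complex.Re e / (nm w + 1).
  by near: y; apply: cvgr_dist_le; [exact: cvg_id|rewrite divr_gt0].
by rewrite ler_pdivlMr//; apply: le_trans; rewrite ler_wpM2l// lerDl.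
Unshelve. all: by end_near. Qed.

Lemma lincomb_continuous n (w : 'I_n -> H) :
  continuous (fun x : 'rV[R]_n => \sum_i ((x 0 i)%:C)%C *: w i).
Proof.
elim: (index_enum _) => [|i r IH].
  by rewrite (_ : (fun x => _) = fun=> 0); [exact: cst_continuous|apply/funext => x; rewrite big_nil].
rewrite (_ : (fun x => _) = fun x : 'rV[R]_n => ((x 0 i)%:C)%C *: w i +
  \sum_(i <- r) ((x 0 i)%:C)%C *: w i); last by apply/funext => x; rewrite big_cons.
have ci : continuous (fun x : 'rV[R]_n => ((x 0 i)%:C)%C *: w i).
  have xi : continuous (fun x : 'rV[R]_n => x 0 i) by exact: coord_continuous.
  exact: (fun x => @continuous_comp _ _ _ _ _ x (xi x) (@scale_continuous (w i) (x 0 i))).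
exact: (fun x => continuousD (ci x) (IH x)).
Qed.

(** Continuous image of a compact real cube; complex coefficients enter through their real and
    imaginary parts. *)
Lemma compact_lincomb n (w : 'I_n -> H) :
  compact [set \sum_i ((x 0 i)%:C)%C *: w i | x in [set x : 'rV[R]_n | forall i, `[-1, 1]%classic (x 0 i)]].
Proof.
apply: continuous_compact; first by apply: continuous_subspaceT; exact: lincomb_continuous.
by apply: (@rV_compact R n (fun=> `[-1, 1]%classic)) => i; exact: segment_compact.
Qed.

End FiniteRank.

Section CoordinateProjections.
Context (R : realType) (H : hilbert R) (cs : coord_system H).
Local Notation C := R[i].
Local Notation nm := (vnorm (inner H)).
Local Notation emb := (cemb cs).
Local Notation tr := (ctr cs).

Lemma coord_proj_linear n : linear (fun v : H => emb (tr n v)).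
Proof. by move=> a u v; rewrite !linearP. Qed.

Definition coord_proj n : {linear H -> H} := mklinear (coord_proj_linear n).

Lemma coord_projE n v : coord_proj n v = emb (tr n v). Proof. by []. Qed.

Lemma coord_proj_adj n v w : inner H (coord_proj n v) w = inner H v (coord_proj n w).
Proof. by rewrite !coord_projE dot_conj !inner_cemb -(dot_conj (@coldot C n)). Qed.

Lemma coord_proj_idem n v : coord_proj n (coord_proj n v) = coord_proj n v.
Proof. by rewrite !coord_projE ctr_cemb. Qed.

Lemma coord_proj_le n v : nm (coord_proj n v) <= nm v.
Proof. by rewrite coord_projE nm_cemb ctr_le. Qed.

Lemma coord_proj_mono m n : (m <= n)%N -> operator_le (coord_proj m) (coord_proj n).
Proof.
move=> mn v; have E k : inner H (coord_proj k v) v = ((cnorm (tr k v) ^+ 2)%:C)%C.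
  by rewrite coord_projE dot_conj inner_cemb (fvvE (@coldot C k)) conjc_real.
rewrite !E lecR ler_pXn2r ?nnegrE ?cnorm_ge0//; exact: ctr_mono.
Qed.

Lemma coord_proj_cvg (d : nat -> nat) v : (forall n, (n <= d n)%N) ->
  coord_proj (d n) v @[n --> \oo] --> v.
Proof.
move=> dn; apply/vcvgP => e e0; have [K KP] := ctr_tail cs v e0.
by exists K => n Kn; rewrite vnormB; apply: KP; exact: leq_trans (dn n).
Qed.

Lemma coord_proj_compact n : compact_operator (coord_proj n).
Proof.
(* The n basis vectors followed by their multiples by i, so that real coefficients in [-1, 1] reach
   the image of the unit ball. *)
pose w (i : 'I_(n + n)) : H := match fintype.split i with
  | inl j => emb (delta_mx j 0) | inr j => (0 +i* 1)%C *: emb (delta_mx j 0) end.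
have wc := @compact_lincomb R H _ w.
apply: (subclosed_compact (@closed_closure _ _) wc).
rewrite [X in _ `<=` X](iffLR (@closure_id _ _)); last first.
  by apply: compact_closed wc; exact: norm_hausdorff.
apply: closureS => _ [v /= v1 <-]; rewrite hilbert_normE -[1]/((1%:C)%C) lecR in v1.
pose c := tr n v; have c1 i : cabs (c i 0) <= 1.
  by rewrite (le_trans (cabs_le_cnorm _ _))// (le_trans (ctr_le _ _ _)).
exists (row_mx (\row_i complex.Re (c i 0)) (\row_i complex.Im (c i 0))).
  have ReC (z : C) : `|complex.Re z| <= cabs z.
    by rewrite -lecR cabsE; exact: normc_ge_Re.
  have ImC (z : C) : `|complex.Im z| <= cabs z.
    have := ReC (- (0 +i* 1)%C * z); rewrite cabsM cabsN cabs_i mul1r.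
    by case: z => a b /=; rewrite oppr0 mul0r sub0r mulN1r opprK.
  move=> k; rewrite -[k]splitK; case: (fintype.split k) => j /=.
    by rewrite row_mxEl mxE in_itv /= -ler_norml (le_trans (ReC _)).
  by rewrite row_mxEr mxE in_itv /= -ler_norml (le_trans (ImC _)).
rewrite big_split_ord /= -big_split /=.
rewrite [tr n v]matrix_sum_delta linear_sum; apply: eq_bigr => j _.
rewrite big_ord1 row_mxEl row_mxEr !mxE /w.
have -> : fintype.split (lshift n j) = inl j by apply: (can_inj (@unsplitK _ _)); rewrite splitK.
have -> : fintype.split (rshift n j) = inr j by apply: (can_inj (@unsplitK _ _)); rewrite splitK.
transitivity (c j 0 *: emb (delta_mx j 0)); last by rewrite -linearZ.
rewrite scalerA -scalerDl; congr (_ *: _).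
by case: (c j 0) => a b; apply/eqP; rewrite eq_complex /= !mul0r !mulr0 ?mulr1 ?subr0 ?addr0 ?add0r !eqxx.
Qed.

Lemma coord_separable : separable H.
Proof.
pose f (l : seq (rat * rat)) : H :=
  emb (\col_(i < size l) (ratr (l`_i).1 +i* ratr (l`_i).2)%C).
exists (range f).
  by apply: (@card_le_trans _ _ _ [set: seq (rat * rat)]); [exact: card_image_le|exact: countableP].
move=> O [v Ov] Oo; have /nbhs_ballP[e e0 eO] := open_nbhs_nbhs (conj Oo Ov).
have e0' : 0 < complex.Re e by move: e0; rewrite /= ltcE => /andP[].
have eE : e = ((complex.Re e)%:C)%C by apply/esym; rewrite RRe_real// gtr0_real.
have [n nP] := ctr_tail cs v (divr_gt0 e0' (ltr0n R 3)).
(* The n coefficient errors, each at most r, add up to at most a third of e; [n.+1] keeps r positive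
   when n = 0. *)
pose r := complex.Re e / 3 / n.+1%:R.
have r0 : 0 < r by rewrite !divr_gt0.
have /choice[q qP] (t : R) : exists q : rat, `|t - ratr q| <= r / 2.
  have [q] := @rat_in_itvoo R (t - r / 2) (t + r / 2) ltac:(by rewrite ltrD2l gt0_cp ?divr_gt0).
  rewrite in_itv /= => /andP[h1 h2]; exists q; rewrite ler_norml.
  by move: (ratr q) (r / 2) h1 h2 => u w; clear; lra.
pose c := tr n v; pose l := [seq (q (complex.Re (c i 0)), q (complex.Im (c i 0))) | i <- enum 'I_n].
have sl : size l = n by rewrite size_map size_enum_ord.
exists (f l); split; last by exists l.
apply: eO; rewrite -ball_normE /= eE hilbert_normE ltcR.
pose c' := \col_(i < n) (ratr (q (complex.Re (c i 0))) +i* ratr (q (complex.Im (c i 0))))%C : 'cV[C]_n.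
have -> : f l = emb c'.
  have E m (h : m = n) : emb (\col_(i < m) (ratr (l`_i).1 +i* ratr (l`_i).2)%C) = emb c'.
    subst m; congr emb; apply/colP => i; rewrite !mxE /l (nth_map i) ?size_enum_ord//=.
    by rewrite nth_ord_enum.
  exact: E.
apply: le_lt_trans (ler_vnormB _ _ (emb c) _) _.
rewrite -(linearB (emb (n := n))) nm_cemb.
have h1 := nP n (leqnn n).
have h2 : cnorm (c - c') <= complex.Re e / 3.
  apply: le_trans (cnorm_le_sum _) _; apply: (@le_trans _ _ (\sum_(i < n) r)).
    apply: ler_sum => i _; rewrite !mxE; case: (c i 0) => a b.
    have -> : (a +i* b)%C - (ratr (q a) +i* ratr (q b))%C =
      ((a - ratr (q a))%:C)%C + (0 +i* 1)%C * ((b - ratr (q b))%:C)%C.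
      by apply/eqP; rewrite eq_complex /= !mul0r !mulr0 ?mul1r ?subr0 ?addr0 ?add0r !eqxx.
    rewrite (le_trans (cabsD _ _))// cabsM cabs_i mul1r !cabs_real [r]splitr.
    exact: lerD.
  have -> : \sum_(i < n) r = complex.Re e / 3 * (n.+1%:R^-1 * n%:R).
    by rewrite sumr_const card_ord -[r *+ n]mulr_natr /r -mulrA.
  rewrite ler_piMr ?divr_ge0 ?(ltW e0')//.
  by rewrite mulrC ler_pdivrMr// mul1r ler_nat.
move: h1 h2 e0'; rewrite -/c; move: (nm _) (cnorm _) (complex.Re e) => x y z; clear; lra.
Qed.

Context (G : groupType) (U : unitary_rep G H).
Context (gamma : nat -> G) (gammaP : forall g, exists i, gamma i = g).
Context (d : nat -> nat) (s : forall n, G -> 'M[C]_(d n)) (dS : forall n, (d n < d n.+1)%N) (dn : forall n, (n <= d n)%N).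
Hypothesis Us : forall g n (c : 'cV[C]_(d n)), g \in window gamma n ->
  nm (U g (emb c) - emb (s n g *m c)) <= 6 * 2^-1 ^+ n * cnorm c.

Let P n := coord_proj (d n).

(** U g nearly acts as s n g on section n, which preserves that section, so little of U g P leaves
    the range of P. *)
Lemma offdiag_le n g v : g \in window gamma n ->
  nm (U g (P n v) - P n (U g (P n v))) <= 6 * 2^-1 ^+ n * nm v.
Proof.
move=> gn; rewrite coord_projE; set c := tr (d n) v.
have -> : U g (emb c) - P n (U g (emb c)) =
    (U g (emb c) - emb (s n g *m c)) - P n (U g (emb c) - emb (s n g *m c)).
  by rewrite linearB [X in _ - (_ - X)]coord_projE ctr_cemb opprB addrA subrK.
apply: le_trans (ctail_le _ _ _) _; apply: le_trans (Us _ gn) _.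
by rewrite ler_wpM2l ?ctr_le// mulr_ge0// ltW// half_gt0.
Qed.

(** P U - U P = P U (1 - P) - (1 - P) U P, and the first term is the adjoint of the off-diagonal
    part for g^-1; hence both g and g^-1 must lie in the window. *)
Lemma commutator_le n g v : g \in window gamma n -> g^-1%g \in window gamma n ->
  nm (P n (U g v) - U g (P n v)) <= 12 * 2^-1 ^+ n * nm v.
Proof.
move=> gn gn'.
have -> : P n (U g v) - U g (P n v) =
    P n (U g (v - P n v)) - (U g (P n v) - P n (U g (P n v))).
  by rewrite (linearB (U g)) (linearB (P n)) opprB addrA subrK.
apply: le_trans (ler_vnormD _ _ _) _; rewrite vnormN.
rewrite (_ : 12 * 2^-1 ^+ n * nm v = 6 * 2^-1 ^+ n * nm v + 6 * 2^-1 ^+ n * nm v); last first.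
  by move: (2^-1 ^+ n) (nm v) => a b; clear; ring.
apply: lerD (offdiag_le _ gn).
apply: (vnorm_adj (S := fun v => P n (U g (v - P n v))) (fun v => offdiag_le v gn')) => u w.
rewrite /P -[RHS]coord_proj_adj linearBl /= [X in _ - X]coord_proj_adj !urep_adj invgK.
by rewrite (linearB (U g)) linearBr.
Qed.

Lemma integrated_commutator x (r : R) : 0 < r -> exists N, forall n, (N <= n)%N -> forall v,
  nm (P n (integrated U x v) - integrated U x (P n v)) <= r * nm v.
Proof.
move=> r0; pose S := \sum_(g <- gsupp x) cabs (x g).
have S0 : 0 <= S by apply: sumr_ge0 => g _; exact: cabs_ge0.
have q0 : 0 < 12 * S + 1 by rewrite ltr_wpDl// mulr_ge0.
have [N NP] := windows_eventually gammaP (gsupp x).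
have [M MP] := windows_eventually gammaP [seq g^-1%g | g <- gsupp x].
have [K KP] := half_small (divr_gt0 r0 q0).
exists (maxn N (maxn M K)) => n; rewrite !geq_max => /and3P[Nn Mn Kn] v.
have -> : P n (integrated U x v) - integrated U x (P n v) =
    \sum_(g <- gsupp x) x g *: (P n (U g v) - U g (P n v)).
  rewrite !integratedE linear_sum -sumrB; apply: eq_bigr => g _.
  by rewrite linearZ scalerBr.
rewrite (le_trans (vnorm_sum _ _ _))//.
apply: (@le_trans _ _ (\sum_(g <- gsupp x) cabs (x g) * (12 * 2^-1 ^+ n * nm v))).
  rewrite big_seq [leRHS]big_seq; apply: ler_sum => g gx; rewrite vnormZ ler_wpM2l ?cabs_ge0//.
  by apply: commutator_le; [exact: NP|apply: MP => //; apply: (map_f (fun g => g^-1%g))].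
rewrite -mulr_suml -/S mulrA ler_wpM2r ?vnorm_ge0//.
have := KP _ Kn; rewrite ler_pdivlMr//; have := half_gt0 R n; move: (2^-1 ^+ n) => u u0.
by rewrite mulrDr mulr1 => h; apply: le_trans h; rewrite mulrA (mulrC S) (mulrC u) lerDl ltW.
Qed.

Lemma quasidiagonal_chain (A : starAlgType C) (pi : star_rep H A) :
  (forall a (r : R), 0 < r -> exists x, forall v, nm (pi a v - integrated U x v) <= r * nm v) ->
  quasidiagonal_set (range pi).
Proof.
move=> appr; split=> [_ [a _ <-]|]; first exact: srep_continuous.
exists P; split=> [n|n|v|_ [a _ <-]].
- split; last exact: coord_proj_compact.
  by split; [exact: coord_proj_idem|exact: coord_proj_adj].
- by apply: coord_proj_mono; exact: ltnW (dS n).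
- exact: coord_proj_cvg.
apply/cvg0P => [n|r r0]; first exact: opnorm_ge0.
have r3 : 0 < r / 3 by rewrite divr_gt0.
have [x xP] := appr a _ r3; have [N NP] := integrated_commutator x r3.
exists N => n /NP nP; apply: opnorm_le => [|v]; first exact: ltW.
have -> : P n (pi a v) - pi a (P n v) = P n (pi a v - integrated U x v) +
   (P n (integrated U x v) - integrated U x (P n v)) - (pi a (P n v) - integrated U x (P n v)).
  by rewrite (linearB (P n)) opprB !addrA !subrK.
rewrite (_ : r * nm v = r / 3 * nm v + r / 3 * nm v + r / 3 * nm v); last by field.
apply: le_trans (ler_vnormD _ _ _) _; rewrite vnormN; apply: lerD; last first.
  by apply: le_trans (xP _) _; rewrite ler_wpM2l ?(ltW r3)// coord_proj_le.
apply: le_trans (ler_vnormD _ _ _) _; apply: lerD => //.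
by apply: le_trans (coord_proj_le _ _) _.
Qed.

End CoordinateProjections.

Lemma countable_enum (G : groupType) : countable [set: G] ->
  exists gamma : nat -> G, forall g, exists i, gamma i = g.
Proof.
move=> /countable_injP[f fi]; exists (fun n => xget 1%g [set g | f g = n]) => g.
exists (f g); apply: fi; rewrite ?inE//.
exact: (@xgetPex _ _ [set h | f h = f g] (ex_intro _ g erefl)).
Qed.

Lemma MF_quasidiagonal_coords (R : realType) (G : groupType) (H : hilbert R)
    (cs : coord_system H) : countable [set: G] -> amenable R G -> MF R G ->
  quasidiagonal (group_Cstar R G).
Proof.
move=> /countable_enum[gamma gammaP] am mf.
have [d [s [A [B [a [e [dS eP rP sP sI]]]]]]] := unitary_chain gamma am mf.
have e1 n : e n <= 2^-1 ^+ n.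
  have [e0 en] := eP n; apply: le_trans en; rewrite lerDr mulr_ge0//; exact: ler0n.
have WB n g : g \in window gamma n -> g \in B n by case: (rP n) => _ [h _ _]; exact: h.
have [U Us] := chain_rep cs gammaP dS e1 WB (fun n => proj1 (sP n)) sI.
have [pi [appr full]] := group_Cstar_rep U.
exists H, pi; split.
- exact: coord_separable cs.
- apply: full => x M M0; exact: (chain_univ_norm gammaP Us eP rP (fun n => proj2 (sP n))).
- exact: (quasidiagonal_chain gammaP dS (d_ge dS) Us).
Qed.

Lemma MF_quasidiagonal (R : realType) (G : groupType) :
  countable [set: G] -> amenable R G -> MF R G -> quasidiagonal (group_Cstar R G).
Proof. exact: MF_quasidiagonal_coords (ell2_coords R). Qed.

(** * The regular representation *)

Section ConstantSequences.
Context (R : realType) (G : groupType).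
Local Notation C := R[i].
Local Notation p := (univ_seminorm R G).
Local Notation cau := (cauchy_subalg p).
Local Notation nul := (@null_ideal R (fun=> grpalg C G) (fun=> p) cau (@cauchy_seq_bounded R _ p)).

Lemma cauchy_cst (x : grpalg C G) : cauchy_seq p (fun=> x).
Proof. by move=> e e0; exists 0%N => m n _ _; rewrite subrr sn0. Qed.

Definition grpalg_emb (x : grpalg C G) : group_Cstar R G :=
  @coset _ _ nul (exist _ (fun=> x) (cauchy_cst x)).

Lemma grpalg_embM x y : grpalg_emb (x * y) = grpalg_emb x * grpalg_emb y.
Proof. by rewrite /grpalg_emb -[RHS](@cosetM _ _ nul); congr coset; exact: subval_inj. Qed.

Lemma grpalg_embS x : grpalg_emb (star x) = star (grpalg_emb x).
Proof. by rewrite /grpalg_emb -[RHS](@cosetS _ _ nul); congr coset; exact: subval_inj. Qed.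

Lemma grpalg_emb_eq x y : grpalg_emb x = grpalg_emb y -> univ_norm (x - y) = 0.
Proof.
move=> /cosetP /cvg0P-/(_ (fun=> sn_ge0 p _)) xy; apply/eqP.
rewrite eq_le (sn_ge0 p) andbT; apply/ler_addgt0Pr => e /xy[K /(_ K (leqnn K))].
by rewrite add0r.
Qed.

Lemma gdeltaM (g h : G) : gdelta C g * gdelta C h = gdelta C (g * h)%g.
Proof.
apply: gcoef_inj => t /=; rewrite /conv (fsbigTE [fset g]%fset).
  rewrite big_seq_fset1 eqxx mul1r; congr (_%:R); congr nat_of_bool.
  by apply/eqP/eqP => [<-|->]; rewrite ?mulVKg ?mulKg.
by move=> u; rewrite inE => /negPf ->; rewrite mul0r.
Qed.

Lemma gdeltaS (g : G) : star (gdelta C g) = gdelta C g^-1%g.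
Proof.
apply: gcoef_inj => t /=; rewrite conjC_nat; congr (_%:R); congr nat_of_bool.
by rewrite -(inj_eq invg_inj) invgK.
Qed.

End ConstantSequences.

Section RegularRepresentation.
Context (R : realType).
Local Notation C := R[i].
Local Notation T := (ell2 R).

(** The squared moduli of the first n permuted entries form a subsum of those of the first m entries
    of v, for m above all f i. *)
Lemma permuted_bound (f : nat -> nat) (v : T) : injective f ->
  forall n, cnorm (trunc n (entry v \o f)) <= l2norm v.
Proof.
move=> fi n; pose m := (\max_(i < n) f i).+1.
apply: le_trans (@cnorm_tr R m v); apply: ler_sqr_le; first exact: cnorm_ge0.
rewrite cnorm_tr_sqr cnorm_sqr.
have fm (i : 'I_n) : (f i < m)%N by rewrite ltnS; exact: leq_bigmax.
pose h i : 'I_m := Ordinal (fm i).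
have hi : injective h by move=> i j /(congr1 val) /fi /val_inj.
pose F (j : 'I_m) := cabs (entry v j) ^+ 2.
have -> : \sum_(i < n) cabs (trunc n (entry v \o f) i 0) ^+ 2 = \sum_(j in [set h i | i in 'I_n]%SET) F j.
  by rewrite big_imset /=; [apply: eq_bigr => i _; rewrite mxE|move=> i j _ _; exact: hi].
rewrite [leRHS](bigID (mem [set h i | i in 'I_n]%SET)) /= lerDl.
by apply: sumr_ge0 => j _; exact: sqr_ge0.
Qed.

Definition permute (f : nat -> nat) (fi : injective f) (v : T) : T :=
  exist _ (entry v \o f) (ex_intro _ (l2norm v) (permuted_bound v fi)).

Lemma entry_permute f (fi : injective f) v k : entry (permute fi v) k = entry v (f k).
Proof. by []. Qed.

Lemma permute_linear f (fi : injective f) : linear (permute fi).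
Proof.
by move=> a u v; apply: entry_inj => k; rewrite !(entryD, entryZ, entry_permute).
Qed.

Lemma permute_norm f (fi : injective f) f' (fi' : injective f') v : cancel f' f ->
  l2norm (permute fi v) = l2norm v.
Proof.
move=> ff; apply/eqP; rewrite eq_le; apply/andP; split.
  by apply: l2norm_le => n; exact: permuted_bound.
rewrite [v in leLHS](_ : v = permute fi' (permute fi v)).
  by apply: l2norm_le => n; exact: permuted_bound.
by apply: entry_inj => k; rewrite !entry_permute ff.
Qed.

Context (G : groupType) (iota : G -> nat) (iotaI : injective iota).

(** Entries are pulled back, so translation by g uses g^-1. Indices outside the image of [iota] are
    fixed: l^2 carries the regular representation plus a trivial summand, also for finite G. *)
Definition regular_perm (g : G) (k : nat) : nat :=
  if pselect (exists h, iota h = k) is left e then iota (g^-1 * projT1 (cid e))%g else k.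

Lemma regular_permE g h : regular_perm g (iota h) = iota (g^-1 * h)%g.
Proof.
rewrite /regular_perm; case: pselect => [e|[]]; last by exists h.
by case: cid => h' /= /iotaI ->.
Qed.

Lemma regular_perm_out g k : ~ (exists h, iota h = k) -> regular_perm g k = k.
Proof. by rewrite /regular_perm; case: pselect. Qed.

Lemma regular_permM g h k : regular_perm (g * h)%g k = regular_perm h (regular_perm g k).
Proof.
have [[t <-]|nk] := pselect (exists h, iota h = k).
  by rewrite !regular_permE invgM mulgA.
by rewrite !regular_perm_out.
Qed.

Lemma regular_perm1 k : regular_perm 1%g k = k.
Proof.
have [[t <-]|nk] := pselect (exists h, iota h = k); last exact: regular_perm_out.
by rewrite regular_permE invg1 mul1g.
Qed.

Lemma regular_permK g : cancel (regular_perm g) (regular_perm g^-1%g).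
Proof. by move=> k; rewrite -regular_permM mulgV regular_perm1. Qed.

Let perm_inj g : injective (regular_perm g) := can_inj (@regular_permK g).

Definition regular_op (g : G) : {linear T -> T} :=
  HB.pack (permute (@perm_inj g)) (GRing.isLinear.Build _ _ _ _ _ (permute_linear (@perm_inj g))).

Lemma entry_regular g v k : entry (regular_op g v) k = entry v (regular_perm g k).
Proof. by []. Qed.

Lemma regular_op1 v : regular_op 1%g v = v.
Proof. by apply: entry_inj => k; rewrite entry_regular regular_perm1. Qed.

Lemma regular_opM g h v : regular_op (g * h)%g v = regular_op g (regular_op h v).
Proof. by apply: entry_inj => k; rewrite !entry_regular regular_permM. Qed.

Lemma regular_op_inner g v w : l2dot (regular_op g v) (regular_op g w) = l2dot v w.
Proof.
apply: (isometry_dot (f := @l2dot R) (g := @l2dot R)) => [a x y|x]; first exact: linearP.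
apply: (permute_norm (perm_inj (g := g)) (perm_inj (g := g^-1%g))).
by move=> k; rewrite -{1}[g]invgK regular_permK.
Qed.

Definition regular_rep : unitary_rep G (ell2_hilbert R) :=
  @UnitaryRep R G (ell2_hilbert R) regular_op regular_op1 regular_opM regular_op_inner.

Lemma regular_rep_faithful g h :
  (forall v, regular_rep g v = regular_rep h v) -> g = h.
Proof.
move=> gh; pose c : 'cV[C]_((iota 1%g).+1) := delta_mx ord_max 0.
have cE k : entry (emb c) k = (k == iota 1%g)%:R.
  have [kn|kn] := ltnP k (iota 1%g).+1; last by rewrite entry_emb0// gtn_eqF.
  rewrite -[k in LHS]/(nat_of_ord (Ordinal kn)) entry_emb mxE andbT.
  by congr (_%:R); congr nat_of_bool; rewrite -val_eqE.
have := congr1 (fun v : T => entry v (iota g)) (gh (emb c)).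
rewrite !entry_regular !cE !regular_permE mulVg eqxx.
have [/iotaI e _|_ /eqP] := eqVneq (iota (h^-1 * g)%g) (iota 1%g); last by rewrite oner_eq0.
by rewrite -[g](mulVKg h) e mulg1.
Qed.

End RegularRepresentation.

Lemma univ_norm_gdelta (R : realType) (G : groupType) (g h : G) : countable [set: G] ->
  univ_norm (gdelta R[i] g - gdelta R[i] h) = 0 -> g = h.
Proof.
move=> /countable_injP[iota iotaI] gh0.
have iI : injective iota by move=> x y; apply: iotaI; rewrite ?inE.
apply: (@regular_rep_faithful R G iota iI) => v; apply/eqP; rewrite -subr_eq0; apply/eqP.
apply: (vnorm_eq0 (f := inner (ell2_hilbert R))); apply/eqP; rewrite eq_le vnorm_ge0 andbT.
rewrite -!integrated_gdelta -integratedB.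
by apply: le_trans (univ_norm_vnorm _ _ _) _; rewrite gh0 mul0r.
Qed.

(** * Compressions to finite rank *)

Lemma cnorm_col0 (R : realType) m n (w : 'cV[R[i]]_m) :
  cnorm (col_mx w (0 : 'cV[R[i]]_n)) = cnorm w.
Proof.
apply/eqP; rewrite -(@eqrXn2 _ 2)// ?cnorm_ge0// cnorm_col.
have -> : cnorm (0 : 'cV[R[i]]_n) = 0 by exact: vnorm0.
by rewrite expr0n addr0.
Qed.

Section AsymptoticRepresentation.
Context (R : realType) (G : groupType).
Local Notation C := R[i].
Context (d : nat -> nat) (s : forall n, G -> 'M[C]_(d n)).
Hypotheses (s_le1 : forall n g, mxbound (s n g) 1)
  (sV : forall n g, s n g^-1%g = (s n g)^t*) (s1 : forall n, s n 1%g = 1%:M)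
  (sM : forall g h e, 0 < e -> exists K, forall n, (K <= n)%N ->
    mxbound (s n g *m s n h - s n (g * h)%g) e)
  (s_inj : forall g h, (forall e, 0 < e -> exists K, forall n, (K <= n)%N ->
    mxbound (s n g - s n h) e) -> g = h).

(* Identity blocks make the sizes strictly increasing. *)
Let pad n := (\sum_(i < n) d i + n.+1)%N.
Let N n := (d n + pad n)%N.
Let t n g : 'M[C]_(N n) := block_mx (s n g) 0 0 (1%:M : 'M[C]_(pad n)).

Let t_bounded g : matrix_prod R N (fun n => t n g).
Proof.
exists 1 => k; apply: opnorm_mxbound => //; apply: mxbound_block => //.
by apply: mxbound_isom; rewrite trmx1 map_mx1 mulmx1.
Qed.

Let elt g : subalg (matrix_prod R N) := exist _ _ (t_bounded g).
Let phi g : Qalg R N := coset (matrix_sum R N) (elt g).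

Let phiM g h : phi (g * h)%g = phi g * phi h.
Proof.
rewrite /phi -[RHS](@cosetM _ _ (matrix_sum R N)); apply: esym; apply/matrix_cosetP => e e0.
have [K KP] := sM g h e0; exists K => n /KP sn.
change (mxbound (t n g *m t n h - t n (g * h)%g) e).
rewrite /t diag_block_mul diag_block_sub mulmx1 subrr.
apply: mxbound_block; [exact: ltW|exact: sn|apply: mxbound0; exact: ltW].
Qed.

Let phi1 : phi 1%g = 1.
Proof.
rewrite -[RHS](@coset1 _ _ (matrix_sum R N)); congr coset; apply: subval_inj.
apply: functional_extensionality_dep => n.
have t1 : t n 1%g = 1%:M by rewrite /t s1 diag_block1.
exact: t1.
Qed.

Let phiV g : phi g^-1%g = star (phi g).
Proof.
rewrite -[RHS](@cosetS _ _ (matrix_sum R N)); congr coset; apply: subval_inj.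
apply: functional_extensionality_dep => n.
have tV : t n g^-1%g = (t n g)^t* by rewrite /t diag_block_adj sV trmx1 map_mx1.
exact: (etrans tV (esym (mxadj_star (t n g)))).
Qed.

(** The matrices are only contractions; their classes are unitary because [phi] is multiplicative
    and sends inverses to adjoints. Injectivity is read on the upper left block. *)
Lemma asymptotic_rep_MF : MF R G.
Proof.
exists N; split=> [k|k|].
- by rewrite /N /pad !addnS.
- by rewrite /N /pad big_ord_recr /=; move: (\sum_(i < k) d i)%N => S; lia.
exists phi; split=> [g|g h|g h].
- by split; rewrite -phiV -phiM ?mulVg ?mulgV.
- exact: phiM.
move=> /matrix_cosetP gh; apply: s_inj => e /gh[K KP]; exists K => n /KP ghn v.
have {}ghn : mxbound (t n g - t n h) e by exact: ghn.
have := ghn (col_mx v 0); rewrite /t diag_block_sub mul_diag_block subrr mul0mx.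
by rewrite !cnorm_col0.
Qed.

End AsymptoticRepresentation.

Section ProjectionTheory.
Context (R : realType) (H : hilbert R) (P : {linear H -> H}).
Local Notation C := R[i].
Local Notation nm := (vnorm (inner H)).
Hypothesis projP : projection P.

Lemma projection_le v : nm (P v) <= nm v.
Proof.
have [PP PS] := projP; apply: ler_sqr_le; first exact: vnorm_ge0.
have := @vnorm_proj_sqr R H (inner H) v (P v) ltac:(by rewrite PS PP).
by move=> h; rewrite -subr_ge0 -h sqr_ge0.
Qed.

Lemma compact_projection_net : compact_operator P ->
  exists l : seq H, forall v, nm v <= 1 -> exists2 w, w \in l & nm (P v - w) <= 2^-1.
Proof.
rewrite /compact_operator compact_cover => cK.
pose r : C := (2^-1%:C)%C; have r0 : 0 < r by rewrite ltcR invr_gt0.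
have [|v Kv|D _ DP] := cK H setT (fun w => ball w r).
- by move=> w _; exact: ball_open.
- by exists v => //; exact: ballxx.
exists (enum_fset D) => v v1; have [|w wD vw] := DP (P v).
  by apply: subset_closure; exists v => //=; rewrite hilbert_normE -[1]/((1%:C)%C) lecR.
exists w; first exact: wD.
by move: vw; rewrite -ball_normE /= hilbert_normE ltcR vnormB => /ltW.
Qed.

(** Riesz's argument: a unit vector of the range orthogonal to the images P w of a finite 1/2-net
    would be at distance at least 1 from each P w, but the net puts it within 1/2 of one of them. *)
Lemma compact_projection_basis : compact_operator P ->
  exists e : seq H, orthon (inner H) e /\ forall v, P v = synth (coord (inner H) e v).
Proof.
move=> /compact_projection_net[l lP]; have [PP PS] := projP.
have [e [eon esp eP]] := gram_schmidt (f := inner H) (e := [::])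
  (fun i j => False_ind _ \o notF) [seq P w | w <- l].
rewrite /= in eon esp eP.
have {}eP v : v \in e -> P v = v.
  apply: (eP (fun v => P v = v)); first exact: linear0.
  - by move=> a u w Pu Pw; rewrite linearP Pu Pw.
  - by move=> _ /seq.mapP[w _ ->]; exact: PP.
have Psynth (c : 'cV[C]_(size e)) : P (synth c) = synth c.
  rewrite /synth linear_sum; apply: eq_bigr => i _.
  by rewrite linearZ /= eP// mem_nth.
have Pcoord v : coord (inner H) e (P v) = coord (inner H) e v.
  by apply/colP => i; rewrite !mxE PS eP// mem_nth.
exists e; split=> // v; rewrite -Pcoord.
pose x := P v - synth (coord (inner H) e (P v)).
have Px : P x = x by rewrite /x linearB PP Psynth.
apply/eqP; rewrite -subr_eq0 -/x; apply/eqP; apply: contrapT => x0.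
have n0 : 0 < nm x by rewrite lt_def vnorm_ge0 andbT; apply/eqP => /vnorm_eq0.
pose y := ((nm x)^-1%:C)%C *: x.
have ny : nm y = 1 by rewrite vnormZ cabs_real gtr0_norm ?invr_gt0// mulVf ?gt_eqF.
have Py : P y = y by rewrite linearZ Px.
have ye i : (i < size e)%N -> inner H y e`_i = 0.
  by move=> ie; rewrite linearZl_LR /= residue_ortho// mulr0.
have [w wl yw] := lP y ltac:(by rewrite ny).
have h : nm (y - P w) <= 2^-1.
  by rewrite -{1}Py -{1}[y]Py -linearB (le_trans (projection_le _)).
have yPw : inner H y (P w) = 0.
  rewrite -(esp (P w)) ?map_f// /synth linear_sumr big1// => i _.
  by rewrite linearZr_LR /= ye// mulr0.
have : nm y ^+ 2 <= 2^-1 ^+ 2.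
  apply: le_trans (_ : nm (y - P w) ^+ 2 <= _); last by rewrite ler_pXn2r ?nnegrE ?vnorm_ge0 ?invr_ge0.
  by rewrite vnormBE yPw /= mul0rn subr0 lerDl sqr_ge0.
rewrite ny expr1n; have : 2^-1 ^+ 2 < 1 :> R by rewrite expr2; lra.
by move=> /lt_le_trans h' /h'; rewrite ltxx.
Qed.

End ProjectionTheory.

Section Compression.
Context (R : realType) (G : groupType) (H : hilbert R) (W : unitary_rep G H).
Local Notation C := R[i].
Local Notation f := (inner H).
Local Notation nm := (vnorm (inner H)).
Context (P : nat -> {linear H -> H}) (e : nat -> seq H).
Hypotheses (projP : forall n, projection (P n)) (eon : forall n, orthon f (e n))
  (PE : forall n v, P n v = synth (coord f (e n) v))
  (Pcvg : forall v, vcvg (fun n => P n v) v)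
  (Pcomm : forall g r, 0 < r -> exists N, forall n, (N <= n)%N -> forall v,
    nm (P n (W g v) - W g (P n v)) <= r * nm v)
  (W_inj : forall g h, (forall v, W g v = W h v) -> g = h).

(** The compression P W(g) P in the basis [e n] of the range of P. *)
Let s n g : 'M[C]_(size (e n)) := \matrix_(i, j) f (W g (e n)`_j) (e n)`_i.

Let sE n g c : s n g *m c = coord f (e n) (W g (synth c)).
Proof.
apply/colP => i; rewrite !mxE /synth linear_sum linear_sumlz; apply: eq_bigr => j _.
by rewrite mxE linearZ linearZl_LR /= mulrC.
Qed.

Let Psynth n (c : 'cV[C]_(size (e n))) : P n (synth c) = synth c.
Proof. by rewrite PE coord_synth. Qed.

Let coordB n u v : coord f (e n) u - coord f (e n) v = coord f (e n) (u - v).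
Proof. by apply/colP => i; rewrite !mxE linearBl. Qed.

(** On the range of P, the defect P W(g) P W(h) - P W(gh) equals P W(g) applied to the commutator of
    P with W(h). *)
Let sM g h r : 0 < r -> exists K, forall n, (K <= n)%N ->
  mxbound (s n g *m s n h - s n (g * h)%g) r.
Proof.
move=> r0; have [N NP] := Pcomm h r0; exists N => n /NP nP c.
rewrite mulmxBl -mulmxA !sE -PE urepM coordB -linearB (le_trans (cnorm_coord (@eon n) _))//.
rewrite urep_nm -(vnorm_synth (@eon n) c).
by have := nP (synth c); rewrite Psynth.
Qed.

(** W(g) v and W(h) v are joined through P W(g) v, P W(g) P v, P W(h) P v and P W(h) v, which
    accounts for the five parts of r. *)
Let s_inj g h : (forall r, 0 < r -> exists K, forall n, (K <= n)%N ->
  mxbound (s n g - s n h) r) -> g = h.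
Proof.
move=> gh; apply: W_inj => v; apply/eqP; rewrite -subr_eq0; apply/eqP.
apply: (vnorm_eq0 (f := f)); apply/eqP; rewrite eq_le vnorm_ge0 andbT.
apply/ler_addgt0Pr => r r0; rewrite add0r.
have r5 : 0 < r / 5 by rewrite divr_gt0.
have q0 : 0 < nm v + 1 by rewrite ltr_wpDl ?vnorm_ge0.
have [K KP] := gh _ (divr_gt0 r5 q0); have [L LP] := Pcvg v r5.
have [M MP] := Pcvg (W g v) r5; have [N NP] := Pcvg (W h v) r5.
pose n := maxn (maxn K L) (maxn M N).
have [Kn Ln Mn Nn] : [/\ K <= n, L <= n, M <= n & N <= n]%N by rewrite /n; split; lia.
have PW k : P n (W k (P n v)) = synth (s n k *m coord f (e n) v) by rewrite !PE sE.
have h1 : nm (P n (W g (P n v)) - P n (W h (P n v))) <= r / 5.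
  have -> : P n (W g (P n v)) - P n (W h (P n v)) = synth ((s n g - s n h) *m coord f (e n) v).
    rewrite !PW /synth -sumrB; apply: eq_bigr => i _.
    by rewrite -scalerBl mulmxBl; congr (_ *: _); rewrite [RHS]mxE [X in _ = _ + X]mxE.
  rewrite (vnorm_synth (@eon n)) (le_trans (KP _ Kn _))//.
  apply: (@le_trans _ _ (r / 5 / (nm v + 1) * nm v)).
    by rewrite ler_wpM2l ?(ltW (divr_gt0 r5 q0))// (cnorm_coord (@eon n)).
  by rewrite -mulrA ler_piMr ?(ltW r5)// mulrC ler_pdivrMr// mul1r lerDl.
have h2 k : nm (P n (W k (P n v)) - P n (W k v)) <= r / 5.
  rewrite -!linearB (le_trans (projection_le (projP n) _))// urep_nm; exact: LP.
have h3 := MP _ Mn; have h4 := NP _ Nn.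
have h5 := ler_vnormB f (W g v) (P n (W g v)) (W h v).
have h6 := ler_vnormB f (P n (W g v)) (P n (W g (P n v))) (W h v).
have h7 := ler_vnormB f (P n (W g (P n v))) (P n (W h (P n v))) (W h v).
have h8 := ler_vnormB f (P n (W h (P n v))) (P n (W h v)) (W h v).
have h9 := h2 g; have h10 := h2 h.
rewrite vnormB in h9; rewrite vnormB in h3.
move: h1 h3 h4 h5 h6 h7 h8 h9 h10; clear.
set x1 := nm _; set x2 := nm _; set x3 := nm _; set x4 := nm _; set x5 := nm _.
set x6 := nm _; set x7 := nm _; set x8 := nm _; set x9 := nm _.
move: x1 x2 x3 x4 x5 x6 x7 x8 x9 => x1 x2 x3 x4 x5 x6 x7 x8 x9; lra.
Qed.

Lemma compression_MF : MF R G.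
Proof.
apply: (@asymptotic_rep_MF R G (fun n => size (e n)) s _ _ _ sM s_inj) => n.
- move=> g c; rewrite sE mul1r (le_trans (cnorm_coord (@eon n) _))// urep_nm.
  by rewrite (vnorm_synth (@eon n)).
- by move=> g; apply/matrixP => i j; rewrite !mxE urep_adj invgK dot_conj.
by apply/matrixP => i j; rewrite !mxE urep1 eon// val_eqE eq_sym.
Qed.

End Compression.

(** * From a possibly non-unital star representation to a unitary one *)

Section UnitaryPart.
Context (R : realType) (G : groupType) (A : starAlgType R[i]) (H : hilbert R).
Context (pi : star_rep H A) (c : G -> A).
Hypotheses (cM : forall g h, c (g * h)%g = c g * c h) (c1 : c 1%g = 1)
  (cS : forall g, star (c g) = c g^-1%g).
Local Notation f := (inner H).
Local Notation nm := (vnorm (inner H)).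

Let c1l g v : pi 1 (pi (c g) v) = pi (c g) v. Proof. by rewrite -srepM mul1r. Qed.
Let c1r g v : pi (c g) (pi 1 v) = pi (c g) v. Proof. by rewrite -srepM mulr1. Qed.

Lemma srep_group_dot g v w : f (pi (c g) v) (pi (c g) w) = f v (pi 1 w).
Proof. by rewrite srepS -srepM cS -cM mulVg c1. Qed.

Lemma srep1_projection : projection (pi 1).
Proof. by split=> v => [|w]; rewrite ?srepS ?star1 -?srepM ?mulr1. Qed.

Lemma srep_group_le g v : nm (pi (c g) v) <= nm v.
Proof.
have [PP PS] := srep1_projection.
have -> : nm (pi (c g) v) = nm (pi 1 v).
  by rewrite /vnorm srep_group_dot [in RHS]PS PP.
exact: projection_le srep1_projection _.
Qed.

(* A star representation need not be unital: the identity is added on the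
   complement of the range of [pi 1]. *)
Let W g v := pi (c g) v + (v - pi 1 v).

Let W_linear g : linear (W g).
Proof.
move=> a u v; rewrite /W (linearP (pi (c g))) (linearP (pi 1)) !scalerDr scalerN opprD.
by rewrite (addrACA (a *: u)) (addrACA (a *: pi (c g) u)).
Qed.

Let W_inner g v w : f (W g v) (W g w) = f v w.
Proof.
have [PP PS] := srep1_projection.
have orth u x : f (pi (c g) u) (x - pi 1 x) = 0.
  by rewrite linearBr /= -[X in _ - X]PS c1l subrr.
rewrite /W linearDl linearDr /= srep_group_dot orth addr0 linearDr /=.
have h0 : f (v - pi 1 v) (pi 1 w) = 0 by rewrite -PS linearB /= PP subrr linear0l.
rewrite (dot_conj f (v - pi 1 v) (pi (c g) w)) orth rmorph0 add0r linearBr /= h0 subr0.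
by rewrite linearBl /= PS addrC subrK.
Qed.

(** The complement is written with [c 1%g], so that a commutator with U g is a difference of two
    commutators with images of group elements. *)
Lemma unitary_part : exists U : unitary_rep G H,
  forall g v, U g v = pi (c g) v + (v - pi (c 1%g) v).
Proof.
have U1 v : W 1%g v = v by rewrite /W c1 addrC subrK.
have [PP PS] := srep1_projection.
have UM g h v : W (g * h)%g v = W g (W h v).
  rewrite /W cM srepM; congr (_ + _).
    by rewrite (linearD (pi (c g))) (linearB (pi (c g))) c1r subrr addr0.
  by rewrite (linearD (pi 1)) (linearB (pi 1)) c1l PP subrr addr0 addrAC subrr add0r.
by exists (@UnitaryRep R G H (fun g => mklinear (@W_linear g)) U1 UM W_inner) => g v; rewrite c1.
Qed.

End UnitaryPart.

(** The supremum [opnorm] controls vectors only once some bound is known; here 2 serves, both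
    operators being contractions. *)
Lemma commutator_opnorm (R : realType) (H : hilbert R) (P T : {linear H -> H}) :
  (forall v, vnorm (inner H) (P v) <= vnorm (inner H) v) ->
  (forall v, vnorm (inner H) (T v) <= vnorm (inner H) v) ->
  forall v, vnorm (inner H) (P (T v) - T (P v)) <=
    opnorm (inner H) (fun v => P (T v) - T (P v)) * vnorm (inner H) v.
Proof.
move=> P1 T1; apply: (@le_opnorm _ _ _ _ 2) => [a u|u].
  by rewrite (linearZ_LR T) (linearZ_LR P) (linearZ_LR P) (linearZ_LR T) scalerBr.
apply: le_trans (ler_vnormD _ _ _) _; rewrite vnormN [2 * _]mulr_natl mulr2n.
by apply: lerD; [exact: le_trans (P1 _) (T1 _)|exact: le_trans (T1 _) (P1 _)].
Qed.

Lemma commutator_affine (V : zmodType) (P T S W : {additive V -> V}) :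
  (forall v, W v = T v + (v - S v)) ->
  forall v, P (W v) - W (P v) = (P (T v) - T (P v)) - (P (S v) - S (P v)).
Proof.
move=> WE v; rewrite !WE raddfD raddfB opprD addrACA; congr (_ + _).
by rewrite !opprB addrC subrKA.
Qed.

Lemma quasidiagonal_MF (R : realType) (G : groupType) : countable [set: G] ->
  quasidiagonal (group_Cstar R G) -> MF R G.
Proof.
move=> Gc [H [pi [_ full [_ [P [Pp _ Pcvg Pcomm]]]]]].
pose c (g : G) := grpalg_emb (gdelta R[i] g).
have cM g h : c (g * h)%g = c g * c h by rewrite /c -grpalg_embM gdeltaM.
have c1 : c 1%g = 1 by congr coset; exact: subval_inj.
have cS g : star (c g) = c g^-1%g by exact: (etrans (esym (grpalg_embS (gdelta R[i] g))) (congr1 _ (gdeltaS R g))).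
have [W WE] := unitary_part pi cM c1 cS.
have /choice[e eP] n := compact_projection_basis (proj1 (Pp n)) (proj2 (Pp n)).
apply: (@compression_MF R G H W P e (fun n => proj1 (Pp n)) (fun n => proj1 (eP n))
  (fun n => proj2 (eP n))).
- by move=> v; apply/vcvgP; exact: Pcvg.
- move=> g r r0; pose D a n v := P n (pi a v) - pi a (P n v).
  have Dle h n v : vnorm (inner H) (D (c h) n v) <= opnorm (inner H) (D (c h) n) * vnorm (inner H) v.
    apply: commutator_opnorm => u; last exact: (srep_group_le pi cM c1 cS).
    exact: projection_le (proj1 (Pp n)) _.
  have r2 : 0 < r / 2 by rewrite divr_gt0.
  have small h : exists N, forall n, (N <= n)%N -> opnorm (inner H) (D (c h) n) <= r / 2.
    have /cvg0P := Pcomm (pi (c h)) (ex_intro2 _ _ (c h) I erefl).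
    by move=> /(_ (fun n => opnorm_ge0 _ _)); apply.
  have [N NP] := small g; have [M MP] := small 1%g.
  exists (maxn N M) => n; rewrite geq_max => /andP[Nn Mn] v.
  have -> : P n (W g v) - W g (P n v) = D (c g) n v - D (c 1%g) n v.
    exact: (commutator_affine (P n) (WE g)).
  rewrite [r]splitr mulrDl (le_trans (ler_vnormD _ _ _))// vnormN; apply: lerD.
    by apply: le_trans (Dle _ _ _) _; rewrite ler_wpM2r ?vnorm_ge0// NP.
  by apply: le_trans (Dle _ _ _) _; rewrite ler_wpM2r ?vnorm_ge0// MP.
(* The complement term is the same for g and h, so W g = W h means pi (c g) = pi (c h), and
   faithfulness identifies the classes. *)
move=> g h gh; apply: (@univ_norm_gdelta R G) => //; apply: grpalg_emb_eq.
apply: full => v; exact: addIr (etrans (esym (WE g v)) (etrans (gh v) (WE h v))).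
Qed.

Theorem theorem2p8 (R : realType) (G : groupType)
    (G_countable : countable [set: G]) (G_amenable : amenable R G) :
  MF R G <-> quasidiagonal (group_Cstar R G).
Proof.
by split; [exact: MF_quasidiagonal|exact: quasidiagonal_MF].
Qed.
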